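(* Let $R$ be an artin algebra, $\mathcal{A}=\mathrm{mod}(R)$, and let $\mathcal{C}\subseteq\mathcal{A}$ be a full additive, strictly full, Karoubi closed subcategory which is functorially finite. Then $\pi_{\mathcal{C}}:\mathcal{H}_{\mathcal{A}}\to\mathcal{H}_{\mathcal{C}}$ is a quotient functor, i.e. $\pi_{\mathcal{C}}$ has a right adjoint $\sigma$ such that the adjunction morphism $\pi_{\mathcal{C}}\circ\sigma\to\mathrm{Id}_{\mathcal{H}_{\mathcal{C}}}$ is an isomorphism.
   Context: $\mathrm{mod}(R)$ is the category of finitely generated left $R$-modules. Strictly full means closed under isomorphisms; Karoubi closed means closed under direct summands in $\mathcal{A}$. $\mathcal{T}_{\mathcal{C}}=K^-(\mathcal{C})$ (bounded above cochain complexes modulo homotopy) is a full triangulated subcategory of $\mathcal{T}_{\mathcal{A}}=K^-(\mathcal{A})$. A $\mathcal{C}$-approximation of $X\in\mathcal{T}_{\mathcal{A}}$ is a quasi-isomorphism $X_{\mathcal{C}}\to X$ with $X_{\mathcal{C}}\in\mathcal{T}_{\mathcal{C}}$ inducing an isomorphism $\mathrm{Hom}_{\mathcal{T}_{\mathcal{C}}}(-,X_{\mathcal{C}})\to\mathrm{Hom}_{\mathcal{T}_{\mathcal{A}}}(-,X)|_{\mathcal{T}_{\mathcal{C}}}$. $\mathcal{C}$ is $\mathcal{A}$-approximating if every $X\in\mathcal{T}_{\mathcal{A}}$ has a $\mathcal{C}$-approximation (equivalently, every $M\in\mathcal{A}$ has a $\mathcal{C}$-cover: a surjection $C\to M$ with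 $C\in\mathcal{C}$ through which every map $C'\to M$, $C'\in\mathcal{C}$, factors); then $\pi_{\mathcal{C}}X=X_{\mathcal{C}}$ defines a functor $\pi_{\mathcal{C}}:\mathcal{T}_{\mathcal{A}}\to\mathcal{T}_{\mathcal{C}}$ right adjoint to the inclusion. $\mathcal{C}$ is functorially finite if $\mathcal{C}$ is $\mathcal{A}$-approximating and $\mathcal{C}^{op}$ is $\mathcal{A}^{op}$-approximating. $\mathcal{H}_{\mathcal{A}}$ is the abelian category of complexes $[X^{-2}\to X^{-1}\to X^0]$ in $\mathcal{A}$ (degrees $-2,-1,0$) with no cohomology in negative degrees, morphisms modulo homotopy; it is the heart of the $t$-structure on $\mathcal{T}_{\mathcal{A}}$ whose $\leq 0$ part is generated by complexes with $X^i=0$ for $i>0$. $\mathcal{T}^{\leq 0}_{\mathcal{C}}$ is the strictly full subcategory of $\mathcal{T}_{\mathcal{C}}$ generated by complexes with $X^i=0$ for $i>0$; it is the $\leq 0$ part of a $t$-structure with $\mathcal{T}^{\geq 0}_{\mathcal{C}}=\{X\mid\mathrm{Hom}_{\mathcal{T}_{\mathcal{C}}}(\mathcal{T}^{\leq 0}_{\mathcal{C}}[1],X)=0\}$, and $\mathcal{H}_{\mathcal{C}}=\mathcal{T}^{\leq 0}_{\mathcal{C}}\cap\mathcal{T}^{\geq 0}_{\mathcal{C}}$ is its heart, an abelian category. One has $\pi_{\mathcal{C}}(\mathcal{H}_{\mathcal{A}})=\mathcal{H}_{\mathcal{C}}$, so $\pi_{\mathcal{C}}$ restricts to $\mathcal{H}_{\mathcal{A}}\to\mathcal{H}_{\mathcal{C}}$.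 *)

(* Defs.v *)
From Stdlib Require Import ClassicalEpsilon.
From HB Require Import structures.
From mathcomp Require Import all_boot all_order all_algebra.

Set Implicit Arguments.
Unset Strict Implicit.
Unset Printing Implicit Defensive.

Import Order.TTheory GRing.Theory Num.Theory.
Local Open Scope ring_scope.

(* Categories are setoid-enriched: [heq] plays the role of equality of         *)
(* morphisms.  For homotopy categories, morphisms are chain maps and [heq] is  *)
(* homotopy.  [hcomp g f] is "g after f".                                      *)

Record category := Category {
  obj :> Type;
  hom : obj -> obj -> Type;
  heq : forall X Y, hom X Y -> hom X Y -> Prop;
  hid : forall X, hom X X;
  hcomp : forall X Y Z, hom Y Z -> hom X Y -> hom X Z;
  heq_refl : forall X Y (f : hom X Y), heq f f;
  heq_sym : forall X Y (f g : hom X Y), heq f g -> heq g f;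
  heq_trans : forall X Y (f g h : hom X Y), heq f g -> heq g h -> heq f h;
  hcomp_heq : forall X Y Z (g g' : hom Y Z) (f f' : hom X Y),
    heq g g' -> heq f f' -> heq (hcomp g f) (hcomp g' f');
  hcomp_idl : forall X Y (f : hom X Y), heq (hcomp (hid Y) f) f;
  hcomp_idr : forall X Y (f : hom X Y), heq (hcomp f (hid X)) f;
  hcompA : forall X Y Z W (h : hom Z W) (g : hom Y Z) (f : hom X Y),
    heq (hcomp h (hcomp g f)) (hcomp (hcomp h g) f)
}.

Arguments hid {c} X.

Definition is_iso (A : category) (X Y : A) (f : hom X Y) : Prop :=
  exists g : hom Y X, heq (hcomp g f) (hid X) /\ heq (hcomp f g) (hid Y).

Definition isomorphic (A : category) (X Y : A) : Prop :=
  exists f : hom X Y, is_iso f.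

Record functor (A B : category) := Functor {
  fobj :> A -> B;
  fmap : forall X Y, hom X Y -> hom (fobj X) (fobj Y);
  fmap_heq : forall X Y (f g : hom X Y), heq f g -> heq (fmap f) (fmap g);
  fmap_id : forall X, heq (fmap (hid X)) (hid (fobj X));
  fmap_comp : forall X Y Z (g : hom Y Z) (f : hom X Y),
    heq (fmap (hcomp g f)) (hcomp (fmap g) (fmap f))
}.

Arguments fmap {A B} F {X Y} f : rename.

(* F is left adjoint to G. *)
Record adjunction (A B : category) (F : functor A B) (G : functor B A) :=
  Adjunction {
  adj_unit : forall X : A, hom X (G (F X));
  adj_counit : forall Y : B, hom (F (G Y)) Y;
  adj_unit_natural : forall (X X' : A) (f : hom X X'),
    heq (hcomp (adj_unit X') f) (hcomp (fmap G (fmap F f)) (adj_unit X));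
  adj_counit_natural : forall (Y Y' : B) (g : hom Y Y'),
    heq (hcomp g (adj_counit Y)) (hcomp (adj_counit Y') (fmap F (fmap G g)));
  triangle_l : forall X : A,
    heq (hcomp (adj_counit (F X)) (fmap F (adj_unit X))) (hid (F X));
  triangle_r : forall Y : B,
    heq (hcomp (fmap G (adj_counit Y)) (adj_unit (G Y))) (hid (G Y))
}.

Arguments adj_counit {A B F G} a Y : rename.

Definition is_quotient_functor (A B : category) (F : functor A B) : Prop :=
  exists (G : functor B A) (adj : adjunction F G),
    forall Y : B, is_iso (adj_counit adj Y).

Definition full_subcategory (A : category) (P : A -> Prop) : category :=
  @Category {X : A | P X}
    (fun X Y => hom (sval X) (sval Y))
    (fun X Y f g => heq f g)
    (fun X => hid (sval X))
    (fun X Y Z g f => hcomp g f)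
    (fun X Y f => heq_refl f)
    (fun X Y f g => @heq_sym A _ _ f g)
    (fun X Y f g h => @heq_trans A _ _ f g h)
    (fun X Y Z g g' f f' => @hcomp_heq A _ _ _ g g' f f')
    (fun X Y f => hcomp_idl f)
    (fun X Y f => hcomp_idr f)
    (fun X Y Z W h g f => hcompA h g f).

Definition restrict_functor (A B : category) (F : functor A B)
    (P : A -> Prop) (Q : B -> Prop) (PQ : forall X, P X -> Q (F X)) :
    functor (full_subcategory P) (full_subcategory Q) :=
  @Functor (full_subcategory P) (full_subcategory Q)
    (fun X => exist Q (F (sval X)) (PQ (sval X) (svalP X)))
    (fun X Y f => fmap F f)
    (fun X Y f g => @fmap_heq _ _ F _ _ f g)
    (fun X => fmap_id F (sval X))
    (fun X Y Z g f => fmap_comp F g f).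

Section Modules.

Variable R : pzRingType.

Definition finitely_generated (M : lmodType R) : Prop :=
  exists (n : nat) (e : 'I_n -> M),
    forall x : M, exists c : 'I_n -> R, x = \sum_(i < n) c i *: e i.

Definition zero_module (M : lmodType R) : Prop := forall x : M, x = 0.

Definition module_iso (M N : lmodType R) : Prop :=
  exists f : {linear M -> N}, bijective f.

(* A full subcategory of the category of modules is given by its objects. *)
Record additive_karoubi_subcategory (C : lmodType R -> Prop) : Prop := {
  subcat_fg : forall M, C M -> finitely_generated M;
  subcat_iso : forall M N, module_iso M N -> C M -> C N;
  subcat_zero : forall M, zero_module M -> C M;
  subcat_sum : forall M N : lmodType R, C M -> C N -> C (M * N)%type;
  subcat_summand : forall M N : lmodType R, C (M * N)%type -> C M
}.

End Modules.

Definition is_ideal (k : comPzRingType) (I : k -> Prop) : Prop :=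
  [/\ I 0, forall x y, I x -> I y -> I (x + y) & forall a x, I x -> I (a * x)].

Definition artinian_ring (k : comPzRingType) : Prop :=
  forall I : nat -> k -> Prop,
    (forall n, is_ideal (I n)) -> (forall n x, I n.+1 x -> I n x) ->
    exists N : nat, forall n x, (N <= n)%N -> I N x -> I n x.

(* The structure morphism k -> R is used instead of [algType k], which would *)
(* exclude the zero ring.                                                    *)
Definition artin_algebra (R : pzRingType) : Prop :=
  exists (k : comPzRingType) (phi : {rmorphism k -> R}),
    [/\ artinian_ring k,
        forall a x, phi a * x = x * phi a
      & exists (n : nat) (e : 'I_n -> R),
          forall x : R, exists c : 'I_n -> k, x = \sum_(i < n) phi (c i) * e i].

Section Complexes.

Variable R : pzRingType.

(* Cochain complexes indexed by all integers.  Since every integer is of the  *)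
(* form n + 1, conditions "in every degree" are written in degree n + 1 when  *)
(* this avoids a transport along (n - 1) + 1 = n.                             *)
Record complex := Complex {
  cterm :> int -> lmodType R;
  cdiff : forall n, {linear cterm n -> cterm (n + 1)};
  cdiffK : forall n (x : cterm n), cdiff (n + 1) (cdiff n x) = 0
}.

Arguments cdiff X n : rename.

Record chain_map (X Y : complex) := ChainMap {
  cmap :> forall n, {linear X n -> Y n};
  cmap_diff : forall n (x : X n), cmap (n + 1) (cdiff X n x) = cdiff Y n (cmap n x)
}.

Definition homotopic (X Y : complex) (f g : chain_map X Y) : Prop :=
  exists h : forall n, {linear X (n + 1) -> Y n},
    forall n (x : X (n + 1)),
      f (n + 1) x - g (n + 1) x = cdiff Y n (h n x) + h (n + 1) (cdiff X (n + 1) x).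

Program Definition chain_id (X : complex) : chain_map X X :=
  @ChainMap X X (fun n => idfun) _.

Program Definition chain_comp (X Y Z : complex)
    (g : chain_map Y Z) (f : chain_map X Y) : chain_map X Z :=
  @ChainMap X Z (fun n => g n \o f n) _.
Next Obligation. by rewrite !cmap_diff. Qed.

Program Definition chain_zero (X Y : complex) : chain_map X Y :=
  @ChainMap X Y (fun n => \0) _.
Next Obligation. by rewrite linear0. Qed.

Lemma homotopic_refl X Y (f : chain_map X Y) : homotopic f f.
Proof. by exists (fun n => \0) => n x /=; rewrite subrr linear0 addr0. Qed.

Lemma homotopic_sym X Y (f g : chain_map X Y) : homotopic f g -> homotopic g f.
Proof.
case=> h hP; exists (fun n => \- h n) => n x /=.
by rewrite -opprB hP linearN opprD.
Qed.

Lemma homotopic_trans X Y (f g h : chain_map X Y) :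
  homotopic f g -> homotopic g h -> homotopic f h.
Proof.
case=> s sP [t tP]; exists (fun n => s n \+ t n) => n x /=.
by rewrite linearD addrACA -sP -tP addrA subrK.
Qed.

Lemma homotopic_comp X Y Z (g g' : chain_map Y Z) (f f' : chain_map X Y) :
  homotopic g g' -> homotopic f f' ->
  homotopic (chain_comp g f) (chain_comp g' f').
Proof.
case=> s sP [t tP].
exists (fun n => (s n \o f (n + 1)) \+ (g' n \o t n)) => n x /=.
rewrite linearD addrACA cmap_diff -sP -cmap_diff -linearD -tP linearB.
by rewrite addrA subrK.
Qed.

Lemma eq_homotopic X Y (f g : chain_map X Y) :
  (forall n x, f n x = g n x) -> homotopic f g.
Proof.
move=> fg; exists (fun n => \0) => n x /=.
by rewrite fg subrr linear0 addr0.
Qed.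

Definition homotopy_category : category :=
  @Category complex chain_map homotopic chain_id chain_comp
    homotopic_refl homotopic_sym homotopic_trans homotopic_comp
    (fun X Y f => eq_homotopic (fun n x => erefl))
    (fun X Y f => eq_homotopic (fun n x => erefl))
    (fun X Y Z W h g f => eq_homotopic (fun n x => erefl)).

Program Definition shift (X : complex) : complex :=
  @Complex (fun n => X (n + 1)) (fun n => \- cdiff X (n + 1)) _.
Next Obligation. by rewrite linearN opprK cdiffK. Qed.

(* f induces an injection, resp. a surjection, on each H^(n+1). *)
Definition quasi_iso (X Y : complex) (f : chain_map X Y) : Prop :=
  (forall n (x : X (n + 1)), cdiff X (n + 1) x = 0 ->
     (exists y : Y n, f (n + 1) x = cdiff Y n y) ->
     exists w : X n, x = cdiff X n w) /\
  (forall n (y : Y (n + 1)), cdiff Y (n + 1) y = 0 ->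
     exists2 x : X (n + 1), cdiff X (n + 1) x = 0 &
     exists w : Y n, y - f (n + 1) x = cdiff Y n w).

Section Subcategory.

Variable C : lmodType R -> Prop.

Definition bounded_above (X : complex) : Prop :=
  exists N : int, forall n, N < n -> zero_module (X n).

Definition bounded_below (X : complex) : Prop :=
  exists N : int, forall n, n < N -> zero_module (X n).

Definition Kminus (X : complex) : Prop :=
  (forall n, C (X n)) /\ bounded_above X.

Definition Kplus (X : complex) : Prop :=
  (forall n, C (X n)) /\ bounded_below X.

Definition is_approximation (X XC : complex) (e : chain_map XC X) : Prop :=
  [/\ Kminus XC, quasi_iso e
    & forall Y, Kminus Y ->
        (forall f : chain_map Y X, exists g : chain_map Y XC,
           homotopic (chain_comp e g) f) /\
        (forall g g' : chain_map Y XC,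
           homotopic (chain_comp e g) (chain_comp e g') -> homotopic g g')].

(* The same notion for C^op in mod(R)^op, in terms of mod(R): reversing arrows *)
(* and degrees, a bounded above complex over mod(R)^op is a bounded below      *)
(* complex over mod(R), and X_C -> X becomes X -> X_C.                         *)
Definition is_op_approximation (X XC : complex) (e : chain_map X XC) : Prop :=
  [/\ Kplus XC, quasi_iso e
    & forall Y, Kplus Y ->
        (forall f : chain_map X Y, exists g : chain_map XC Y,
           homotopic (chain_comp g e) f) /\
        (forall g g' : chain_map XC Y,
           homotopic (chain_comp g e) (chain_comp g' e) -> homotopic g g')].

Record approximation (X : complex) := Approximation {
  apx : complex;
  apx_map : chain_map apx X;
  apxP : is_approximation apx_map
}.

End Subcategory.

Local Notation fg := (@finitely_generated R).

Definition approximating (C : lmodType R -> Prop) : Prop :=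
  forall X, Kminus fg X ->
    exists (XC : complex) (e : chain_map XC X), is_approximation C e.

Definition op_approximating (C : lmodType R -> Prop) : Prop :=
  forall X, Kplus fg X ->
    exists (XC : complex) (e : chain_map X XC), is_op_approximation C e.

Definition functorially_finite (C : lmodType R -> Prop) : Prop :=
  approximating C /\ op_approximating C.

(* The category K^-(C); K^-(mod R) is the case C = finitely_generated. *)
Definition Tcat (C : lmodType R -> Prop) : category :=
  @full_subcategory homotopy_category (Kminus C).

Definition in_nonpositive_degrees (X : complex) : Prop :=
  forall n : int, 0 < n -> zero_module (X n).

Definition T_le0 (C : lmodType R -> Prop) (X : Tcat C) : Prop :=
  exists2 Y : Tcat C, in_nonpositive_degrees (sval Y) & isomorphic X Y.

Definition T_ge0 (C : lmodType R -> Prop) (X : Tcat C) : Prop :=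
  forall Y : Tcat C, T_le0 Y ->
    forall f : chain_map (shift (sval Y)) (sval X),
      homotopic f (chain_zero (shift (sval Y)) (sval X)).

Definition in_H_C (C : lmodType R -> Prop) (X : Tcat C) : Prop :=
  T_le0 X /\ T_ge0 X.

Definition in_H_A (X : Tcat fg) : Prop :=
  (forall n : int, ~~ (-2 <= n <= 0) -> zero_module (sval X n)) /\
  (forall n : int, n + 1 < 0 -> forall x : sval X (n + 1),
     cdiff (sval X) (n + 1) x = 0 -> exists y : sval X n, x = cdiff (sval X) n y).

Definition H_C (C : lmodType R -> Prop) : category :=
  full_subcategory (@in_H_C C).

Definition H_A : category := full_subcategory in_H_A.

Section Projection.

Variable C : lmodType R -> Prop.

(* A choice of a C-approximation of every object of K^-(mod R). *)
Variable app : forall X : Tcat fg, approximation C (sval X).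

Definition pi_obj (X : Tcat fg) : Tcat C :=
  exist (Kminus C) (apx (app X)) (let: And3 h _ _ := apxP (app X) in h).

Lemma pi_map_exists (X Y : Tcat fg) (f : hom X Y) :
  exists g : chain_map (apx (app X)) (apx (app Y)),
    homotopic (chain_comp (apx_map (app Y)) g)
              (chain_comp f (apx_map (app X))).
Proof.
case: (apxP (app Y)) => _ _ /(_ _ (svalP (pi_obj X))) [lift _].
exact: lift.
Qed.

Definition pi_map (X Y : Tcat fg) (f : hom X Y) : hom (pi_obj X) (pi_obj Y) :=
  sval (constructive_indefinite_description _ (pi_map_exists f)).

Lemma pi_mapP (X Y : Tcat fg) (f : hom X Y) :
  homotopic (chain_comp (apx_map (app Y)) (pi_map f))
            (chain_comp f (apx_map (app X))).
Proof. by rewrite /pi_map; case: constructive_indefinite_description. Qed.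

Lemma pi_map_unique (X Y : Tcat fg) (g g' : hom (pi_obj X) (pi_obj Y)) :
  homotopic (chain_comp (apx_map (app Y)) g) (chain_comp (apx_map (app Y)) g') ->
  homotopic g g'.
Proof.
case: (apxP (app Y)) => _ _ /(_ _ (svalP (pi_obj X))) [_ inj].
exact: inj.
Qed.

Lemma pi_map_heq (X Y : Tcat fg) (f g : hom X Y) :
  heq f g -> heq (pi_map f) (pi_map g).
Proof.
move=> fg; apply: pi_map_unique.
apply: homotopic_trans (pi_mapP f) _.
apply: homotopic_trans (homotopic_sym (pi_mapP g)).
exact: homotopic_comp (homotopic_refl _).
Qed.

Lemma pi_map_id (X : Tcat fg) : heq (pi_map (hid X)) (hid (pi_obj X)).
Proof.
apply: pi_map_unique; apply: homotopic_trans (pi_mapP _) _.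
exact: eq_homotopic.
Qed.

Lemma pi_map_comp (X Y Z : Tcat fg) (g : hom Y Z) (f : hom X Y) :
  heq (pi_map (hcomp g f)) (hcomp (pi_map g) (pi_map f)).
Proof.
apply: pi_map_unique; apply: homotopic_trans (pi_mapP _) _.
apply: homotopic_sym.
apply: (@homotopic_trans _ _ _
  (chain_comp (chain_comp (apx_map (app Z)) (pi_map g)) (pi_map f))).
  exact: eq_homotopic.
apply: homotopic_trans
  (homotopic_comp (pi_mapP g) (homotopic_refl (pi_map f))) _.
apply: (@homotopic_trans _ _ _
  (chain_comp g (chain_comp (apx_map (app Y)) (pi_map f)))).
  exact: eq_homotopic.
apply: homotopic_trans
  (homotopic_comp (homotopic_refl g) (pi_mapP f)) _.
exact: eq_homotopic.
Qed.

Definition pi_functor : functor (Tcat fg) (Tcat C) :=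
  @Functor (Tcat fg) (Tcat C) pi_obj pi_map pi_map_heq pi_map_id pi_map_comp.

End Projection.

End Complexes.

Arguments H_A R : clear implicits.

(* Main.v *)
Require Import Defs.
From mathcomp Require Import all_boot all_order all_algebra.
From HB Require Import structures.
From mathcomp Require Import boolp zify.
From mathcomp Require classical_sets.

(* In terms of finitely presented functors, [H_A R] and [H_C C] are [mod A] and
   [mod C], and [pi] restricts functors from [A] to [C]; the right adjoint of the
   restriction must be shown to preserve finite presentation.  An object [Y] of
   [H_C C] is determined by the functor that it represents, and the point is to
   describe that functor by duality: with [D = Hom_k(-, E)] for an injective
   cogenerator [E] of the modules over the artinian base ring [k], there are
   [beta : B0 -> B1] in [C] with
     Hom(X, Y) = { f in D Hom(B0, X) | f kills the maps factoring through beta },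
   where [Hom] is taken up to homotopy.  The right-hand side only involves maps
   from [B0] and [B1] to [X], so it does not see the difference between [X] and
   its [C]-approximation; and it is representable on [H_A R] as well, by the
   value at [Y] of the right adjoint.

   Existence of [beta] uses generators and relations for the tensor product
   functors [DY (x) -] together with [C]-preenvelopes; representability on
   [H_A R] uses the Nakayama-type isomorphisms [D Hom(R^J, M) = Hom(M, D R^J)].
   The cogenerator [E] is a [k]-module of maximal length among those with a
   multiplicity-free socle. *)

Set Implicit Arguments.
Unset Strict Implicit.
Unset Printing Implicit Defensive.

Import Order.TTheory GRing.Theory Num.Theory.
Local Open Scope ring_scope.

(** * Submodules and quotients *)

Section LinearMaps.

Variable R : pzRingType.
Implicit Types U V W : lmodType R.

(** Both constructions concern one exact sequence Hom(X, Y1) -> Hom(X, Y0) -> D Hom(B0, X) -> D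
    Hom(B1, X), read from its two ends: a map Y1 -> Y0 in [C] determines B0 -> B1 so that it is
    exact for X in [C], and B0 -> B1 determines modules Z1 -> Z0 so that it is exact for every X.
    Complexes enter only afterwards, since an object of either heart is controlled by its
    differential from degree -1 to degree 0. Double duals are never formed. What is used of duality
    is that a functional on one side of a pairing with values in E, if it kills the kernel of the
    pairing, is evaluation at an element of the other side. This needs E injective with only scalar
    endomorphisms. Both properties are obtained by induction along a fixed composition series of k,
    without decomposing k into local factors. *)

Definition mklin U V (f : U -> V) (lin_f : linear f) : {linear U -> V} :=
  HB.pack f (GRing.isLinear.Build R U V *:%R f lin_f).

Lemma linear_ext U V (f g : {linear U -> V}) : f =1 g -> f = g.
Proof.
case: f g => [f [[df] [sf]]] [g [[dg] [sg]]] /= /funext fg.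
by subst g; rewrite (Prop_irrelevance df dg) (Prop_irrelevance sf sg).
Qed.

Lemma linZ U V (f : {linear U -> V}) a x : f (a *: x) = a *: f x.
Proof. by rewrite linearZ. Qed.

Lemma linP U V (f : {linear U -> V}) a x y : f (a *: x + y) = a *: f x + f y.
Proof. by rewrite linearP. Qed.

Lemma linear_comb U V (f : {linear U -> V}) (I : finType) (c : I -> R) (e : I -> U) :
  f (\sum_i c i *: e i) = \sum_i c i *: f (e i).
Proof. by rewrite linear_sum; apply: eq_bigr => i _; rewrite linZ. Qed.

Lemma linear_inj U V (f : {linear U -> V}) :
  (forall x, f x = 0 -> x = 0) -> injective f.
Proof.
by move=> f0 x y fxy; apply/subr0_eq/f0; rewrite linearB fxy subrr.
Qed.

Definition pair_lin U V W (f : {linear U -> V}) (g : {linear U -> W}) :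
  {linear U -> (V * W)%type}.
Proof.
apply: (@mklin _ _ (fun x => (f x, g x))) => a x y.
by rewrite !linearP.
Defined.

Definition fst_lin U V : {linear (U * V)%type -> U}.
Proof. by apply: (@mklin _ _ fst). Defined.

Definition snd_lin U V : {linear (U * V)%type -> V}.
Proof. by apply: (@mklin _ _ snd). Defined.

Lemma factor_surj U V W (p : {linear U -> V}) (f : {linear U -> W}) :
  (forall y, exists x, p x = y) -> (forall x, p x = 0 -> f x = 0) ->
  exists g : {linear V -> W}, forall x, g (p x) = f x.
Proof.
move=> p_surj pf; have [s sK] := choice p_surj.
have fs x : f (s (p x)) = f x.
  by apply/subr0_eq; rewrite -linearB; apply: pf; rewrite linearB sK subrr.
suff lin_g : linear (f \o s) by exists (mklin lin_g).
by move=> a y z /=; rewrite -linearP -[RHS]fs linearP !sK.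
Qed.

Lemma factor_inj U V W (i : {linear V -> W}) (f : {linear U -> W}) :
  injective i -> (forall x, exists y, i y = f x) ->
  exists g : {linear U -> V}, forall x, i (g x) = f x.
Proof.
move=> i_inj /choice [g gP].
suff lin_g : linear g by exists (mklin lin_g).
by move=> a y z; apply: i_inj; rewrite gP !linearP !gP.
Qed.

End LinearMaps.

Section Submodules.

Variables (R : pzRingType) (M : lmodType R).

Record submod := Submod {
  submod_in :> M -> Prop;
  submod0 : submod_in 0;
  submodP : forall a x y, submod_in x -> submod_in y -> submod_in (a *: x + y)
}.

Implicit Types P Q : submod.

Lemma submodZ P a x : P x -> P (a *: x).
Proof. by move=> Px; rewrite -[_ *: _]addr0; apply: submodP => //; apply: submod0. Qed.

Lemma submodD P x y : P x -> P y -> P (x + y).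
Proof. by rewrite -{2}[x]scale1r; apply: submodP. Qed.

Lemma submodN P x : P x -> P (- x).
Proof. by rewrite -scaleN1r; apply: submodZ. Qed.

Lemma submodB P x y : P x -> P y -> P (x - y).
Proof. by move=> Px Py; apply/submodD/submodN. Qed.

Lemma submod_sum P (I : finType) (p : pred I) (F : I -> M) :
  (forall i, p i -> P (F i)) -> P (\sum_(i | p i) F i).
Proof.
move=> PF; elim/big_rec: _ => [|i x pi Px]; first exact: submod0.
by apply: submodD; first exact: PF.
Qed.

(** Membership is made boolean, so that elements with equal values are equal and the choice
    structure is inherited. *)
Definition submod_type P := {x : M | `[< P x >]}.

Section SubmodType.

Variable P : submod.

HB.instance Definition _ := Choice.on (submod_type P).

Definition in_submod (x : M) (Px : P x) : submod_type P :=
  exist _ x (asboolT Px).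

Lemma submod_typeP (x : submod_type P) : P (sval x).
Proof. by case: x => x /= /asboolP. Qed.

Lemma submod_type_inj (x y : submod_type P) : sval x = sval y -> x = y.
Proof. exact: val_inj. Qed.

Let zero := in_submod (submod0 P).
Let opp x := in_submod (submodN (submod_typeP x)).
Let add x y := in_submod (submodD (submod_typeP x) (submod_typeP y)).
Let scale a x := in_submod (submodZ a (submod_typeP x)).

Fact submod_addA : associative add.
Proof. by move=> x y z; apply: val_inj; rewrite /= addrA. Qed.
Fact submod_addC : commutative add.
Proof. by move=> x y; apply: val_inj; rewrite /= addrC. Qed.
Fact submod_add0 : left_id zero add.
Proof. by move=> x; apply: val_inj; rewrite /= add0r. Qed.
Fact submod_addN : left_inverse zero opp add.
Proof. by move=> x; apply: val_inj; rewrite /= addNr. Qed.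

HB.instance Definition _ := GRing.isZmodule.Build (submod_type P)
  submod_addA submod_addC submod_add0 submod_addN.

Fact submod_scaleA a b x : scale a (scale b x) = scale (a * b) x.
Proof. by apply: val_inj; rewrite /= scalerA. Qed.
Fact submod_scale1 : left_id 1 scale.
Proof. by move=> x; apply: val_inj; rewrite /= scale1r. Qed.
Fact submod_scaleDr : right_distributive scale +%R.
Proof. by move=> a x y; apply: val_inj; rewrite /= scalerDr. Qed.
Fact submod_scaleDl x : {morph scale^~ x : a b / a + b}.
Proof. by move=> a b; apply: val_inj; rewrite /= scalerDl. Qed.

HB.instance Definition _ := GRing.Zmodule_isLmodule.Build R (submod_type P)
  submod_scaleA submod_scale1 submod_scaleDr submod_scaleDl.

Definition submod_val : {linear submod_type P -> M}.
Proof. by apply: (@mklin R (submod_type P) M sval). Defined.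

End SubmodType.

Section QuotientConstruction.

Variable P : submod.

(** Started from any member of a coset, [choose] returns the same element, because members of one
    coset define the same predicate. The quotient is the set of these canonical representatives. *)
Definition quot_rep (x : M) : M := choose (fun y => `[< P (x - y) >]) x.

Lemma quot_repP x : P (x - quot_rep x).
Proof.
apply/asboolP; apply: (@chooseP _ (fun y => `[< P (x - y) >])).
by apply/asboolP; rewrite subrr; apply: submod0.
Qed.

Lemma quot_rep_eq x y : P (x - y) -> quot_rep x = quot_rep y.
Proof.
move=> Pxy; rewrite /quot_rep.
have e : (fun z => `[< P (x - z) >]) = (fun z => `[< P (y - z) >]).
  apply/funext => z; apply/asbool_equiv_eq; split => [Pz|Pz].
    by rewrite -[y - z](subrKA x) -opprB; apply: submodD => //; apply: submodN.
  by rewrite -[x - z](subrKA y); apply: submodD.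
rewrite -e; apply: choose_id.
  by apply/asboolP; rewrite subrr; apply: submod0.
exact/asboolP.
Qed.

Lemma quot_rep_idem x : quot_rep (quot_rep x) == quot_rep x.
Proof. by rewrite eq_sym; apply/eqP/quot_rep_eq/quot_repP. Qed.

Definition raw_quot := {x : M | quot_rep x == x}.

HB.instance Definition _ := Choice.on raw_quot.

Definition to_quot (x : M) : raw_quot := exist _ (quot_rep x) (quot_rep_idem x).

Lemma to_quot_val (x : raw_quot) : to_quot (sval x) = x.
Proof. by apply: val_inj; rewrite /=; apply/eqP/(svalP x). Qed.

Lemma to_quot_eq x y : P (x - y) -> to_quot x = to_quot y.
Proof. by move=> Pxy; apply: val_inj; rewrite /=; apply: quot_rep_eq. Qed.

Lemma to_quot_inv x y : to_quot x = to_quot y -> P (x - y).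
Proof.
move=> /(congr1 sval) /= xy; rewrite -[x - y](subrKA (quot_rep x)) {2}xy.
by apply: submodD; [|rewrite -opprB; apply: submodN]; apply: quot_repP.
Qed.

Let zero := to_quot 0.
Let opp (x : raw_quot) := to_quot (- sval x).
Let add (x y : raw_quot) := to_quot (sval x + sval y).
Let scale a (x : raw_quot) := to_quot (a *: sval x).

Let oppE x : opp (to_quot x) = to_quot (- x).
Proof. by apply: to_quot_eq; rewrite opprK addrC; apply: quot_repP. Qed.
Let addE x y : add (to_quot x) (to_quot y) = to_quot (x + y).
Proof.
apply: to_quot_eq; rewrite opprD addrACA.
by apply: submodD; rewrite -opprB; apply/submodN/quot_repP.
Qed.
Let scaleE a x : scale a (to_quot x) = to_quot (a *: x).
Proof.
apply: to_quot_eq; rewrite -scalerBr; apply: submodZ.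
by rewrite -opprB; apply/submodN/quot_repP.
Qed.

Fact quot_addA : associative add.
Proof.
move=> x y z; rewrite -[x]to_quot_val -[y]to_quot_val -[z]to_quot_val.
by rewrite !addE addrA.
Qed.
Fact quot_addC : commutative add.
Proof. by move=> x y; rewrite -[x]to_quot_val -[y]to_quot_val !addE addrC. Qed.
Fact quot_add0 : left_id zero add.
Proof. by move=> x; rewrite -[x]to_quot_val addE add0r. Qed.
Fact quot_addN : left_inverse zero opp add.
Proof. by move=> x; rewrite -[x]to_quot_val oppE addE addNr. Qed.

HB.instance Definition _ := GRing.isZmodule.Build raw_quot
  quot_addA quot_addC quot_add0 quot_addN.

Fact quot_scaleA a b x : scale a (scale b x) = scale (a * b) x.
Proof. by rewrite -[x]to_quot_val !scaleE scalerA. Qed.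
Fact quot_scale1 : left_id 1 scale.
Proof. by move=> x; rewrite -[x]to_quot_val scaleE scale1r. Qed.
Fact quot_scaleDr : right_distributive scale +%R.
Proof.
move=> a x y; rewrite -[x]to_quot_val -[y]to_quot_val.
by rewrite [_ + _]addE !scaleE scalerDr; symmetry; apply: addE.
Qed.
Fact quot_scaleDl x : {morph scale^~ x : a b / a + b}.
Proof. by move=> a b; rewrite -[x]to_quot_val !scaleE scalerDl; symmetry; apply: addE. Qed.

HB.instance Definition _ := GRing.Zmodule_isLmodule.Build R raw_quot
  quot_scaleA quot_scale1 quot_scaleDr quot_scaleDl.

Fact to_quot_linear : linear to_quot.
Proof. by move=> a x y; rewrite -addE -scaleE. Qed.

Definition raw_quot_map : {linear M -> raw_quot} := mklin to_quot_linear.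

Lemma raw_quot_surj y : exists x, raw_quot_map x = y.
Proof. by exists (sval y); apply: to_quot_val. Qed.

Lemma raw_quot_eq0 x : raw_quot_map x = 0 <-> P x.
Proof.
rewrite -(linear0 raw_quot_map); split=> [/to_quot_inv|Px]; first by rewrite subr0.
by apply: to_quot_eq; rewrite subr0.
Qed.

End QuotientConstruction.

(* Sealed, so that unification never unfolds the module structure of quotients. *)
Lemma quot_spec (P : submod) :
  {Q : lmodType R & {p : {linear M -> Q} |
    (forall y, exists x, p x = y) /\ (forall x, p x = 0 <-> P x)}}.
Proof.
exists (raw_quot P), (raw_quot_map P); split; first exact: raw_quot_surj.
exact: raw_quot_eq0.
Qed.

Definition quot (P : submod) : lmodType R := projT1 (quot_spec P).
Definition quot_map (P : submod) : {linear M -> quot P} := sval (projT2 (quot_spec P)).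

Lemma quot_map_surj (P : submod) y : exists x, quot_map P x = y.
Proof. by case: (svalP (projT2 (quot_spec P))) => + _; apply. Qed.

Lemma quot_map_eq0 (P : submod) x : quot_map P x = 0 <-> P x.
Proof. by case: (svalP (projT2 (quot_spec P))) => _; apply. Qed.

Definition gen_in (I : finType) (e : I -> M) (x : M) :=
  exists c : I -> R, x = \sum_i c i *: e i.

Fact gen_in0 (I : finType) (e : I -> M) : gen_in e 0.
Proof. by exists (fun=> 0); rewrite big1 // => i _; rewrite scale0r. Qed.

Fact gen_inP (I : finType) (e : I -> M) a x y :
  gen_in e x -> gen_in e y -> gen_in e (a *: x + y).
Proof.
move=> [c ->] [d ->]; exists (fun i => a * c i + d i).
rewrite scaler_sumr -big_split; apply: eq_bigr => i _.
by rewrite scalerDl scalerA.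
Qed.

Definition gen (I : finType) (e : I -> M) := Submod (gen_in0 e) (@gen_inP I e).

Lemma gen_mem (I : finType) (e : I -> M) i : gen e (e i).
Proof.
exists (fun j => (j == i)%:R); rewrite (bigD1 i) //= eqxx scale1r.
by rewrite big1 ?addr0 // => j /negbTE ->; rewrite scale0r.
Qed.

Definition fgs (P : M -> Prop) :=
  exists (I : finType) (e : I -> M),
    (forall i, P (e i)) /\ (forall x, P x -> gen e x).

End Submodules.

Arguments in_submod {R M P x} Px.
Arguments submod_val {R M} P.

(** * Finitely generated and noetherian modules *)

Section FinitelyGenerated.

Variable R : pzRingType.
Implicit Types M N : lmodType R.

Definition fg M := fgs (fun _ : M => True).

Definition noeth M := forall P : submod M, fgs P.

Lemma fgP M : finitely_generated M <-> fg M.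
Proof.
split=> [[n [e eP]]|[I [e [_ eP]]]]; first by exists 'I_n, e; split=> // x _.
exists #|I|, (e \o enum_val) => x; have [c ->] := eP x Logic.I.
exists (c \o enum_val); apply: (reindex (@enum_val I I)).
by exists enum_rank => i _; [apply: enum_valK | apply: enum_rankK].
Qed.

(** Generators of [P'] are joined to elements [e] that generate [P] modulo [P']. *)
Lemma fgs_ext M (P P' : M -> Prop) (I : finType) (e : I -> M) :
  fgs P' -> (forall x, P' x -> P x) -> (forall i, P (e i)) ->
  (forall x, P x -> exists c : I -> R, P' (x - \sum_i c i *: e i)) -> fgs P.
Proof.
move=> [J [f [fP' fgen]]] P'P Pe eP.
exists (I + J)%type, (fun s => match s with inl i => e i | inr j => f j end).
split=> [[i|j]|x /eP [c /fgen [d xE]]]; [exact: Pe | exact/P'P/fP' |].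
exists (fun s => match s with inl i => c i | inr j => d j end).
by rewrite big_sumType /= -xE addrC subrK.
Qed.

Lemma fg_surj M N (f : {linear M -> N}) :
  (forall y, exists x, f x = y) -> fg M -> fg N.
Proof.
move=> f_surj [I [e [_ eP]]]; exists I, (f \o e); split=> // y _.
have [x <-] := f_surj y; have [c ->] := eP x Logic.I.
by exists c; rewrite linear_sum; apply: eq_bigr => i _; rewrite linearZ.
Qed.

Lemma fg_prod M N : fg M -> fg N -> fg (M * N)%type.
Proof.
move=> [I [e [_ eP]]] [J [f [_ fP]]].
exists (I + J)%type,
  (fun s => match s with inl i => (e i, 0) | inr j => (0, f j) end).
split=> // -[x y] _; have [c xE] := eP x Logic.I; have [d yE] := fP y Logic.I.
exists (fun s => match s with inl i => c i | inr j => d j end).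
rewrite big_sumType /=.
suff sumE (A : finType) (g : A -> R) (h : A -> (M * N)%type) :
    \sum_i g i *: h i = (\sum_i g i *: (h i).1, \sum_i g i *: (h i).2).
  rewrite !sumE /= -xE -yE; congr pair => /=.
    by rewrite [X in _ + X]big1 ?addr0 // => i _; rewrite scaler0.
  by rewrite [X in X + _]big1 ?add0r // => i _; rewrite scaler0.
elim/big_rec3: _ => // i z1 z2 z3 _ ->.
by congr pair.
Qed.

Lemma sum_scale_ffunE M (I J : finType) (c : J -> R) (f : J -> {ffun I -> M}) i :
  (\sum_j c j *: f j) i = \sum_j c j *: f j i.
Proof. by rewrite sum_ffunE; apply: eq_bigr => j _; rewrite ffunE. Qed.

Definition single M (I : finType) (i : I) (x : M) : {ffun I -> M} :=
  [ffun j => if j == i then x else 0].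

Lemma ffun_single M (I : finType) (v : {ffun I -> M}) :
  v = \sum_i single i (v i).
Proof.
apply/ffunP => j; rewrite sum_ffunE (bigD1 j) //= big1 => [|i ij].
  by rewrite ffunE eqxx addr0.
by rewrite ffunE eq_sym (negbTE ij).
Qed.

Lemma fg_ffun M (I : finType) : fg M -> fg {ffun I -> M}.
Proof.
move=> [J [e [_ eP]]]; exists (I * J)%type, (fun s => single s.1 (e s.2)).
split=> // v _; have [c cP] := choice (fun i => eP (v i) Logic.I).
exists (fun s => c s.1 s.2); rewrite [LHS]ffun_single.
rewrite -(pair_bigA _ (fun i j => c i j *: single i (e j))) /=.
apply: eq_bigr => i _; apply/ffunP => j.
rewrite sum_scale_ffunE ffunE cP; case: eqP => [->|/eqP ij].
  by apply: eq_bigr => s _; rewrite ffunE eqxx.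
by rewrite big1 // => s _; rewrite ffunE (negbTE ij) scaler0.
Qed.

Lemma noeth_inj M N (f : {linear M -> N}) : injective f -> noeth N -> noeth M.
Proof.
move=> f_inj nN P.
pose Q := @Submod _ N (fun y => exists2 x, P x & y = f x)
  (ex_intro2 _ _ 0 (submod0 P) (esym (linear0 f)))
  (fun a x y Qx Qy => let: ex_intro2 x' Px xE := Qx in
     let: ex_intro2 y' Py yE := Qy in
     ex_intro2 _ _ (a *: x' + y') (submodP a Px Py)
       (etrans (congr2 (fun u v => a *: u + v) xE yE) (esym (linearP f a x' y')))).
have [I [e [Qe eP]]] := nN Q.
have [g gP] := choice (fun i => let: ex_intro2 x Px xE := Qe i in
  ex_intro (fun x => P x /\ e i = f x) x (conj Px xE)).
exists I, g; split=> [i|x Px]; first by case: (gP i).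
have [|c cE] := eP (f x); first by exists x.
exists c; apply: f_inj; rewrite cE linear_sum; apply: eq_bigr => i _.
by rewrite linearZ; congr (_ *: _); case: (gP i).
Qed.

Lemma noeth_fg M : noeth M -> fg M.
Proof.
exact: (fun h => h (@Submod R M (fun=> True) Logic.I (fun _ _ _ _ _ => Logic.I))).
Qed.

(** Induction on the number of generators of a submodule that contains [P]. The coefficients of the
    first generator in elements of [P] form a left ideal; lifts to [P] of finitely many generators
    of this ideal, together with generators of the part of [P] that avoids the first generator,
    generate [P]. *)
Lemma fg_noeth M : noeth R^o -> fg M -> noeth M.
Proof.
move=> nR /fgP [n [e eP]] P.
have {eP} : forall x, P x -> gen e x by move=> x _; have [c ->] := eP x; exists c.
elim: n e P => [|n IHn] e P Pe.
  exists 'I_0, e; split=> [[]//|x /Pe [c ->]]; by exists c.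
pose e' i := e (lift ord0 i).
have J0 : exists y, gen e' y /\ P ((0 : R) *: e ord0 + y).
  by exists 0; split; [apply: submod0 | rewrite scale0r addr0; apply: submod0].
have JP (a x y : R^o) : (exists z, gen e' z /\ P ((x : R) *: e ord0 + z)) ->
    (exists z, gen e' z /\ P ((y : R) *: e ord0 + z)) ->
    exists z, gen e' z /\ P ((a *: x + y : R) *: e ord0 + z).
  move=> [z [gz Pz]] [t [gt Pt]]; exists ((a : R) *: z + t); split.
    exact: submodP.
  rewrite scalerDl -scalerA addrACA -scalerDr; exact: submodP.
have [I [c [cJ cP]]] := nR (@Submod R R^o _ J0 JP).
have [y yP] := choice cJ.
have P'0 : P 0 /\ gen e' 0 by split; apply: submod0.
have P'P a x z : P x /\ gen e' x -> P z /\ gen e' z ->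
    P (a *: x + z) /\ gen e' (a *: x + z).
  by move=> [? ?] [? ?]; split; apply: submodP.
apply: (@fgs_ext _ _ _ _ (fun i => (c i : R) *: e ord0 + y i)
  (IHn e' (@Submod R M _ P'0 P'P) (fun x => @proj2 _ _))).
- by move=> x [].
- by move=> i; case: (yP i).
move=> x Px; have [d xE] := Pe x Px.
have xE' : x = d ord0 *: e ord0 + \sum_i d (lift ord0 i) *: e' i.
  by rewrite xE big_ord_recl.
have [|b bE] := cP (d ord0).
  exists (\sum_i d (lift ord0 i) *: e' i); split; last by rewrite -xE'.
  by exists (fun i => d (lift ord0 i)).
exists b; split.
  apply: submodB => //; apply: submod_sum => i _; apply: submodZ.
  by case: (yP i).
rewrite {1}xE' bE scaler_suml.
have -> : \sum_i b i *: ((c i : R) *: e ord0 + y i) =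
    \sum_i (b i *: c i : R) *: e ord0 + \sum_i b i *: y i.
  by rewrite -big_split; apply: eq_bigr => i _; rewrite scalerDr scalerA.
rewrite addrAC opprD addrA subrr add0r addrC.
apply: submodB; first by exists (fun i => d (lift ord0 i)).
by apply: submod_sum => i _; apply: submodZ; case: (yP i).
Qed.

End FinitelyGenerated.

(** * Composition series of artinian rings *)

Section Series.

Variable k : comPzRingType.
Implicit Types (a r x y : k) (s t : seq k).

Fixpoint span s x : Prop :=
  if s is a :: s' then exists c, span s' (x - c * a) else x = 0.

Fixpoint all_steps (Q : k -> seq k -> Prop) s : Prop :=
  if s is a :: s' then Q a s' /\ all_steps Q s' else True.

(* [a] generates a simple module modulo [span s], or lies in [span s]. *)
Definition simple_step a s :=
  forall r, span s (r * a) \/ exists u, span s (u * (r * a) - a).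

Lemma span_ideal s : is_ideal (span s).
Proof.
elim: s => [|a s [s0 sD sM]] /=; split=> //.
- by move=> x y -> ->; rewrite addr0.
- by move=> c x ->; rewrite mulr0.
- by exists 0; rewrite mul0r subr0.
- move=> x y [c xc] [d yd]; exists (c + d).
  by rewrite mulrDl opprD addrACA; apply: sD.
- by move=> c x [d xd]; exists (c * d); rewrite -mulrA -mulrBr; apply: sM.
Qed.

Lemma span0 s : span s 0. Proof. by case: (span_ideal s). Qed.

Lemma span_sub (I : k -> Prop) s : is_ideal I -> {in s, forall a, I a} ->
  forall x, span s x -> I x.
Proof.
case=> I0 ID IM; elim: s => [|a s IHs] sI x /= => [-> //|[c /IHs]].
move=> sc; rewrite -[x](subrK (c * a)); apply: ID.
  by apply: sc => b bs; apply: sI; rewrite inE bs orbT.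
by apply/IM/sI; rewrite inE eqxx.
Qed.

Hypothesis artin : artinian_ring k.

Lemma minimal_ideal (F : (k -> Prop) -> Prop) I0 :
  F I0 -> (forall I, F I -> is_ideal I) ->
  exists2 I, F I & forall J, F J -> (forall x, J x -> I x) ->
    forall x, I x -> J x.
Proof.
move=> F0 F_ideal; apply: contrapT => no_min.
have next (I : {I | F I}) : exists J : {I | F I},
    (forall x, sval J x -> sval I x) /\ ~ (forall x, sval I x -> sval J x).
  apply: contrapT => nJ; apply: no_min; exists (sval I); first exact: svalP.
  move=> J FJ JI; apply: contrapT => nIJ; apply: nJ.
  by exists (exist _ J FJ).
have [f fP] := choice next.
pose I n := sval (iter n f (exist _ I0 F0)).
have [||N NP] := @artin I; first by move=> n; apply/F_ideal/svalP.
  by move=> n x; rewrite /I iterS; case: (fP (iter n f (exist _ I0 F0))) => + _; apply.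
case: (fP (iter N f (exist _ I0 F0))) => _; apply => x.
by move=> /(NP N.+1 x (leqnSn N)).
Qed.

(** The chain of ideals generated by the powers of [a] stops. The equation says that [c] inverts [a]
    on multiples of [a ^+ N]. *)
Lemma artin_regular a : exists N c, a ^+ N = c * a * a ^+ N.
Proof.
have [n|n x [c ->]|N NP] := @artin (fun n x => exists c, x = c * a ^+ n).
- split; first by exists 0; rewrite mul0r.
    by move=> _ _ [c ->] [d ->]; exists (c + d); rewrite mulrDl.
  by move=> r _ [c ->]; exists (r * c); rewrite mulrA.
- by exists (c * a); rewrite exprS mulrA.
have [|c cE] := NP N.+1 (a ^+ N) (leqnSn N); first by exists 1; rewrite mul1r.
by exists N, c; rewrite {1}cE exprS mulrA.
Qed.

Definition has_series (I : k -> Prop) :=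
  exists s, all_steps simple_step s /\ (forall x, I x <-> span s x).

(** A series of the image [a I] lifts to [I] along multiplication by [a] and is placed on top of a
    series of the kernel. *)
Lemma has_series_ext (I : k -> Prop) a : is_ideal I ->
  has_series (fun x => I x /\ a * x = 0) ->
  has_series (fun x => exists2 y, I y & x = a * y) -> has_series I.
Proof.
move=> I_ideal [s0 [ser0 span0E]] [s1 [ser1 span1E]].
have [I0 ID IM] := I_ideal.
have s1I : forall x, span s1 x -> exists2 y, I y & x = a * y.
  by move=> x /span1E.
have : exists t, [/\ all_steps simple_step (t ++ s0),
    {in t, forall b, I b}
    & forall x, I x -> span s1 (a * x) <-> span (t ++ s0) x].
  elim: s1 ser1 s1I {span1E} => [_ _|b s1 IH /= [stepb /IH{}IH] s1I].
    exists [::]; split=> //= x Ix; rewrite -span0E; split=> [->//|[]//].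
  have [|t [sert tI tE]] := IH.
    by move=> x s1x; apply: s1I; exists 0; rewrite mul0r subr0.
  have [|y Iy bE] := s1I b.
    by exists 1; rewrite mul1r subrr; apply: span0.
  exists (y :: t); split=> /=.
  - split=> // r; case: (stepb r) => [|[u]].
      by rewrite bE mulrCA tE; [left | apply: IM].
    rewrite bE (mulrCA r) (mulrCA u) -mulrBr tE; first by right; exists u.
    by apply: ID; [apply/IM/IM | rewrite -mulN1r; apply: IM].
  - by move=> c; rewrite inE => /predU1P [-> //|/tI].
  move=> x Ix; split=> -[c cP]; exists c; move: cP; rewrite bE (mulrCA c) -mulrBr.
    by rewrite tE //; apply: ID => //; rewrite -mulNr; apply: IM.
  by rewrite tE //; apply: ID => //; rewrite -mulNr; apply: IM.
case=> t [sert tI tE]; exists (t ++ s0); split=> // x; split=> [Ix|].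
  by apply/tE => //; apply/span1E; exists x.
apply: span_sub => // b; rewrite mem_cat => /orP [/tI //|bs0].
suff : I b /\ a * b = 0 by case.
apply/span0E; elim: s0 bs0 {ser0 span0E sert tE} => // c s0 IH.
rewrite inE => /predU1P [->|/IH s0b] /=.
  by exists 1; rewrite mul1r subrr; apply: span0.
by exists 0; rewrite mul0r subr0.
Qed.

(** An ideal [I] minimal among those without a series would behave as a vector space: every scalar
    acts on it as zero or invertibly. Each of its elements is then a simple step over any others, so
    no finite family spans [I], and an infinite independent family generates ideals that descend
    forever. *)
Lemma artin_series : exists s, all_steps simple_step s /\ span s 1.
Proof.
suff [s [sers sP]] : has_series (fun=> True) by exists s; split=> //; apply/sP.
apply: contrapT => no_series.
have [||I [I_ideal noI] Imin] :=
    @minimal_ideal (fun I => is_ideal I /\ ~ has_series I) (fun=> True).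
- by split.
- by move=> J [].
have [I0 ID IM] := I_ideal.
have serJ (J : k -> Prop) : is_ideal J -> (forall x, J x -> I x) ->
    ~ (forall x, I x -> J x) -> has_series J.
  by move=> J_ideal JI nIJ; apply: contrapT => noJ; apply: nIJ; apply: Imin.
(* Otherwise the kernel and the image of [a] are proper subideals, have series by minimality, and
   combine to a series of [I]. *)
have divI a : (forall x, I x -> a * x = 0) \/ (forall x, I x -> exists2 y, I y & x = a * y).
  apply: contrapT => /not_orP [nker nim]; apply/noI/(has_series_ext (a := a)) => //.
    apply: serJ => [|x []//|IJ]; last by apply: nker => x /IJ [].
    split; first by rewrite mulr0.
      by move=> x y [? x0] [? y0]; rewrite mulrDr x0 y0 addr0; split=> //; apply: ID.
    by move=> c x [? x0]; rewrite mulrCA x0 mulr0; split=> //; apply: IM.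
  apply: serJ => // [|x [y Iy ->]]; last exact: IM.
  split; first by exists 0; rewrite ?mulr0.
    move=> _ _ [x Ix ->] [y Iy ->]; exists (x + y); first exact: ID.
    by rewrite mulrDr.
  by move=> c _ [x Ix ->]; exists (c * x); [apply: IM | rewrite mulrCA].
(* If [a I = I], then [x] is a multiple of [a ^+ N], where [artin_regular] supplies an inverse of
   [a]. *)
have invI a x : I x -> a * x = 0 \/ exists b, b * (a * x) = x.
  move=> Ix; have [aI0|aI] := divI a; first by left; apply: aI0.
  right; have [N [c cE]] := artin_regular a; exists c.
  have : exists2 y, I y & x = a ^+ N * y.
    elim: N {cE} => [|N [y Iy ->]]; first by exists x; rewrite ?mul1r.
    have [z Iz ->] := aI y Iy; exists z => //.
    by rewrite exprSr mulrA.
  by case=> y _ ->; rewrite !mulrA -cE.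
have serI s : {in s, forall a, I a} -> exists2 x, I x & ~ span s x.
  move=> sI; apply: contrapT => nx; apply: noI; exists s; split.
    elim: s sI {nx} => //= x s IHs sI; split; last first.
      by apply: IHs => b bs; apply: sI; rewrite inE bs orbT.
    move=> r; have [|rx0|[b bE]] := invI r x; first by apply: sI; rewrite inE eqxx.
      by left; rewrite rx0; apply: span0.
    by right; exists b; rewrite bE subrr; apply: span0.
  move=> x; split=> [Ix|]; last exact: span_sub.
  by apply: contrapT => nsx; apply: nx; exists x.
pose inI (s : seq k) := {in s, forall a, I a}.
pose seqI := {s : seq k | inI s}.
have next (p : seqI) : exists x, I x /\ ~ span (sval p) x.
  by have [x Ix nsx] := serI _ (svalP p); exists x.
have [f fP] := choice next.
have consI (p : seqI) : inI (f p :: sval p).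
  by move=> a; rewrite inE => /predU1P [->|/(svalP p) //]; case: (fP p).
have nilI : inI [::] by [].
pose sq n := iter n (fun p : seqI => exist inI _ (consI p) : seqI) (exist inI _ nilI).
pose x n := f (sq n).
have Ix n : I (x n) by case: (fP (sq n)).
have indep n : ~ span (sval (sq n)) (x n) by case: (fP (sq n)).
have span_x m n : (m < n)%N -> span (sval (sq n)) (x m).
  elim: n => // n IHn; rewrite ltnS leq_eqVlt => /predU1P [->|/IHn mn] /=.
    by exists 1; rewrite mul1r subrr; apply: span0.
  by exists 0; rewrite mul0r subr0.
pose J n y := forall I', is_ideal I' -> (forall i, (n <= i)%N -> I' (x i)) -> I' y.
have [n|n y Jy I' ? I'x|N /(_ N.+1 (x N) (leqnSn N))] := @artin J.
- split=> [I' []//|y z Jy Jz I' I'_ideal I'x|r y Jy I' I'_ideal I'x].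
    by case: (I'_ideal) => _ + _; apply; [apply: Jy | apply: Jz].
  by case: (I'_ideal) => _ _; apply; apply: Jy.
- by apply: Jy => // i ni; apply/I'x/ltnW.
(* The spans of these lists together contain [J N.+1], hence also [x N], since the chain is
   stationary from [N] on. *)
pose T := fix T d := if d is e.+1 then x (N.+1 + e)%N :: T e else [::].
have T_mono d e y : span (T d) y -> span (T (e + d)%N) y.
  by elim: e => // e IHe /IHe; exists 0; rewrite mul0r subr0.
have T_ideal : is_ideal (fun y => exists d, span (T d) y).
  split; first by exists 0.
    move=> y z [d Ty] [e Tz]; exists (d + e)%N.
    have [_ TD _] := span_ideal (T (d + e)%N).
    by apply: TD; [rewrite addnC|]; apply: T_mono.
  move=> r y [d Ty]; exists d; have [_ _ TM] := span_ideal (T d); exact: TM.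
case/(_ _ _ T_ideal) => [I' _ I'x|i Ni|d]; first exact: I'x.
  exists (i - N.+1).+1; rewrite /= subnKC //.
  by exists 1; rewrite mul1r subrr; apply: span0.
elim: d => [/= xN0|d IHd /= [c cP]].
  by apply: (indep N); rewrite xN0; apply: span0.
(* The generator of largest index drops out or, its coefficient being invertible on it, lies in the
   span of earlier terms, against independence. *)
have [cx0|[b bE]] := invI c (x (N.+1 + d)%N) (Ix _).
  by apply: IHd; move: cP; rewrite cx0 subr0.
apply: (indep (N.+1 + d)%N); rewrite -bE.
have [_ sD sM] := span_ideal (sval (sq (N.+1 + d)%N)); apply: (sM).
rewrite -[_ * x _](subKr (x N)); apply: sD; first by apply: span_x; rewrite leq_addr.
rewrite -mulN1r; apply: sM; move: cP; apply: span_sub.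
  exact: span_ideal.
have Td e : (e <= d)%N -> {in T e, forall a, span (sval (sq (N.+1 + d)%N)) a}.
  elim: e => // e IHe ed a; rewrite inE => /predU1P [->|]; last by apply: IHe; apply: ltnW.
  by apply: span_x; rewrite ltn_add2l.
exact: Td.
Qed.

End Series.

(** * Matlis duality *)

Section ZornSubmodule.

Import classical_sets.
Local Open Scope classical_set_scope.

Variables (R : pzRingType) (M : lmodType R).

Lemma Zorn_submod (Q : submod M) (good : M -> Prop) :
  (forall x, Q x -> good x) ->
  exists V : submod M, [/\ forall x, Q x -> V x, forall x, V x -> good x
    & forall z, ~ V z -> exists a v, V v /\ ~ good (a *: z + v)].
Proof.
move=> Qgood.
pose ok (V : set M) := exists2 W : submod M, V = W :> set M &
  (forall x, Q x -> W x) /\ (forall x, W x -> good x).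
have [F okF totF|A [okA Amax]] := @Zorn_bigcup _ (fun V => V = set0 \/ ok V).
  have [F0|/existsNP [V0 /not_implyP [FV0 V0n0]]] := pselect (forall V, F V -> V = set0).
    left; apply/seteqP; split=> // x [V FV]; by rewrite (F0 V).
  right; have [//|[W0 V0E [QW0 W0good]]] := okF _ FV0.
  have cup0 : (\bigcup_(X in F) X) 0 by exists V0 => //; rewrite V0E; apply: submod0.
  have cupP a x y : (\bigcup_(X in F) X) x -> (\bigcup_(X in F) X) y ->
      (\bigcup_(X in F) X) (a *: x + y).
    move=> [V FV Vx] [V' FV' V'y].
    have [W [FW Wx Wy]] : exists W, [/\ F W, W x & W y].
      have [VV'|V'V] := totF _ _ FV FV'; last by exists V; split=> //; apply: V'V.
      by exists V'; split=> //; apply: VV'.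
    exists W => //.
    have [W0'|[U WU _]] := okF _ FW; first by move: Wx; rewrite W0'.
    by move: Wx Wy; rewrite WU; apply: submodP.
  exists (Submod cup0 cupP) => //; split=> [x Qx|x [V FV Vx]].
    by exists V0 => //; rewrite V0E; apply: QW0.
  have [V0'|[U VU [_ Ugood]]] := okF _ FV; first by move: Vx; rewrite V0'.
  by apply: Ugood; rewrite -VU.
have {okA} [W AE [QW Wgood]] : ok A.
  case: okA => // A0; exfalso; apply: (Amax (Q : set M)); last by right; exists Q.
  split; last by move=> /(_ 0 (submod0 Q)); rewrite A0.
  by rewrite A0; apply: sub0set.
exists W; split=> // z nWz; apply: contrapT => no.
pose U x := exists a v, W v /\ x = a *: z + v.
have U0 : U 0 by exists 0, 0; rewrite scale0r addr0; split=> //; apply: submod0.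
have UP a x y : U x -> U y -> U (a *: x + y).
  move=> [b [v [Wv ->]]] [c [w [Ww ->]]]; exists (a * b + c), (a *: v + w).
  by rewrite scalerDr scalerA addrACA -scalerDl; split=> //; apply: submodP.
have WU x : W x -> U x by exists 0, x; rewrite scale0r add0r.
apply: (Amax U); last first.
  right; exists (Submod U0 UP) => //; split=> [x /QW /WU //|x [a [v [Wv ->]]]].
  by apply: contrapT => ng; apply: no; exists a, v.
rewrite AE; split=> [x /WU //|/(_ z)]; apply: contra_not nWz; apply.
by exists 1, 0; rewrite scale1r addr0; split=> //; apply: submod0.
Qed.

End ZornSubmodule.

Section Matlis.

Variable k : comPzRingType.
Implicit Types (a r u : k) (s t : seq k) (M N : lmodType k).

Definition ann M t (x : M) := forall a, a \in t -> a *: x = 0.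

Lemma annP M t (x : M) : ann t x -> forall r, span t r -> r *: x = 0.
Proof.
elim: t => [|a t IHt] tx r /=; first by move=> ->; rewrite scale0r.
case=> c /IHt{IHt}IH; rewrite -[r](subrK (c * a)) scalerDl IH.
  by rewrite -scalerA tx ?inE ?eqxx // scaler0 addr0.
by move=> b bt; apply: tx; rewrite inE bt orbT.
Qed.

Lemma ann_cons M a t (x : M) : ann t x -> a *: x = 0 -> ann (a :: t) x.
Proof. by move=> tx ax b; rewrite inE => /predU1P [->|/tx]. Qed.

Lemma annB M t (x y : M) c : ann t x -> ann t y -> ann t (x - c *: y).
Proof.
move=> tx ty a at_.
by rewrite scalerBr scalerA mulrC -scalerA tx // ty // scaler0 subr0.
Qed.

(* When [a] is a simple step over [span t], this is the isotypic component of *)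
(* the socle of [M] of the simple module [k a] modulo [span t].               *)
Definition soc M a t (x : M) := forall r, span t (r * a) -> r *: x = 0.

Definition simple_soc M a t :=
  forall x y : M, soc a t x -> soc a t y -> x <> 0 -> exists c, y = c *: x.

Lemma ann_soc M a t (x : M) : ann t x -> soc a t (a *: x).
Proof. by move=> tx r ra; rewrite scalerA; apply: annP ra. Qed.

Lemma all_steps_imp (Q1 Q2 Q3 : k -> seq k -> Prop) s :
  (forall a t, Q1 a t -> Q2 a t -> Q3 a t) ->
  all_steps Q1 s -> all_steps Q2 s -> all_steps Q3 s.
Proof.
by move=> Q; elim: s => //= a s IHs [? ?] [? ?]; split; [apply: Q | apply: IHs].
Qed.

(** Multiplication by [a] embeds the elements of [P] killed by [t'], modulo those killed by
    [a :: t'], in the socle component of [a]. If these components are simple, each step of the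
    filtration counts for 0 or 1, and the sum along the whole series is the length of [P]. *)
Fixpoint len M t (P : M -> Prop) : nat :=
  if t is a :: t'
  then addn `[< exists x, [/\ P x, ann t' x & a *: x <> 0] >] (len t' P) else 0%N.

Lemma len_le M N t (P : M -> Prop) (P' : N -> Prop) :
  (forall a t (x : M), P x -> ann t x -> a *: x <> 0 ->
     exists y : N, [/\ P' y, ann t y & a *: y <> 0]) -> (len t P <= len t P')%N.
Proof.
move=> PP'; elim: t => //= a t IHt; apply: leq_add => //.
case: asboolP => // -[x [Px tx ax]].
by case: asboolP => // -[]; apply: PP' ax.
Qed.

Lemma len_size M t (P : M -> Prop) : (len t P <= size t)%N.
Proof. by elim: t => //= a t IHt; rewrite -add1n; apply: leq_add => //; case: asbool. Qed.

(** The filtrations of [P] and [P'] must jump at the same steps. At a jump, [y] is corrected by a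
    multiple of an element of [P] whose image spans the simple socle component. *)
Lemma len_eq M t (P P' : submod M) : all_steps (@simple_soc M) t ->
  (forall x, P x -> P' x) -> (len t P' <= len t P)%N ->
  forall y, P' y -> exists x, P x /\ ann t (y - x).
Proof.
move=> soct PP'; elim: t soct => [_ _ y _|a t IHt /= [soca /IHt{}IHt] le].
  by exists 0; split; [apply: submod0|].
have letP : (len t P <= len t P')%N.
  by apply: len_le => b u x Px ux bx; exists x; split=> //; apply: PP'.
move=> y P'y.
have [|x [Px tyx]] := IHt _ y P'y.
  rewrite leqNgt; apply/negP => lt; move: le.
  rewrite leqNgt => /negP; apply.
  case: asboolP => [[x [Px tx ax]]|_]; last first.
    by rewrite add0n (leq_trans lt) ?leq_addl.
  case: asboolP => [_|[]]; first by rewrite ltn_add2l.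
  by exists x; split=> //; apply: PP'.
have [ayx|ayx] := pselect (a *: (y - x) = 0).
  by exists x; split=> //; apply: ann_cons.
have [z [Pz tz az]] : exists x, [/\ P x, ann t x & a *: x <> 0].
  apply: contrapT => nz; move: le; rewrite (asboolF nz) add0n leqNgt => /negP; apply.
  rewrite (asboolT (P := exists x, [/\ P' x, ann t x & a *: x <> 0])) ?add1n //.
  by exists (y - x); split=> //; apply: submodB => //; apply: PP'.
have [c cE] := soca _ _ (ann_soc (a := a) tz) (ann_soc (a := a) tyx) az.
exists (x + c *: z); split; first by rewrite addrC; apply: submodP.
rewrite opprD addrA; apply: ann_cons; first exact: annB.
by rewrite scalerBr cE !scalerA mulrC subrr.
Qed.

Variable s : seq k.
Hypotheses (steps_s : all_steps (@simple_step k) s) (span_s : span s 1).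

Lemma ann_s M (x : M) : ann s x -> x = 0.
Proof. by move=> /annP /(_ _ span_s); rewrite scale1r. Qed.

(** Along the series, [P] either lies in the span of the tail, or is generated modulo that span by
    any one element outside it, the quotient being simple. *)
Lemma noeth_series : noeth k^o.
Proof.
move=> P; have : forall x : k^o, P x -> span s x.
  by move=> x _; have [_ _ sM] := span_ideal s; rewrite -[x : k]mulr1; apply: sM.
elim: s steps_s P => [_ P /= P0|a t IHt /= [stepa stept] P Pat].
  exists void, (fun i => 0); split=> // x /P0 ->; exact: submod0.
have [Pt|/existsNP [x /not_implyP [Px ntx]]] := pselect (forall x, P x -> span t x).
  exact: IHt.
have [_ tD tM] := span_ideal t.
have Q0 : P 0 /\ span t 0 by split; [apply: submod0 | apply: span0].
have QP (c y z : k^o) : P y /\ span t y -> P z /\ span t z ->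
    P (c *: y + z) /\ span t (c *: y + z).
  by move=> [? ?] [? ?]; split; [apply: submodP | apply: tD => //; apply: tM].
have [c tc] := Pat x Px.
have [|[u tu]] := stepa c.
  by move=> tca; case: ntx; rewrite -[x : k](subrK (c * a)); apply: tD.
have fgQ := IHt stept (@Submod _ k^o _ Q0 QP) (fun x => @proj2 _ _).
apply: (@fgs_ext _ _ _ _ unit (fun=> x) fgQ) => [y []//|//|y Py].
have [d td] := Pat y Py; exists (fun=> d * u); rewrite big_const card_unit /= addr0.
split; first by apply: submodB => //; apply: submodZ.
have uxa : (u * (c * a) - a) + u * ((x : k) - c * a) = u * x - a.
  by rewrite mulrBr addrC addrA subrK.
have -> : y - (d * u) *: x = (y - d * a) - d * (u * x - a).
  by rewrite mulrBr opprB addrA subrK [d * (u * x)]mulrA.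
apply: (tD) => //; rewrite -mulNr; apply: (tM); rewrite -uxa.
by apply: (tD) => //; apply: (tM).
Qed.

(** As [span s] contains 1, some step is the first not to carry [x] into [P]. For simple steps,
    [a *: x] then generates a simple module modulo [P]. *)
Lemma no_ann_step M (P : submod M) (Q : k -> seq k -> Prop) x :
  all_steps Q s -> ~ P x ->
  exists a t, [/\ Q a t, forall r, span t r -> P (r *: x) & ~ P (a *: x)].
Proof.
move=> Qs nPx; apply: contrapT => no.
suff sP : forall r, span s r -> P (r *: x) by apply: nPx; rewrite -[x]scale1r; apply: sP.
elim: s Qs => [_ r -> |a t IHt /= [Qat /IHt{}IHt] r [c /IHt rc]].
  by rewrite scale0r; apply: submod0.
rewrite -[r](subrK (c * a)) scalerDl -scalerA; apply: submodD => //; apply: submodZ.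
by apply: contrapT => nPa; apply: no; exists a, t.
Qed.

(* A module all of whose socle components are simple is a submodule of the    *)
(* minimal injective cogenerator, which is therefore the longest such module. *)
Definition multfree M := all_steps (@simple_soc M) s.

Definition full M := @Submod k M (fun=> True) Logic.I (fun _ _ _ _ _ => Logic.I).

Definition longest E := multfree E /\
  forall M, multfree M -> (len s (full M) <= len s (full E))%N.

Lemma exists_longest : exists E, longest E.
Proof.
pose Z := quot (full k^o).
have Z0 (x : Z) : x = 0.
  by have [y <-] := quot_map_surj x; apply/quot_map_eq0.
have mfZ : multfree Z.
  by rewrite /multfree; elim: s => //= a t IHt; split=> // x y _ _ [].
pose p n := `[< exists M, multfree M /\ len s (full M) = n >].
have p_ex : exists n, p n by exists (len s (full Z)); apply/asboolP; exists Z.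
have p_le n : p n -> (n <= size s)%N by move=> /asboolP [M [_ <-]]; apply: len_size.
have [n /asboolP [E [mfE En]] nmax] := ex_maxnP p_ex p_le.
exists E; split=> // M mfM; rewrite En; apply: nmax.
by apply/asboolP; exists M.
Qed.

Variable E : lmodType k.
Hypothesis longE : longest E.

Let mfE : multfree E. Proof. by case: longE. Qed.

(** The image has the length of [E], which no multiplicity-free module exceeds. *)
Lemma longest_surj M (f : {linear E -> M}) : injective f -> multfree M ->
  forall y, exists x, f x = y.
Proof.
move=> f_inj mfM y.
have P0 : exists x, f x = 0 by exists 0; apply: linear0.
have PP a z z' : (exists x, f x = z) -> (exists x, f x = z') ->
    exists x, f x = a *: z + z'.
  by move=> [x <-] [x' <-]; exists (a *: x + x'); rewrite linearP.
have [||||_ [[x <-]]] := @len_eq M s (@Submod _ M _ P0 PP) (full M) _ _ _ y.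
- exact: mfM.
- by [].
- apply: leq_trans (proj2 longE _ mfM) _; apply: len_le => a t x _ tx ax.
  exists (f x); split; first by exists x.
    by move=> b bt; rewrite -linZ tx // linear0.
  by rewrite -linZ -(linear0 f) => /f_inj.
- by [].
by move=> /ann_s /subr0_eq yE; exists x.
Qed.

(** An essential extension has no new socle: a nonzero element of a socle component has a nonzero
    multiple in [E], from which simplicity of the step recovers the element. *)
Lemma essential_multfree M (f : {linear E -> M}) : injective f ->
  (forall x, x <> 0 -> exists a e, e <> 0 /\ a *: x = f e) -> multfree M.
Proof.
move=> f_inj ess; apply: all_steps_imp steps_s mfE => a t stepa soca.
have lift (x : M) : soc a t x -> exists2 x', soc a t x' & x = f x'.
  have [->|x0] := pselect (x = 0).
    by exists 0; rewrite ?linear0 // => r _; rewrite scaler0.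
  move=> xsoc; have [b [e [e0 be]]] := ess x x0.
  have [/xsoc bx0|[u uE]] := stepa b.
    by case: e0; apply: f_inj; rewrite -be bx0 linear0.
  have xE : x = f (u *: e).
    rewrite linZ -be scalerA; apply/subr0_eq; rewrite -{1}[x]scale1r -scalerBl.
    apply: xsoc; rewrite -[1 - _]opprB mulNr mulrBl mul1r -mulrA -mulN1r.
    by case: (span_ideal t) => _ _; apply.
  exists (u *: e) => // r /xsoc; rewrite xE -linZ -(linear0 f) => /f_inj //.
move=> x y /lift [x' socx ->] /lift [y' socy ->] fx0.
have [x0|c ->] := soca _ _ socx socy; first by case: fx0; rewrite x0 linear0.
by exists c; rewrite linZ.
Qed.

Lemma ann_submod a t : is_ideal (fun r => span t (r * a)).
Proof.
have [t0 tD tM] := span_ideal t; split; first by rewrite mul0r.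
  by move=> x y ? ?; rewrite mulrDl; apply: tD.
by move=> c x ?; rewrite -mulrA; apply: tM.
Qed.

(** A simple module missing from the socle of [E] could be added as a direct summand, and [E] would
    embed properly in a multiplicity-free module. The alternative [span t a] is a step with zero
    quotient. *)
Lemma longest_simple :
  all_steps (fun a t => span t a \/ exists2 e : E, soc a t e & e <> 0) s.
Proof.
suff : forall a t, simple_step a t -> @simple_soc E a t ->
    span t a \/ exists2 e : E, soc a t e & e <> 0.
  by move=> H; apply: all_steps_imp steps_s mfE.
move=> a t stepa _; apply: contrapT => /not_orP [nta no].
have socE0 (e : E) : soc a t e -> e = 0.
  by move=> ee; apply: contrapT => e0; apply: no; exists e.
have [m0 mD mM] := ann_submod a t.
have mP (c x y : k^o) : span t (x * a) -> span t (y * a) ->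
    span t ((c *: x + y) * a) by move=> ? ?; apply: mD => //; apply: mM.
(* The maximal ideal of scalars killing [a] modulo [span t]; [quot m] is the simple module of this
   step. *)
pose m := @Submod k k^o (fun r => span t (r * a)) m0 mP.
have m1 q : ~ m q -> exists u, m (u * q - 1).
  move=> nmq; have [/nmq //|[u uE]] := stepa q; exists u.
  by rewrite /= mulrBl mul1r -mulrA.
have mf : multfree (E * quot m)%type.
  apply: all_steps_imp steps_s mfE => b u stepb socb [x sg] [y tau].
  move=> socx socy xsg0.
  have socP (z : E) (rho : quot m) : soc b u (z, rho) ->
      soc b u z /\ soc b u rho.
    by move=> zr; split=> r /zr e; [apply: (congr1 fst e) | apply: (congr1 snd e)].
  have [socx1 socsg] := socP _ _ socx; have [socy1 soctau] := socP _ _ socy.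
  have [[sg0 tau0]|] := pselect (sg = 0 /\ tau = 0).
    move: xsg0; rewrite sg0 tau0 => x0.
    have [x00|c ->] := socb _ _ socx1 socy1; first by apply: x0; rewrite x00.
    by exists c; congr pair; rewrite scaler0.
  move=> nst; have [rho socrho rho0] : exists2 rho : quot m, soc b u rho & rho <> 0.
    have [sg0|] := pselect (sg = 0); last by exists sg.
    by exists tau => // tau0; apply: nst.
  have [q qE] := quot_map_surj rho.
  have nmq : ~ m q by move=> /quot_map_eq0; rewrite qE.
  (* A nonzero [rho] in the component of [b] forces the annihilator of [b] modulo [span u] to be
     [m]. The component of [b] in [E] is then that of [a], which is zero. *)
  have bm r : span u (r * b) -> m r.
    move=> /socrho; rewrite -qE -linZ => /quot_map_eq0 mrq.
    have [v mv] := m1 q nmq.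
    have -> : r = v * (r * q) - r * (v * q - 1).
      by rewrite mulrBr mulr1 opprB mulrCA addrCA subrr addr0.
    by apply: (submodB (P := m)); [apply: mM | apply: mM].
  have mb r : m r -> span u (r * b).
    move=> mr; have [//|[v vE]] := stepb r; exfalso; apply: nmq.
    have /bm m1' : span u ((v * r - 1) * b) by rewrite mulrBl mul1r -mulrA.
    have -> : q = q * (v * r) - q * (v * r - 1) by rewrite mulrBr mulr1 subKr.
    by apply: (submodB (P := m)); [rewrite mulrA; apply: mM | apply: mM].
  have x0 : x = 0 by apply: socE0 => r /mb; apply: socx1.
  have y0 : y = 0 by apply: socE0 => r /mb; apply: socy1.
  have sg0 : sg <> 0 by move=> sg0; apply: xsg0; rewrite x0 sg0.
  have [p pE] := quot_map_surj sg; have [p' p'E] := quot_map_surj tau.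
  have nmp : ~ m p by move=> /quot_map_eq0; rewrite pE.
  have [v mv] := m1 p nmp; exists (p' * v); rewrite x0 y0; congr pair.
    by rewrite scaler0.
  change (tau = (p' * v) *: sg); apply/subr0_eq.
  rewrite -pE -p'E -linZ -linearB; apply/quot_map_eq0.
  have e : - (p' : k) * (v * p - 1) = p' - p' * v * p.
    by rewrite mulrBr mulr1 opprK mulNr -mulrA addrC.
  by have := mM (- p') _ mv; rewrite e.
have lin : linear (fun e : E => (e, 0 : quot m)).
  by move=> c e e'; congr pair; rewrite /= ?scaler0 ?addr0.
have inj : injective (mklin lin) by move=> e e' [].
have [e [_ /esym /quot_map_eq0]] := longest_surj inj mf (0, quot_map m 1).
by rewrite /= mul1r.
Qed.

(** Let [V] be maximal among the submodules of the product of [E] and [N'] that contain the pushout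
    relations and meet [E] trivially. The quotient by [V] is an essential extension of [E], hence
    equal to [E], and the map from [N'] to it extends [f]. *)
Theorem longest_injective N N' (A : {linear N -> N'}) (f : {linear N -> E}) :
  (forall x, A x = 0 -> f x = 0) -> exists g : {linear N' -> E}, forall x, g (A x) = f x.
Proof.
move=> Af.
have G0 : exists x, (0 : (E * N')%type) = (f x, - A x).
  by exists 0; rewrite !linear0 ?oppr0.
have GP a (x y : (E * N')%type) : (exists z, x = (f z, - A z)) ->
    (exists z, y = (f z, - A z)) -> exists z, a *: x + y = (f z, - A z).
  move=> [z ->] [z' ->]; exists (a *: z + z').
  by congr pair; rewrite linearP //= opprD scalerN.
have [|V [GV Vgood Vmax]] :=
    @Zorn_submod _ _ (@Submod _ (E * N')%type _ G0 GP) (fun x => x.2 = 0 -> x.1 = 0).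
  move=> _ [z ->] /= Az; apply: Af; exact/eqP/(etrans (esym (oppr_eq0 _)))/eqP.
have lin : linear (fun e : E => quot_map V (e, 0)).
  by move=> c e e'; rewrite -linearP; congr (quot_map V (_, _)); rewrite /= ?scaler0 ?addr0.
have inj : injective (mklin lin).
  by apply: linear_inj => e /quot_map_eq0 /Vgood; apply.
have surj : forall y, exists e, quot_map V (e, 0) = y.
  apply: (longest_surj inj); apply: (essential_multfree inj) => x x0.
  have [z zE] := quot_map_surj x.
  have [|a [v [Vv]]] := Vmax z; first by move=> /quot_map_eq0; rewrite zE.
  move=> /not_implyP [azv2 azv1]; exists a, (a *: z + v).1; split=> //.
  rewrite -zE -linZ; apply/subr0_eq; rewrite /= -linearB; apply/quot_map_eq0.
  have -> : a *: z - ((a *: z + v).1, 0) = - v; last exact: submodN.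
  apply/subr0_eq; rewrite opprK addrAC {1}[a *: z + v]surjective_pairing azv2.
  exact: subrr.
have linj : linear (fun y => quot_map V (0, y)).
  by move=> c y y'; rewrite -linearP; congr (quot_map V (_, _)); rewrite /= ?scaler0 ?addr0.
have [g gP] := @factor_inj _ N' E (quot V) (mklin lin) (mklin linj) inj
  (fun y => surj (quot_map V (0, y))).
exists g => x; apply: inj; rewrite gP /=; apply/subr0_eq; rewrite -linearB.
apply/quot_map_eq0; have -> : (0, A x) - (f x, 0) = - (f x, - A x).
  by congr pair; rewrite /= ?sub0r ?subr0 ?opprK.
by apply: submodN; apply: GV; exists x.
Qed.

(** Some multiple of [x] generates a simple module modulo [P]; this module embeds in [E], and
    injectivity extends the embedding. *)
Theorem longest_separates N (P : submod N) x : ~ P x ->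
  exists f : {linear N -> E}, (forall y, P y -> f y = 0) /\ f x <> 0.
Proof.
move=> nPx.
have steps : all_steps (fun a t => simple_step a t /\
    (span t a \/ exists2 e : E, soc a t e & e <> 0)) s.
  by apply: all_steps_imp steps_s longest_simple.
have [a [t [[stepa ta] Pt nPa]]] := no_ann_step steps nPx.
case: ta => [/Pt //|[e soce e0]].
have linA : linear (fun r : k^o => r *: quot_map P (a *: x)).
  by move=> c r r'; rewrite scalerDl -scalerA.
have linf : linear (fun r : k^o => (r : k) *: e).
  by move=> c r r'; rewrite scalerDl -scalerA.
have [r|g gE] := @longest_injective _ _ (mklin linA) (mklin linf).
  rewrite /= -linZ scalerA => /quot_map_eq0 Pra.
  have [/soce //|[u /Pt Pu]] := stepa r; case: nPa.
  move: Pu; rewrite scalerBl -scalerA => Pu.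
  by rewrite -[_ *: x](subKr (u *: ((r * a) *: x))); apply: submodB => //; apply: submodZ.
exists (g \o quot_map P); split=> [y /quot_map_eq0 /= ->|/= gx0]; first exact: linear0.
by apply: e0; rewrite -[e]scale1r -[LHS](gE 1) /= scale1r !linZ gx0 scaler0.
Qed.

(** Induction along the filtration by annihilators, from the elements killed by the full series,
    which are zero, to the whole module. *)
Lemma ann_induct (Q : k -> seq k -> Prop) (H : seq k -> Prop) t :
  (forall a t, Q a t -> H (a :: t) -> H t) -> all_steps Q t -> H t -> H [::].
Proof. by move=> HQ; elim: t => //= a t IHt [Qat Qt] /HQ /(_) Ht; apply: IHt => //; apply: Ht. Qed.

(** If [h] is the scalar [c] on the elements killed by [a :: t], then on those killed by [t] the map
    [h - c] vanishes where [a] does and lands in the simple socle component of [a]. It is therefore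
    [d * a] for a scalar [d], and [c + d * a] serves there. *)
Theorem longest_endo (h : {linear E -> E}) : exists c, forall x, h x = c *: x.
Proof.
pose H t := exists c, forall x : E, ann t x -> h x = c *: x.
suff step a t : @simple_soc E a t -> H (a :: t) -> H t.
  have [|c cP] := ann_induct step mfE; last by exists c => x; apply: cP.
  by exists 0 => x /ann_s ->; rewrite linear0 scaler0.
move=> soca [c cP].
have [[z [tz az]]|no] := pselect (exists z : E, ann t z /\ a *: z <> 0); last first.
  exists c => x tx; apply/cP/ann_cons => //; apply: contrapT => ax.
  by apply: no; exists x.
have soc_h x : ann t x -> soc a t (h x - c *: x).
  move=> tx r ra; rewrite scalerBr -linZ scalerA mulrC -scalerA.
  rewrite cP ?subrr //; apply: ann_cons => [b bt|].
    by rewrite scalerA mulrC -scalerA tx // scaler0.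
  by rewrite scalerA mulrC; apply: annP ra.
have [d dE] := soca _ _ (ann_soc (a := a) tz) (soc_h z tz) az.
exists (c + d * a) => x tx.
have [b bE] := soca _ _ (ann_soc (a := a) tz) (ann_soc (a := a) tx) az.
have /cP : ann (a :: t) (x - b *: z).
  apply: ann_cons; first exact: annB.
  by rewrite scalerBr bE !scalerA mulrC subrr.
move=> hxz; have hz : h z = c *: z + d *: (a *: z) by rewrite -dE addrC subrK.
rewrite -{1}[x](subrK (b *: z)) linearD hxz linZ hz scalerBr scalerDr scalerDl.
rewrite (scalerA b c) (mulrC b c) -(scalerA c b) addrA subrK -(scalerA d a) bE; congr (_ + _).
by rewrite !scalerA (mulrC b).
Qed.

(** Each step of the filtration adds at most one generator, for any submodule of [E]. *)
Theorem longest_fg : fg E.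
Proof.
apply: noeth_fg => P.
pose H t := fgs (fun x => P x /\ ann t x).
suff step a t : @simple_soc E a t -> H (a :: t) -> H t.
  have [|I [e [eP eg]]] := ann_induct step mfE.
    exists void, (fun i => 0); split=> // x [_ /ann_s ->]; exact: submod0.
  by exists I, e; split=> [i|x Px]; [case: (eP i) | apply: eg].
move=> soca fgat.
have [[z [Pz tz az]]|no] := pselect (exists z : E, [/\ P z, ann t z & a *: z <> 0]).
  apply: (@fgs_ext _ _ _ _ unit (fun=> z) fgat) => //.
    by move=> x [Px tx]; split=> // b bt; apply: tx; rewrite inE bt orbT.
  move=> x [Px tx].
  have [b bE] := soca _ _ (ann_soc (a := a) tz) (ann_soc (a := a) tx) az.
  exists (fun=> b); rewrite big_const card_unit /= addr0; split.
    by apply: submodB => //; apply: submodZ.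
  apply: ann_cons; first exact: annB.
  by rewrite scalerBr bE !scalerA mulrC subrr.
have [I [e [eP eg]]] := fgat; exists I, e; split=> [i|x [Px tx]].
  by have [? eat] := eP i; split=> // b bt; apply: eat; rewrite inE bt orbT.
apply: eg; split=> //; apply: ann_cons => //; apply: contrapT => ax.
by apply: no; exists x.
Qed.

End Matlis.

Record dualizing (k : comPzRingType) (E : lmodType k) : Prop := Dualizing {
  dual_fg : fg E;
  dual_injective : forall (N N' : lmodType k) (A : {linear N -> N'})
    (f : {linear N -> E}), (forall x, A x = 0 -> f x = 0) ->
    exists g : {linear N' -> E}, forall x, g (A x) = f x;
  dual_separates : forall (N : lmodType k) (P : submod N) x, ~ P x ->
    exists f : {linear N -> E}, (forall y, P y -> f y = 0) /\ f x <> 0;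
  dual_endo : forall h : {linear E -> E}, exists c, forall x, h x = c *: x
}.

Lemma exists_dualizing (k : comPzRingType) : artinian_ring k ->
  noeth k^o /\ exists E : lmodType k, dualizing E.
Proof.
move=> /artin_series [s [steps_s span_s]]; split; first exact: noeth_series span_s.
have [E longE] := exists_longest s; exists E; split.
- exact: longest_fg longE.
- exact: longest_injective longE.
- exact: longest_separates longE.
- exact: longest_endo longE.
Qed.

(** * Functionals with values in the dualizing module *)

Section Dualizing.

Variables (k : comPzRingType) (E : lmodType k) (dE : dualizing E).
Implicit Types G N : lmodType k.

(** The substitute for double duality. Values on generators of [N] send [G] to [E^I]; [f] factors
    through the image and extends to [E^I] by injectivity, and its components there are scalars by
    [dual_endo]. *)
Lemma pairing_represents G N (b : G -> N -> E) (f : {linear G -> E}) :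
  (forall x, linear (b^~ x)) -> (forall g, linear (b g)) -> fg N ->
  (forall g, (forall x, b g x = 0) -> f g = 0) -> exists x, forall g, f g = b g x.
Proof.
move=> linl linr [I [e [_ eP]]] kerf.
have linA : linear (fun g => [ffun i => b g (e i)]).
  by move=> c g h; apply/ffunP => i; rewrite !ffunE linl.
have [g|h hE] := dual_injective dE (A := mklin linA) (f := f).
  move=> /= Ag; apply: kerf => x; have [c ->] := eP x Logic.I.
  rewrite (linear_comb (mklin (linr g)) c e : b g _ = _) big1 // => i _.
  by have /ffunP/(_ i) := Ag; rewrite !ffunE /= => ->; rewrite scaler0.
have lin1 i : linear (single i : E -> {ffun I -> E}).
  move=> c x y; apply/ffunP => j; rewrite !ffunE.
  by case: eqP; rewrite ?scaler0 ?addr0.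
have [c cP] := choice (fun i => dual_endo dE (h \o mklin (lin1 i))).
exists (\sum_i c i *: e i) => g; rewrite -hE (ffun_single (mklin linA g)) linear_sum.
rewrite (linear_comb (mklin (linr g)) c e : b g _ = _).
by apply: eq_bigr => i _; rewrite -cP /= ffunE.
Qed.

(** Values on generators embed the dual of [N] in a power of [E], so the dual is finitely generated;
    its generators separate because all functionals do. *)
Lemma separating_family N : noeth k^o -> fg N ->
  exists (I : finType) (v : I -> {linear N -> E}),
    forall x, (forall i, v i x = 0) -> x = 0.
Proof.
move=> nk fgN; have [J [e [_ eP]]] := fgN.
have P0 : exists f : {linear N -> E}, forall j, (0 : {ffun J -> E}) j = f (e j).
  by exists \0 => j; rewrite ffunE.
have PP c (x y : {ffun J -> E}) :
    (exists f : {linear N -> E}, forall j, x j = f (e j)) ->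
    (exists f : {linear N -> E}, forall j, y j = f (e j)) ->
    exists f : {linear N -> E}, forall j, (c *: x + y) j = f (e j).
  move=> [f fP] [g gP].
  have lin : linear (fun z => c *: f z + g z).
    move=> a z t; rewrite /= (linP f) (linP g) !scalerDr !scalerA (mulrC c a) -!scalerA.
    by rewrite addrACA.
  by exists (mklin lin) => j; rewrite !ffunE fP gP.
have [I [d [dP dg]]] := fg_noeth nk (fg_ffun J (dual_fg dE)) (@Submod _ _ _ P0 PP).
have [v vP] := choice dP; exists I, v => x vx; apply: contrapT => x0.
have z0 : (fun y : N => y = 0) 0 by [].
have zP (c : k) (y z : N) : y = 0 -> z = 0 -> c *: y + z = 0.
  by move=> -> ->; rewrite scaler0 addr0.
have [f [_]] := dual_separates dE (P := @Submod _ N (fun y => y = 0) z0 zP) x0.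
apply; have [|c /ffunP cE] := dg [ffun j => f (e j)].
  by exists f => j; rewrite ffunE.
have [b xE] := eP x Logic.I.
have -> : f x = \sum_i c i *: v i x.
  rewrite xE linear_comb; under [RHS]eq_bigr do rewrite linear_comb scaler_sumr.
  rewrite exchange_big; apply: eq_bigr => j _.
  have := cE j; rewrite ffunE sum_scale_ffunE => ->; rewrite scaler_sumr.
  by apply: eq_bigr => i _; rewrite vP !scalerA mulrC.
by rewrite big1 // => i _; rewrite vx scaler0.
Qed.

End Dualizing.

(** * Presentations of dual functors *)

Section Restriction.

Variables (k : comPzRingType) (R : pzRingType) (phi : {rmorphism k -> R}).

(** An alias, which keeps the scalars from [k] apart from those of [R] on the same carrier. *)
Definition res (f : {rmorphism k -> R}) (M : lmodType R) : Type := M.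

Variable M : lmodType R.

HB.instance Definition _ := GRing.Zmodule.copy (res phi M) M.

Let scale a (x : res phi M) : res phi M := phi a *: (x : M).

Fact res_scaleA a b x : scale a (scale b x) = scale (a * b) x.
Proof. by rewrite /scale scalerA rmorphM. Qed.
Fact res_scale1 : left_id 1 scale.
Proof. by move=> x; rewrite /scale rmorph1 scale1r. Qed.
Fact res_scaleDr : right_distributive scale +%R.
Proof. by move=> a x y; rewrite /scale scalerDr. Qed.
Fact res_scaleDl x : {morph scale^~ x : a b / a + b}.
Proof. by move=> a b; rewrite /scale rmorphD scalerDl. Qed.

HB.instance Definition _ := GRing.Zmodule_isLmodule.Build k (res phi M)
  res_scaleA res_scale1 res_scaleDr res_scaleDl.

Lemma resZ a (x : res phi M) : a *: x = phi a *: (x : M) :> M.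
Proof. by []. Qed.

End Restriction.

Section HomModule.

Variables (k : comPzRingType) (R : pzRingType) (phi : {rmorphism k -> R}).

Definition central := forall a x, phi a * x = x * phi a.

Definition homk (cen : central) (X Y : lmodType R) : Type := {linear X -> Y}.

Variables (cen : central) (X Y : lmodType R).

Local Notation H := (homk cen X Y).

HB.instance Definition _ := gen_eqMixin H.
HB.instance Definition _ := gen_choiceMixin H.

Fact homk_comb_linear a b (f g : {linear X -> Y}) :
  linear (fun x => phi a *: f x + phi b *: g x).
Proof.
move=> c x y; rewrite (linP f) (linP g) !scalerDr !scalerA !cen.
by rewrite addrACA -!scalerA.
Qed.

Let comb a b (f g : H) : H := mklin (homk_comb_linear a b f g).
Let zero : H := \0.
Let opp (f : H) : H := comb (-1) 0 f f.
Let add (f g : H) : H := comb 1 1 f g.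
Let scale a (f : H) : H := comb a 0 f f.

Let addE f g x : (add f g : {linear X -> Y}) x = (f : {linear X -> Y}) x + (g : {linear X -> Y}) x.
Proof. by rewrite /= rmorph1 !scale1r. Qed.
Let oppE f x : (opp f : {linear X -> Y}) x = - (f : {linear X -> Y}) x.
Proof. by rewrite /= rmorphN rmorph1 rmorph0 scaleN1r scale0r addr0. Qed.
Let scaleE a f x : (scale a f : {linear X -> Y}) x = phi a *: (f : {linear X -> Y}) x.
Proof. by rewrite /= rmorph0 scale0r addr0. Qed.

Fact homk_addA : associative add.
Proof. by move=> f g h; apply: linear_ext => x; rewrite !addE addrA. Qed.
Fact homk_addC : commutative add.
Proof. by move=> f g; apply: linear_ext => x; rewrite !addE addrC. Qed.
Fact homk_add0 : left_id zero add.
Proof. by move=> f; apply: linear_ext => x; rewrite addE add0r. Qed.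
Fact homk_addN : left_inverse zero opp add.
Proof. by move=> f; apply: linear_ext => x; rewrite addE oppE addNr. Qed.

HB.instance Definition _ := GRing.isZmodule.Build H
  homk_addA homk_addC homk_add0 homk_addN.

Fact homk_scaleA a b f : scale a (scale b f) = scale (a * b) f.
Proof. by apply: linear_ext => x; rewrite !scaleE scalerA rmorphM. Qed.
Fact homk_scale1 : left_id 1 scale.
Proof. by move=> f; apply: linear_ext => x; rewrite !scaleE rmorph1 scale1r. Qed.
Fact homk_scaleDr : right_distributive scale +%R.
Proof.
move=> a f g; apply: linear_ext => x; rewrite scaleE.
apply: etrans (esym (addE (scale a f) (scale a g) x)).
by rewrite !scaleE -scalerDr; congr (_ *: _); apply: addE.
Qed.
Fact homk_scaleDl f : {morph scale^~ f : a b / a + b}.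
Proof.
move=> a b; apply: linear_ext => x; rewrite scaleE.
apply: etrans (esym (addE (scale a f) (scale b f) x)).
by rewrite !scaleE rmorphD scalerDl.
Qed.

HB.instance Definition _ := GRing.Zmodule_isLmodule.Build k H
  homk_scaleA homk_scale1 homk_scaleDr homk_scaleDl.

Lemma homkP a (f g : H) x :
  (a *: f + g : {linear X -> Y}) x = phi a *: (f : {linear X -> Y}) x + (g : {linear X -> Y}) x.
Proof. by rewrite -scaleE; apply: (addE (scale a f) g). Qed.

End HomModule.

Section Coinduced.

Variables (k : comPzRingType) (R : pzRingType) (phi : {rmorphism k -> R}).
Variables (E : lmodType k) (J : finType).

Local Notation F := {ffun J -> R^o}.

(* Hom_k(R^J, E), with R acting through right multiplication on R^J. *)
Definition coind (f : {rmorphism k -> R}) : Type := {linear res f F -> E}.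

Local Notation K := (coind phi).

HB.instance Definition _ := gen_eqMixin K.
HB.instance Definition _ := gen_choiceMixin K.

Definition rmul (t : R) (v : F) : F := [ffun j => (v j : R) * t].

Fact rmul_linear t : linear (rmul t : res phi F -> res phi F).
Proof.
move=> c x y; apply/ffunP => j; rewrite !ffunE mulrDl; congr (_ + _).
by rewrite /GRing.scale /= mulrA.
Qed.

Let zero : K := \0.
Let opp (f : K) : K := \- (f : {linear res phi F -> E}).
Fact coind_add_linear (f g : K) :
  linear (fun x => (f : {linear res phi F -> E}) x + (g : {linear res phi F -> E}) x).
Proof. by move=> c x y; rewrite (linP f) (linP g) scalerDr addrACA. Qed.
Let add (f g : K) : K := mklin (coind_add_linear f g).
Let scale t (f : K) : K :=
  (f : {linear res phi F -> E}) \o mklin (rmul_linear t).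
Let cE (f : K) := f : {linear res phi F -> E}.

Fact coind_addA : associative add.
Proof. by move=> f g h; apply: linear_ext => x; rewrite /= addrA. Qed.
Fact coind_addC : commutative add.
Proof. by move=> f g; apply: linear_ext => x; rewrite /= addrC. Qed.
Fact coind_add0 : left_id zero add.
Proof. by move=> f; apply: linear_ext => x; rewrite /= add0r. Qed.
Fact coind_addN : left_inverse zero opp add.
Proof. by move=> f; apply: linear_ext => x; rewrite /= addNr. Qed.

HB.instance Definition _ := GRing.isZmodule.Build K
  coind_addA coind_addC coind_add0 coind_addN.

Fact coind_scaleA a b f : scale a (scale b f) = scale (a * b) f.
Proof.
apply: linear_ext => x /=; congr (cE f _); apply/ffunP => j.
by rewrite !ffunE mulrA.
Qed.
Fact coind_scale1 : left_id 1 scale.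
Proof.
move=> f; apply: linear_ext => x /=; congr (cE f _); apply/ffunP => j.
by rewrite !ffunE mulr1.
Qed.
Fact coind_scaleDr : right_distributive scale +%R.
Proof. by move=> a f g; apply: linear_ext => x. Qed.
Fact coind_scaleDl f : {morph scale^~ f : a b / a + b}.
Proof.
move=> a b; apply: linear_ext => x /=; rewrite -linearD; congr (cE f _).
by apply/ffunP => j; rewrite !ffunE mulrDr.
Qed.

HB.instance Definition _ := GRing.Zmodule_isLmodule.Build R K
  coind_scaleA coind_scale1 coind_scaleDr coind_scaleDl.

Lemma coindP t (f g : K) x : cE (t *: f + g) x = cE f (rmul t x) + cE g x.
Proof. by []. Qed.

End Coinduced.

Section FreeModule.

Variables (R : pzRingType) (J : finType) (X : lmodType R).

Fact free_map_linear (c : J -> X) :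
  linear (fun v : {ffun J -> R^o} => \sum_j (v j : R) *: c j).
Proof.
move=> a v w; rewrite scaler_sumr -big_split; apply: eq_bigr => j _.
by rewrite !ffunE scalerDl -scalerA.
Qed.

Definition free_map (c : J -> X) : {linear {ffun J -> R^o} -> X} :=
  mklin (free_map_linear c).

Definition basis (j : J) : {ffun J -> R^o} := single j (1 : R^o).

Lemma free_map_basis c j : free_map c (basis j) = c j.
Proof.
rewrite /= (bigD1 j) //= ffunE eqxx scale1r big1 ?addr0 // => i /negbTE ij.
by rewrite ffunE ij scale0r.
Qed.

Lemma free_mapE (f : {linear {ffun J -> R^o} -> X}) v :
  f v = \sum_j (v j : R) *: f (basis j).
Proof.
rewrite (ffun_single v) linear_sum; apply: eq_bigr => j _.
rewrite -ffun_single -linZ; congr (f _); apply/ffunP => i; rewrite !ffunE.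
by case: eqP => _; rewrite ?scaler0 // /GRing.scale /= mulr1.
Qed.

Lemma fg_free : fg {ffun J -> R^o}.
Proof.
exists J, basis; split=> // v _; exists v.
rewrite [LHS]ffun_single; apply: eq_bigr => j _.
apply/ffunP => i; rewrite !ffunE.
by case: eqP => _; rewrite ?scaler0 // /GRing.scale /= mulr1.
Qed.

End FreeModule.

(** * Finiteness and functionals for homomorphism modules *)

Section ArtinAlgebra.

Variables (k : comPzRingType) (R : pzRingType) (phi : {rmorphism k -> R}).
Hypotheses (cen : central phi) (nk : noeth k^o) (fgR : fg (res phi R^o)).
Variables (E : lmodType k) (dE : dualizing E).

Implicit Types X Y M N B : lmodType R.

Local Notation res := (res phi).
Local Notation homk := (homk cen).

Fact res_lin_linear X Y (f : {linear X -> Y}) : linear (f : res X -> res Y).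
Proof. by move=> a x y; rewrite [LHS](linP f). Qed.
Definition res_lin X Y f : {linear res X -> res Y} := mklin (@res_lin_linear X Y f).

Lemma fg_res M : fg M -> fg (res M).
Proof.
move=> [I [e [_ eP]]]; have [J [r [_ rP]]] := fgR.
exists (I * J)%type, (fun s => (r s.2 : R) *: (e s.1 : M)); split=> // x _.
have [c xE] := eP x Logic.I.
have [d dP] := choice (fun i => rP (c i) Logic.I).
exists (fun s => d s.1 s.2); rewrite [LHS]xE.
rewrite -(pair_bigA _ (fun i j => d i j *: ((r j : R) *: e i : res M))) /=.
apply: eq_bigr => i _; rewrite {1}[c i]dP; rewrite scaler_suml.
by apply: eq_bigr => j _; rewrite resZ scalerA.
Qed.

Lemma fg_of_res M : fg (res M) -> fg M.
Proof.
move=> [I [e [_ eP]]]; exists I, e; split=> // x _.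
by have [c xE] := eP x Logic.I; exists (fun i => phi (c i)).
Qed.

Lemma noeth_res M : fg M -> noeth (res M).
Proof. by move=> fgM; apply/fg_noeth/fg_res. Qed.

(** Finiteness is transferred over [k], where [noeth] is available; generators over [k] also
    generate over [R]. *)
Lemma fg_inj M N (f : {linear M -> N}) : injective f -> fg N -> fg M.
Proof.
move=> f_inj fgN; apply/fg_of_res/noeth_fg.
exact: (@noeth_inj _ _ _ (res_lin f)) (noeth_res fgN).
Qed.

Lemma fg_submod M (S : submod M) : fg M -> fg (submod_type S).
Proof. by apply: (@fg_inj _ _ (submod_val S)); apply: submod_type_inj. Qed.

Lemma fg_quot M (S : submod M) : fg M -> fg (quot S).
Proof. by apply: (@fg_surj _ _ _ (quot_map S)); apply: quot_map_surj. Qed.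

Definition homk_lin X Y (f : homk X Y) : {linear X -> Y} := f.

Definition postcomp X Y Y' (u : {linear Y -> Y'}) : {linear homk X Y -> homk X Y'}.
Proof.
apply: (@mklin _ (homk X Y) (homk X Y') (fun f => u \o homk_lin f)) => a f g.
apply: linear_ext => x; rewrite [RHS]homkP [LHS](congr1 u (homkP a f g x)).
by rewrite linP.
Defined.

Definition evals X Y (I : finType) (p : I -> X) : {linear homk X Y -> {ffun I -> res Y}}.
Proof.
apply: (@mklin _ (homk X Y) {ffun I -> res Y} (fun f => [ffun i => homk_lin f (p i)])).
by move=> a f g; apply/ffunP => i; rewrite !ffunE [LHS](homkP a f g).
Defined.

Lemma evals_inj X Y (I : finType) (p : I -> X) : (forall x, gen p x) ->
  injective (evals Y p).
Proof.
move=> pX f g /ffunP fg; apply: linear_ext => x; have [c ->] := pX x.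
apply: etrans (linear_comb (homk_lin f) c p) _.
apply: etrans (esym (linear_comb (homk_lin g) c p)); apply: eq_bigr => i _; congr (_ *: _).
by have := fg i; rewrite !ffunE.
Qed.

Lemma fg_homk X Y : fg X -> fg Y -> fg (homk X Y).
Proof.
move=> [I [p [_ pP]]] fgY; apply/noeth_fg/(noeth_inj (@evals_inj X Y I p _)).
  by move=> x; apply: pP.
by apply/fg_noeth/fg_ffun/fg_res.
Qed.

Lemma fg_coind (J : finType) : fg (coind E J phi).
Proof.
apply: fg_of_res.
have [I [p [_ pP]]] := fg_res (fg_free R J).
pose A (f : res (coind E J phi)) : {ffun I -> E} :=
  [ffun i => (f : {linear res {ffun J -> R^o} -> E}) (p i)].
have linA : linear A.
  move=> a f g; apply/ffunP => i; rewrite !ffunE; apply: etrans (coindP (phi a) f g (p i)) _.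
  rewrite -linZ; congr (_ + _).
  congr ((f : {linear res {ffun J -> R^o} -> E}) _); apply/ffunP => j.
  change (rmul (phi a) (p i) j = (phi a *: (p i : {ffun J -> R^o})) j).
  by rewrite !ffunE /GRing.scale /= cen.
apply/noeth_fg/(@noeth_inj _ _ _ (mklin linA)).
  move=> f g /ffunP fg; apply: linear_ext => x; have [c ->] := pP x Logic.I.
  rewrite !linear_comb; apply: eq_bigr => i _; congr (_ *: _).
  by have := fg i; rewrite !ffunE.
by apply/fg_noeth/fg_ffun/(dual_fg dE).
Qed.

Local Notation dual M := {linear res M -> E}.

(* D Hom(X, Y) is the tensor product DY (x) X. *)
Lemma functional_homk X Y (I : finType) (v : I -> dual Y) (f : {linear homk X Y -> E}) :
  fg X -> (forall y, (forall i, v i y = 0) -> y = 0) ->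
  exists b : I -> X, forall x, f x = \sum_i v i (homk_lin x (b i)).
Proof.
move=> fgX v_sep.
pose pr (x : homk X Y) (b : {ffun I -> res X}) := \sum_i v i (homk_lin x (b i)).
have [x a g h|x a b c||x x0|b bE] := pairing_represents dE (b := pr) (f := f).
- rewrite /pr scaler_sumr -big_split /=; apply: eq_bigr => i _.
  by rewrite -(linP (v i)); congr (v i _); exact: (homkP a g h (x i)).
- rewrite /pr scaler_sumr -big_split /=; apply: eq_bigr => i _.
  rewrite !ffunE -(linP (v i)); congr (v i _).
  exact: (linP (homk_lin x) (phi a) (b i) (c i)).
- exact/fg_ffun/fg_res.
- suff -> : x = 0 by rewrite linear0.
  apply: linear_ext => z; apply: v_sep => i.
  have := x0 (single i (z : res X)); rewrite /pr (bigD1 i) //= ffunE eqxx.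
  rewrite big1 ?addr0 // => j /negbTE ji; rewrite ffunE ji.
  by rewrite [homk_lin x 0]linear0 linear0.
by exists b.
Qed.

End ArtinAlgebra.

Definition lcomp (R : pzRingType) (X Y Z : lmodType R) (g : {linear Y -> Z})
  (f : {linear X -> Y}) : {linear X -> Z} := g \o f.

Section Kernels.

Variables (k : comPzRingType) (R : pzRingType) (phi : {rmorphism k -> R}).
Hypotheses (cen : central phi) (nk : noeth k^o) (fgR : fg (res phi R^o)).
Variables (E : lmodType k) (dE : dualizing E).

Implicit Types X Y M N B : lmodType R.

Local Notation res := (res phi).
Local Notation homk := (homk cen).
Local Notation dual M := {linear res M -> E}.

Lemma sum_comb X Y (I J : finType) (c : I -> J -> R) (e : J -> X) (u : I -> dual Y)
    (x : {linear X -> Y}) :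
  \sum_i u i (x (\sum_j c i j *: e j)) = \sum_j \sum_i u i (c i j *: x (e j)).
Proof.
rewrite exchange_big; apply: eq_bigr => i _.
by rewrite linear_comb [LHS](linear_sum (u i)).
Qed.

(* Generators and relations for [DY] as an [R]-module present the functor     *)
(* sending [X] to the kernel of [X^I -> DY (x) X] given by the [u i].         *)
Lemma tensor_kernel Y (I : finType) (u : I -> dual Y) : fg Y ->
  exists (W : lmodType R) (w : I -> W), fg W /\
    forall X (b : I -> X),
      (forall x : {linear X -> Y}, \sum_i u i (x (b i)) = 0) <->
      exists g : {linear W -> X}, forall i, b i = g (w i).
Proof.
move=> fgY; have [L [v v_sep]] := separating_family dE nk (fg_res fgR fgY).
pose T := (I + L)%type.
(* The [v l] are added so that the family separates the elements of [Y]. *)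
pose uu (t : T) : dual Y := match t with inl i => u i | inr l => v l end.
pose F := {ffun T -> R^o}.
pose pr (s : res F) (y : res Y) := \sum_t uu t ((s t : R) *: (y : Y)).
have prl y : linear (pr^~ y).
  move=> a s s'; rewrite /pr scaler_sumr -big_split /=; apply: eq_bigr => t _.
  by rewrite -(linP (uu t)); congr (uu t _); rewrite !ffunE scalerDl -scalerA.
have prr s : linear (pr s).
  move=> a y y'; rewrite /pr scaler_sumr -big_split /=; apply: eq_bigr => t _.
  rewrite -(linP (uu t)); congr (uu t _).
  by rewrite !resZ scalerDr !scalerA cen.
have A0 : forall y, pr 0 y = 0 by move=> y; exact: (linear0 (mklin (prl y))).
have AP (a : k) s s' : (forall y, pr s y = 0) -> (forall y, pr s' y = 0) ->
    forall y, pr (a *: s + s') y = 0.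
  by move=> s0 s'0 y; rewrite prl s0 s'0 scaler0 addr0.
have [J [a [aA aG]]] := noeth_res nk fgR (fg_free R T) (@Submod k (res F) _ A0 AP).
(* The rows [a j] generate the relations between the functionals [uu]. A map from [quot S] to [X] is
   a vector in [X^J] which the matrix sends to zero in the [L]-coordinates; the resulting
   [I]-coordinates are the images of the [w i]. *)
pose col t : {ffun J -> R^o} := [ffun j => a j t].
pose S := gen (fun l => col (inr l)).
have colE X (g : {linear quot S -> X}) t :
    g (quot_map S (col t)) = \sum_j (a j t : R) *: g (quot_map S (basis R j)).
  rewrite [LHS](free_mapE (lcomp g (quot_map S))); apply: eq_bigr => j _.
  by rewrite ffunE.
exists (quot S), (fun i => quot_map S (col (inl i))); split.
  by apply: fg_quot; apply: fg_free.
move=> X b; split=> [bE|[g bE] x]; last first.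
  have : \sum_t uu t (x (g (quot_map S (col t)))) = 0.
    under eq_bigr do rewrite colE.
    rewrite sum_comb big1 // => j _; exact: aA.
  rewrite big_sumType /= [X in _ + X]big1 ?addr0 => [|l _]; last first.
    have /quot_map_eq0 -> : S (col (inr l)) by apply: gen_mem.
    by rewrite !linear0.
  by under eq_bigr do rewrite -bE.
pose z0 : {ffun T -> res X} := [ffun t => match t with inl i => b i | inr _ => 0 end].
have P0 : exists c : J -> X, forall t, (0 : {ffun T -> res X}) t = \sum_j (a j t : R) *: c j.
  by exists (fun=> 0) => t; rewrite ffunE big1 // => j _; rewrite scaler0.
have PP (r : k) (z z' : {ffun T -> res X}) :
    (exists c : J -> X, forall t, z t = \sum_j (a j t : R) *: c j) ->
    (exists c : J -> X, forall t, z' t = \sum_j (a j t : R) *: c j) ->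
    exists c : J -> X, forall t, (r *: z + z') t = \sum_j (a j t : R) *: c j.
  move=> [c zE] [c' z'E]; exists (fun j => phi r *: c j + c' j) => t.
  rewrite !ffunE zE z'E resZ scaler_sumr -big_split; apply: eq_bigr => j _.
  by rewrite scalerDr !scalerA cen.
have [[c cE]|nP] := pselect (exists c : J -> X, forall t, z0 t = \sum_j (a j t : R) *: c j).
  have [|x /(@quot_map_eq0 _ _ S) [r ->]|g gE] :=
      @factor_surj _ _ _ _ (quot_map S) (free_map c).
  - exact: quot_map_surj.
  - rewrite linear_comb big1 // => l _; have := cE (inr l); rewrite ffunE => cl.
    rewrite /=; under eq_bigr do rewrite ffunE.
    by rewrite -cl scaler0.
  exists g => i; rewrite gE /=; have := cE (inl i); rewrite ffunE => ->.
  by apply: eq_bigr => j _; rewrite ffunE.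
(* If [(b, 0)] is not in the image of the matrix, a functional separates it from that image. By
   [pairing_represents] this functional comes from a linear map [h : X -> Y], which contradicts the
   assumption on [b]. *)
have [f [fP]] := dual_separates dE (P := @Submod _ {ffun T -> res X} _ P0 PP) nP.
case; have flin (t0 : X) : linear (fun s : res F => f [ffun t => (s t : R) *: t0]).
  move=> r s s'; rewrite -(linP f); congr (f _); apply/ffunP => t.
  by rewrite !ffunE scalerDl -scalerA.
have hE (t0 : X) : exists y : Y, forall s : res F,
    f [ffun t => (s t : R) *: t0] = pr s y.
  apply: (pairing_represents dE (f := mklin (flin t0)) prl prr) => [|s /aG [c ->]].
    exact: fg_res.
  apply: fP; exists (fun j => phi (c j) *: t0) => t; rewrite ffunE.
  rewrite (_ : (\sum_i c i *: a i : res F) t = \sum_i phi (c i) * a i t); last first.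
    by rewrite sum_ffunE; apply: eq_bigr => j _; rewrite ffunE.
  rewrite scaler_suml; apply: eq_bigr => j _.
  by rewrite scalerA cen.
have [h hP] := choice hE.
have pr1 t y : pr (single t (1 : R^o)) y = uu t y.
  rewrite /pr (bigD1 t) //= ffunE eqxx scale1r big1 ?addr0 // => s /negbTE st.
  by rewrite ffunE st scale0r linear0.
(* Values of [h] were chosen one by one; linearity holds because the [v l] separate [Y]. *)
have hlin : linear h.
  move=> r x y; apply/subr0_eq/v_sep => l.
  rewrite (linearB (v l)) -[v l (h _)](pr1 (inr l)) -hP.
  rewrite -[v l _](pr1 (inr l)).
  pose s1 : res F := single (inr l) (1 : R^o).
  rewrite [X in _ - X](_ : _ = pr (rmul r s1) (h x) + pr s1 (h y)).
    rewrite -!hP -linearD -linearB; apply: (etrans _ (linear0 f)); congr (f _).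
    apply/ffunP => t; rewrite !ffunE scalerDr scalerA.
    exact: subrr.
  rewrite /pr -big_split; apply: eq_bigr => t _ /=; rewrite -linearD; congr (uu t _).
  by rewrite !ffunE scalerDr scalerA.
rewrite (ffun_single z0) linear_sum big_sumType /= [X in _ + X]big1 => [|l _].
  rewrite addr0 -[RHS](bE (mklin hlin)); apply: eq_bigr => i _ /=.
  rewrite -[u i _](pr1 (inl i)) -hP; congr (f _); apply/ffunP => t.
  by rewrite !ffunE; case: eqP => _; rewrite ?scale1r ?scale0r.
apply: (etrans _ (linear0 f)); congr (f _); apply/ffunP => t.
by rewrite !ffunE if_same.
Qed.

End Kernels.

(** * Exact sequences joining Hom and dual Hom *)

Section Presentations.

Variables (k : comPzRingType) (R : pzRingType) (phi : {rmorphism k -> R}).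
Hypotheses (cen : central phi) (nk : noeth k^o) (fgR : fg (res phi R^o)).
Variables (E : lmodType k) (dE : dualizing E).

Implicit Types X Y M N B : lmodType R.

Local Notation res := (res phi).
Local Notation homk := (homk cen).
Local Notation dual M := {linear res M -> E}.

(** With relations [a] between the elements [q i] and generators of [B], Hom(B, M) is the kernel of
    the matrix [a] from [M^T] to [M^J]. A functional that kills it factors through [M^J] by
    injectivity of [E], and functionals on [M^J] are maps from [M] to Hom_k(R^J, E). The submodule
    [L] imposes that the functional not involve the coordinates of the auxiliary generators. *)
Lemma hom_kernel B (I : finType) (q : I -> B) : fg B ->
  exists (L : lmodType R) (l : I -> dual L), fg L /\
    forall M (f : I -> dual M),
      (forall g : {linear B -> M}, \sum_i f i (g (q i)) = 0) <->
      exists u : {linear M -> L}, forall i m, f i m = l i (u m).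
Proof.
move=> [D [p [_ pP]]].
pose T := (I + D)%type.
pose qq (t : T) : B := match t with inl i => q i | inr d => p d end.
pose F := {ffun T -> R^o}.
have A0 : free_map qq (0 : res F) = 0 by apply: linear0.
have AP (a : k) (s s' : res F) : free_map qq s = 0 -> free_map qq s' = 0 ->
    free_map qq (a *: s + s') = 0.
  by move=> s0 s'0; rewrite (linP (free_map qq)) s0 s'0 scaler0 addr0.
have [J [a [aA aG]]] := noeth_res nk fgR (fg_free R T)
  (@Submod k (res F) (fun s => free_map qq s = 0) A0 AP).
pose col t : {ffun J -> R^o} := [ffun j => a j t].
pose K := coind E J phi.
pose ap (f : K) (x : res {ffun J -> R^o}) : E := (f : {linear _ -> _}) x.
have apD f g x : ap (f + g) x = ap f x + ap g x by [].
have apZ r f x : ap (r *: f) x = ap f (rmul r x) by [].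
have L0 : forall d s, ap 0 (rmul s (col (inr d))) = 0 by [].
have LP (r : R) f g : (forall d s, ap f (rmul s (col (inr d))) = 0) ->
    (forall d s, ap g (rmul s (col (inr d))) = 0) ->
    forall d s, ap (r *: f + g) (rmul s (col (inr d))) = 0.
  move=> f0 g0 d s; rewrite apD apZ g0 addr0 -(f0 d (s * r)).
  by congr (ap f _); apply/ffunP => j; rewrite !ffunE mulrA.
pose S := @Submod R K _ L0 LP.
have llin i : linear (fun f : res (submod_type S) => ap (submod_val S f) (col (inl i))).
  move=> r f g; rewrite [submod_val S _](linP (submod_val S) (phi r)) apD apZ.
  rewrite -(linZ (submod_val S f : {linear res {ffun J -> R^o} -> E})); congr (_ + _).
  congr (ap _ _); apply/ffunP => j; rewrite [LHS]ffunE.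
  by rewrite [RHS]ffunE /GRing.scale /= cen.
exists (submod_type S), (fun i => mklin (llin i)); split.
  by apply: (fg_submod nk fgR); apply: fg_coind.
move=> M f; split=> [f0|[u uE] g]; last first.
  pose U (m : M) : K := submod_val S (u m).
  have UL d m : ap (U m) (col (inr d)) = 0.
    rewrite -(submod_typeP (u m) d 1); congr (ap _ _); apply/ffunP => j.
    by rewrite !ffunE mulr1.
  have Ucol t m : ap (U m) (col t) = \sum_j ap (U ((a j t : R) *: m)) (basis R j).
    have -> : col t = \sum_j rmul (a j t) (basis R j).
      rewrite [LHS]ffun_single; apply: eq_bigr => j _; apply/ffunP => i.
      by rewrite !ffunE; case: eqP => _; rewrite ?mul1r ?mul0r.
    rewrite [LHS](linear_sum (U m : {linear res {ffun J -> R^o} -> E})).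
    by apply: eq_bigr => j _; rewrite /U !linZ.
  have : \sum_t ap (U (g (qq t))) (col t) = 0.
    under eq_bigr do rewrite Ucol.
    rewrite exchange_big big1 // => j _.
    have lin : linear (fun m : M => U m).
      by move=> c x y; rewrite /U !linP.
    have -> : \sum_t ap (U ((a j t : R) *: g (qq t))) (basis R j) =
        ap (\sum_t U ((a j t : R) *: g (qq t))) (basis R j).
      by elim/big_rec2: _ => // t x y _ ->; rewrite apD.
    rewrite -(linear_sum (mklin lin)) /=; under eq_bigr do rewrite -linZ.
    rewrite -linear_sum -[\sum_t _]/(free_map qq (a j)) aA linear0.
    by rewrite [U 0](linear0 (mklin lin)).
  rewrite big_sumType /= [X in _ + X]big1 ?addr0 => [UE|d _]; last exact: UL.
  by rewrite -[RHS]UE; apply: eq_bigr => i _; rewrite uE.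
pose Am (m : {ffun T -> res M}) : {ffun J -> res M} :=
  [ffun j => \sum_t (a j t : R) *: (m t : M)].
have Alin : linear Am.
  move=> r m m'; apply/ffunP => j; rewrite !ffunE resZ scaler_sumr -big_split.
  by apply: eq_bigr => t _; rewrite !ffunE resZ scalerDr !scalerA cen.
have ff_lin : linear (fun m : {ffun T -> res M} => \sum_i f i (m (inl i))).
  move=> r m m'; rewrite scaler_sumr -big_split; apply: eq_bigr => i _ /=.
  by rewrite !ffunE (linP (f i)).
have [m /= Am0|h hE] := dual_injective dE (A := mklin Alin) (f := mklin ff_lin).
  have [|s qs0|g gE] := @factor_surj _ _ _ _ (free_map qq) (free_map (m : T -> M)).
  - move=> b; have [c ->] := pP b Logic.I.
    exists [ffun t => if t is inr d then c d else 0].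
    rewrite /= big_sumType /= big1 ?add0r => [|i _]; last by rewrite ffunE scale0r.
    by apply: eq_bigr => d _; rewrite ffunE.
  - have [c ->] := aG s qs0.
    pose fm : {linear res F -> res M} := res_lin phi (free_map (m : T -> M)).
    rewrite [LHS](linear_comb fm) big1 // => j _.
    by have /ffunP/(_ j) := Am0; rewrite !ffunE => mj; rewrite [fm _]mj scaler0.
  rewrite -[RHS](f0 g); apply: eq_bigr => i _; congr (f i _).
  by rewrite -(free_map_basis (m : T -> M) (inl i)) -gE free_map_basis.
have Am1 t (m : res M) : Am (single t m) = [ffun j => (a j t : R) *: (m : M)].
  apply/ffunP => j; rewrite !ffunE (bigD1 t) //= ffunE eqxx big1 ?addr0 //.
  by move=> s /negbTE st; rewrite ffunE st scaler0.
have u0lin (m : M) : linear (fun x : res {ffun J -> R^o} => h [ffun j => (x j : R) *: m]).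
  move=> r x y; rewrite -(linP h); congr (h _); apply/ffunP => j.
  by rewrite !ffunE scalerDl -scalerA.
pose u0 (m : M) : K := mklin (u0lin m).
have u0l : linear u0.
  move=> r m m'; apply: linear_ext => x; rewrite [RHS]coindP /= -linearD.
  by congr (h _); apply/ffunP => j; rewrite !ffunE scalerDr scalerA.
have u0S m : S (u0 m).
  move=> d s; rewrite /ap /=.
  rewrite (_ : [ffun j => _] = Am (single (inr d) (s *: m : res M))).
    rewrite [LHS]hE /= big1 // => i _; rewrite ffunE /=; exact: linear0.
  by rewrite Am1; apply/ffunP => j; rewrite !ffunE scalerA.
have [||u uE] := @factor_inj _ M _ K (submod_val S) (mklin u0l).
- exact: submod_type_inj.
- by move=> m; exists (in_submod (u0S m)).
exists u => i m; change (f i m = ap (submod_val S (u m)) (col (inl i))).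
rewrite uE /ap /=.
rewrite (_ : [ffun j => _] = Am (single (inl i) (m : res M))).
  rewrite [RHS]hE /= (bigD1 i) //= ffunE eqxx big1 ?addr0 // => i' /negbTE ii.
  by rewrite ffunE (inj_eq (@inl_inj _ _)) ii linear0.
by rewrite Am1; apply/ffunP => j; rewrite !ffunE.
Qed.

(** Exactness for [X] in [P] of Hom(X, Y1) -> Hom(X, Y0) -> D Hom(B0, X) -> D Hom(B1, X), where the
    middle map sends [x] to [g |-> xi (lcomp x g)]. The first two fields make the composites
    vanish. *)
Record presents (P : lmodType R -> Prop) (B0 B1 Y1 Y0 : lmodType R)
    (beta : {linear B0 -> B1}) (d : {linear Y1 -> Y0})
    (xi : {linear homk B0 Y0 -> E}) : Prop := Presents {
  presents_d : forall y : {linear B0 -> Y1}, xi (lcomp d y) = 0;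
  presents_beta : forall z : {linear B1 -> Y0}, xi (lcomp z beta) = 0;
  presents_ker : forall X (x : {linear X -> Y0}), P X ->
    (forall g : {linear B0 -> X}, xi (lcomp x g) = 0) ->
    exists w : {linear X -> Y1}, forall t, x t = d (w t);
  presents_im : forall X (f : {linear homk B0 X -> E}), P X ->
    (forall g : {linear B1 -> X}, f (lcomp g beta) = 0) ->
    exists x : {linear X -> Y0}, forall g : {linear B0 -> X}, f g = xi (lcomp x g)
}.

(** By injectivity of [E], a functional on Hom(B0, M) is given by a family of functionals on [M],
    one for each generator of [B0]. The module [L] classifies the families that vanish on maps
    through [beta], and [L'] those that vanish on all maps from [B0]. *)
Theorem exists_presentation (B0 B1 : lmodType R) (beta : {linear B0 -> B1}) :
  fg B0 -> fg B1 ->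
  exists (Z1 Z0 : lmodType R) (d : {linear Z1 -> Z0}) (xi : {linear homk B0 Z0 -> E}),
    [/\ fg Z1, fg Z0 & presents (fun=> True) beta d xi].
Proof.
move=> fgB0 fgB1; have [I [p [_ pP]]] := fgB0.
have [L [l [fgL lP]]] := hom_kernel (fun i => beta (p i)) fgB1.
have [L' [l' [fgL' l'P]]] := hom_kernel p fgB0.
(* Classifying maps are not known to be unique, so pairs defining the same functionals replace a map
   from [L'] to [L]; the scalar [r] makes the condition stable under [R]. *)
have S0 : forall i r, l i (r *: (0 : (L * L')%type).1) = l' i (r *: (0 : (L * L')%type).2).
  by move=> i r; rewrite !scaler0 !linear0.
have SP (a : R) (x y : (L * L')%type) :
    (forall i r, l i (r *: x.1) = l' i (r *: x.2)) ->
    (forall i r, l i (r *: y.1) = l' i (r *: y.2)) ->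
    forall i r, l i (r *: (a *: x + y).1) = l' i (r *: (a *: x + y).2).
  move=> xP yP i r; rewrite /= !scalerDr !scalerA.
  by rewrite (linearD (l i)) (linearD (l' i)) xP yP.
pose S := @Submod R (L * L')%type _ S0 SP.
pose d : {linear submod_type S -> L} := lcomp (fst_lin L L') (submod_val S).
have xilin : linear (fun x : homk B0 L => \sum_i l i (homk_lin x (p i))).
  move=> a x y; rewrite scaler_sumr -big_split; apply: eq_bigr => i _ /=.
  by rewrite -(linP (l i)); congr (l i _); exact: (homkP a x y (p i)).
exists (submod_type S), L, d, (mklin xilin); split=> //.
  by apply: (fg_submod nk fgR); apply: fg_prod.
split=> [y|z|X x _ x0|X f _ f0].
- rewrite -[RHS](iffRL (l'P L' l') _ (lcomp (lcomp (snd_lin L L') (submod_val S)) y)); last first.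
    by exists idfun.
  apply: eq_bigr => i _ /=.
  by have := submod_typeP (y (p i)) i 1; rewrite !scale1r.
- by apply: (iffRL (lP L l)); exists idfun.
- have [|u uE] := iffLR (l'P X (fun i => (l i \o res_lin phi x : dual X))); first exact: x0.
  have wS t : S (x t, u t).
    by move=> i r; rewrite /= -!linZ; exact: uE.
  have [||w wE] := @factor_inj _ X _ _ (submod_val S) (pair_lin x u).
  + exact: submod_type_inj.
  + by move=> t; exists (in_submod (wS t)).
  by exists w => t; change (x t = (submod_val S (w t)).1); rewrite wE.
have p_gen x : gen p x by apply: pP.
have [g g0|h hE] := dual_injective dE (A := evals cen X p) (f := f).
  suff -> : g = 0 by rewrite linear0.
  by apply: (evals_inj p_gen); rewrite g0 linear0.
have lin1 i : linear (fun m : res X => h (single i m)).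
  move=> a x y; rewrite -(linP h); congr (h _); apply/ffunP => j.
  by rewrite !ffunE; case: eqP; rewrite ?scaler0 ?addr0.
have fE (g : homk B0 X) : f g = \sum_i mklin (lin1 i) (homk_lin g (p i)).
  rewrite -hE (ffun_single (evals _ _ _ _)) linear_sum; apply: eq_bigr => i _ /=.
  by rewrite ffunE.
have [|u uE] := iffLR (lP X (fun i => mklin (lin1 i))).
  by move=> g; rewrite -[RHS](f0 g) fE.
by exists u => g; rewrite fE; apply: eq_bigr => i _; rewrite uE.
Qed.

(** Functionals on Hom(X, Y0) are families of elements of [X], by [functional_homk]. Maps from [W]
    classify the families whose functional kills the maps through [d], and maps from [W'] those
    whose functional is zero. For [X] in [C], maps from [W] extend to [B0]; an extension gives the
    zero functional when it extends to the amalgam [quot S] of [B0] and [W'], and then to [B1]. *)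
Theorem exists_copresentation (C : lmodType R -> Prop) (Y1 Y0 : lmodType R)
    (d : {linear Y1 -> Y0}) :
  (forall M, C M -> fg M) ->
  (forall W, fg W -> exists (B : lmodType R) (p : {linear W -> B}), C B /\
     forall X, C X -> forall g : {linear W -> X},
       exists g' : {linear B -> X}, forall x, g x = g' (p x)) ->
  fg Y1 -> fg Y0 ->
  exists (B0 B1 : lmodType R) (beta : {linear B0 -> B1}) (xi : {linear homk B0 Y0 -> E}),
    [/\ C B0, C B1 & presents C beta d xi].
Proof.
move=> Cfg env fgY1 fgY0.
have [I [v v_sep]] := separating_family dE nk (fg_res fgR fgY0).
have [W [w [fgW wP]]] :=
  tensor_kernel cen nk fgR dE (fun i => (v i \o res_lin phi d : dual Y1)) fgY1.
have [W' [w' [fgW' w'P]]] := tensor_kernel cen nk fgR dE v fgY0.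
have [B0 [p [CB0 pP]]] := env W fgW.
pose S := gen (fun i => (p (w i), - w' i)).
have [B1 [q [CB1 qP]]] : exists (B : lmodType R) (q : {linear quot S -> B}), C B /\
     forall X, C X -> forall g : {linear quot S -> X},
       exists g' : {linear B -> X}, forall x, g x = g' (q x).
  by apply/env/fg_quot/fg_prod => //; apply: Cfg.
have jBlin : linear (fun x : B0 => quot_map S (x, 0)).
  by move=> a x y; rewrite -linearP; congr (quot_map S (_, _)); rewrite /= ?scaler0 ?addr0.
have jWlin : linear (fun x : W' => quot_map S (0, x)).
  by move=> a x y; rewrite -linearP; congr (quot_map S (_, _)); rewrite /= ?scaler0 ?addr0.
pose jB := mklin jBlin; pose jW := mklin jWlin.
have jBW i : jB (p (w i)) = jW (w' i).
  apply/subr0_eq; rewrite /= -linearB; apply/quot_map_eq0.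
  rewrite (_ : _ - _ = (p (w i), - w' i)); first exact: (gen_mem (fun i => (p (w i), - w' i))).
  by congr pair; rewrite /= ?subr0 ?sub0r.
pose beta := lcomp q jB.
have xilin : linear (fun x : homk B0 Y0 => \sum_i v i (homk_lin x (p (w i)))).
  move=> a x y; rewrite scaler_sumr -big_split; apply: eq_bigr => i _ /=.
  by rewrite -(linP (v i)); congr (v i _); exact: (homkP a x y (p (w i))).
exists B0, B1, beta, (mklin xilin); split=> //.
have xi_ker X (g : {linear B0 -> X}) : C X ->
    (forall x : {linear X -> Y0}, \sum_i v i (x (g (p (w i)))) = 0) ->
    exists g' : {linear B1 -> X}, g = lcomp g' beta.
  move=> CX /w'P [g' g'E].
  have mlin : linear (fun s : (B0 * W')%type => g s.1 + g' s.2).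
    by move=> a x y; rewrite (linP g) (linP g') scalerDr addrACA.
  have [||h hE] := @factor_surj _ _ _ _ (quot_map S) (mklin mlin).
  - exact: quot_map_surj.
  - move=> x /(@quot_map_eq0 _ _ S) [c ->].
    rewrite linear_comb big1 // => i _.
    by rewrite /= linearN g'E subrr scaler0.
  have [h' h'E] := qP X CX h; exists h'; apply: linear_ext => x.
  change (g x = h' (q (quot_map S (x, 0)))).
  by rewrite -h'E hE /= linear0 addr0.
split=> [y|z|X x CX x0|X f CX f0].
- by apply: (iffRL (wP B0 (fun i => p (w i)))); exists p.
- apply: etrans (iffRL (w'P B1 (fun i => q (jW (w' i)))) _ z).
    by apply: eq_bigr => i _; congr (v i (z (q _))); exact: jBW.
  by exists (lcomp q jW).
(* If [x] does not factor through [d], some functional kills the maps that do but not [x]; it comes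
   from a map [B0 -> X], on which [x0] makes it vanish. *)
- apply: contrapT => nd.
  have P0 : exists y : {linear X -> Y1}, (0 : homk X Y0) = lcomp d y.
    by exists \0; apply: linear_ext => t; rewrite /= linear0.
  have PP (a : k) (z z' : homk X Y0) :
      (exists y : {linear X -> Y1}, z = lcomp d y) ->
      (exists y : {linear X -> Y1}, z' = lcomp d y) ->
      exists y : {linear X -> Y1}, a *: z + z' = lcomp d y.
    move=> [y ->] [y' ->]; exists (a *: (y : homk X Y1) + y').
    by symmetry; exact: (linP (postcomp cen X d) a y y').
  have [|f [fd fx]] := dual_separates dE (P := @Submod _ (homk X Y0) _ P0 PP) (x := x).
    by case=> y xE; apply: nd; exists y => t; rewrite xE.
  apply: fx; have [b fE] := functional_homk fgR dE f (Cfg X CX) v_sep.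
  have [|g gE] := iffLR (wP X b).
    by move=> y; rewrite -[RHS](fd (lcomp d y)) ?fE //; exists y.
  have [g' g'E] := pP X CX g.
  rewrite fE -[RHS](x0 g'); apply: eq_bigr => i _ /=.
  by rewrite gE g'E.
(* Here the pairing is read from its other side: functionals of [g] are represented by maps [x]. *)
pose pr (g : homk B0 X) (x : homk X Y0) := \sum_i v i (homk_lin x (homk_lin g (p (w i)))).
have [x a g h|g a x y||g g0|x xE] := pairing_represents dE (b := pr) (f := f).
- rewrite /pr scaler_sumr -big_split; apply: eq_bigr => i _ /=.
  rewrite -(linP (v i)); congr (v i _).
  apply: etrans (congr1 (homk_lin x) (homkP a g h (p (w i)))) _.
  exact: (linP (homk_lin x)).
- rewrite /pr scaler_sumr -big_split; apply: eq_bigr => i _ /=.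
  rewrite -(linP (v i)); congr (v i _).
  exact: (homkP a x y (homk_lin g (p (w i)))).
- by apply: (fg_homk cen nk fgR); [apply: Cfg | ].
- have [|g' ->] := xi_ker X g CX; first exact: g0.
  exact: f0.
by exists x => g; rewrite xE.
Qed.

End Presentations.

(** * Complexes *)

Section Families.

Variable F : int -> Type.

Definition upd (f : forall n, F n) n (a : F n) : forall m, F m :=
  fun m => if n =P m is ReflectT e then eq_rect n F a m e else f m.

Lemma upd_eq f n (a : F n) : upd f a n = a.
Proof. by rewrite /upd; case: eqP => // e; rewrite (eq_irrelevance e erefl). Qed.

Lemma upd_neq f n (a : F n) m : n != m -> upd f a m = f m.
Proof. by rewrite /upd; case: eqP. Qed.

(** Dependent recursion towards negative degrees, for building homotopies and chain maps. As [Q]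
    links degrees [n] and [n + 1], nothing is transported along equalities of degrees in its uses;
    each step changes a single degree. *)
Lemma descending_family (Q : forall n, F n -> F (n + 1) -> Prop) (N : int)
    (f0 : forall n, F n) :
  (forall n, N <= n -> Q n (f0 n) (f0 (n + 1))) ->
  (forall n (f : forall n, F n), n < N -> (forall m, n < m -> Q m (f m) (f (m + 1))) ->
     exists a, Q n a (f (n + 1))) ->
  exists f : forall n, F n,
    (forall n, N <= n -> f n = f0 n) /\ (forall n, Q n (f n) (f (n + 1))).
Proof.
move=> Q0 step.
pose good (i : nat) f := forall m, N - i%:Z <= m -> Q m (f m) (f (m + 1)).
have stepP (p : nat * (forall n, F n)) : exists f, good p.1 p.2 ->
    good p.1.+1 f /\ forall m, N - p.1%:Z <= m -> f m = p.2 m.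
  case: p => i f /=.
  have [gf|] := pselect (good i f); last by exists f.
  have [||a Qa] := step (N - i.+1%:Z) f; [lia| |].
    by move=> m Nm; apply: gf; lia.
  exists (upd f a) => _; split=> m Nm; last by rewrite upd_neq //; lia.
  have [->|mN] := eqVneq m (N - i.+1%:Z).
    by rewrite upd_eq upd_neq //; lia.
  by rewrite !upd_neq; [apply: gf| | ]; lia.
have [s sP] := choice stepP.
pose fix g i := if i is j.+1 then s (j, g j) else f0.
have gg i : good i (g i).
  by elim: i => [|i IHi] m /=; [rewrite subr0; apply: Q0 | apply: (sP (i, g i) IHi).1].
have gS i m : N - i%:Z <= m -> g i.+1 m = g i m by apply: (sP (i, g i) (gg i)).2.
have gD j i m : N - i%:Z <= m -> g (j + i)%N m = g i m.
  by elim: j => // j IHj Nm; rewrite addSn gS ?IHj //; lia.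
(* In degree [n < N] the families no longer change after [N - n] steps. *)
pose f n := g `|N - n|%N n.
have fE i n : N - i%:Z <= n -> f n = g i n.
  move=> Nn; rewrite /f -(gD i `|N - n|%N); last by lia.
  by rewrite addnC gD.
exists f; split=> n; first by move=> Nn; rewrite (fE 0) //; lia.
rewrite (fE `|N - n|%N) ?(fE `|N - n|%N (n + 1)); try lia.
by apply: gg; lia.
Qed.

End Families.

Section Subcomplex.

Variable R : pzRingType.
Variables (A : int -> lmodType R) (D : forall n, {linear A n -> A (n + 1)}).
Variable P : forall n, submod (A n).
Hypothesis PD : forall n x, P n x -> P (n + 1) (D n x).
Hypothesis DD : forall n x, P n x -> D (n + 1) (D n x) = 0.

Fact sub_diff_linear n : linear (fun x : submod_type (P n) =>
  in_submod (PD (submod_typeP x)) : submod_type (P (n + 1))).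
Proof. by move=> a x y; apply: submod_type_inj; rewrite /= linearP. Qed.

Fact sub_diffK n (x : submod_type (P n)) :
  mklin (@sub_diff_linear (n + 1)) (mklin (@sub_diff_linear n) x) = 0.
Proof. by apply: submod_type_inj; apply/DD/submod_typeP. Qed.

(** Complexes given by cases on the degree are cut out of an ambient family by predicates, so that
    the types of the terms need no case analysis. *)
Definition subcomplex : complex R := Complex sub_diffK.

End Subcomplex.

Section Stalk.

Variable R : pzRingType.
Implicit Types M : lmodType R.

Fact stalk0 M (m n : int) : m = n \/ 0 = 0 :> M. Proof. by right. Qed.
Fact stalkP M (m n : int) (a : R) (x y : M) :
  m = n \/ x = 0 -> m = n \/ y = 0 -> m = n \/ a *: x + y = 0.
Proof. by move=> [|->]; [left | case=> [|->]; [left | right; rewrite scaler0 addr0]]. Qed.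

Definition stalk_submod M m n := @Submod R M _ (@stalk0 M m n) (@stalkP M m n).

Fact stalk_D M m n x : stalk_submod M m n x -> stalk_submod M m (n + 1) (\0 x : M).
Proof. by right. Qed.

Definition stalk M (m : int) : complex R :=
  @subcomplex R (fun=> M) (fun n => \0) (stalk_submod M m) (@stalk_D M m)
    (fun _ _ _ => erefl).

Lemma stalk_zero M m n : m != n -> zero_module (stalk M m n).
Proof.
move=> mn x; apply: submod_type_inj.
by case: (submod_typeP x) => // e; rewrite e eqxx in mn.
Qed.

Definition stalk_in M m : {linear M -> stalk M m m}.
Proof.
apply: (@mklin _ M (stalk M m m) (fun x => in_submod (or_introl erefl : stalk_submod M m m x))).
by move=> a x y; apply: submod_type_inj.
Defined.

Definition stalk_val M m n : {linear stalk M m n -> M} := submod_val (stalk_submod M m n).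

Lemma stalk_inK M m (x : stalk M m m) : stalk_in M m (stalk_val M m m x) = x.
Proof. exact: submod_type_inj. Qed.

Lemma stalk_valK M m x : stalk_val M m m (stalk_in M m x) = x.
Proof. by []. Qed.

Variable X : complex R.

Definition stalk_fam M m (u : {linear M -> X m}) : forall n, {linear M -> X n} :=
  upd (fun n => \0 : {linear M -> X n}) u.

Fact stalk_map_diff M m (u : {linear M -> X m}) (du : forall x, cdiff _ m (u x) = 0)
    n (x : stalk M m n) :
  (stalk_fam u (n + 1) \o stalk_val M m (n + 1)) (cdiff _ n x) =
  cdiff _ n ((stalk_fam u n \o stalk_val M m n) x).
Proof.
rewrite [LHS](linear0 (stalk_fam u (n + 1))) /= /stalk_fam.
have [e|mn] := eqVneq m n; last by rewrite upd_neq // linear0.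
by move: x; rewrite -e => x; rewrite upd_eq du.
Qed.

Definition stalk_map M m (u : {linear M -> X m}) (du : forall x, cdiff _ m (u x) = 0) :
  chain_map (stalk M m) X := ChainMap (stalk_map_diff du).

Lemma stalk_mapE M m u du x : @stalk_map M m u du m (stalk_in M m x) = u x.
Proof. by rewrite /= /stalk_fam upd_eq. Qed.

Lemma stalk_map_ext M m (f g : chain_map (stalk M m) X) :
  (forall x, f m (stalk_in M m x) = g m (stalk_in M m x)) -> forall n x, f n x = g n x.
Proof.
move=> fg n x; have [e|mn] := eqVneq m n; last first.
  by rewrite (stalk_zero mn x) !linear0.
by move: x; rewrite -e => x; rewrite -[x]stalk_inK.
Qed.

End Stalk.

(** * Comparison of complexes by relative exactness *)

Section Comparison.

Variable R : pzRingType.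
Implicit Types (X Y : complex R) (P : lmodType R -> Prop).

Lemma linear_diff_linear (U V : lmodType R) (f g : {linear U -> V}) :
  linear (fun x => f x - g x).
Proof. by move=> a x y; rewrite (linP f) (linP g) scalerBr opprD addrACA. Qed.

Definition lin_sub (U V : lmodType R) (f g : {linear U -> V}) : {linear U -> V} :=
  mklin (linear_diff_linear f g).

(** Every map from [M] placed in degree [n + 1] to [Y] is null-homotopic: exactness as seen by the
    modules in [P], not exactness of [Y] itself. *)
Definition exact_at P Y n := forall M, P M -> forall u : {linear M -> Y (n + 1)},
  (forall x, cdiff Y (n + 1) (u x) = 0) ->
  exists w : {linear M -> Y n}, forall x, u x = cdiff Y n (w x).

Definition exact_neg P Y := forall n : int, n + 1 < 0 -> exact_at P Y n.

(** The terms of [X] play the part of projectives for [exact_at], so the homotopy continues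
    downwards as between projective resolutions. *)
Lemma homotopic_of_degree0 P X Y (f g : chain_map X Y) (w : {linear X 0 -> Y (-1)}) :
  (forall n, P (X n)) -> in_nonpositive_degrees X -> exact_neg P Y ->
  (forall x, f 0 x - g 0 x = cdiff Y (-1) (w x)) -> homotopic f g.
Proof.
move=> PX X0 exY fg.
pose F n := {linear X (n + 1) -> Y n}.
pose Q n (a : F n) (b : F (n + 1)) := forall x : X (n + 1),
  f (n + 1) x - g (n + 1) x = cdiff Y n (a x) + b (cdiff X (n + 1) x).
have [n n0 x|n h n0 hQ|h [_ hQ]] := @descending_family F Q 0 (fun n => \0).
- by rewrite [x]X0 ?linear0 ?subr0 ?addr0 //; lia.
- have [n1|n1] := eqVneq n (-1).
    move: h hQ; rewrite n1 => h hQ; exists w => x.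
    by rewrite [cdiff X _ x](X0 (-1 + 1 + 1)) // linear0 addr0; apply: fg.
  pose v := lin_sub (lin_sub (f (n + 1)) (g (n + 1))) (lcomp (h (n + 1)) (cdiff X (n + 1))).
  have [||x|a aE] := exY n _ (X (n + 1)) _ v; [lia|exact: PX| |].
    rewrite /= !linearB -!cmap_diff (hQ (n + 1)); last lia.
    by rewrite cdiffK linear0 addr0 subrr.
  by exists a => x; rewrite -aE /= subrK.
by exists h.
Qed.

(** The component in degree -1 is part of the data because [exact_neg] asserts nothing in degree
    0. *)
Lemma chain_map_of_degree0 P X Y (x0 : {linear X 0 -> Y 0})
    (x1 : {linear X (-1) -> Y (-1)}) :
  (forall n, P (X n)) -> in_nonpositive_degrees X -> in_nonpositive_degrees Y ->
  exact_neg P Y -> (forall x, cdiff Y (-1) (x1 x) = x0 (cdiff X (-1) x)) ->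
  exists f : chain_map X Y, forall x, f 0 x = x0 x.
Proof.
move=> PX X0 Y0 exY x10.
pose F n := {linear X n -> Y n}.
pose Q n (a : F n) (b : F (n + 1)) := forall x : X n,
  b (cdiff X n x) = cdiff Y n (a x).
pose f0 : forall n, F n := upd (upd (fun n => \0 : F n) (x0 : F 0)) (x1 : F (-1)).
have f00 : f0 0 = x0 by rewrite /f0 upd_neq ?upd_eq.
have f01 : f0 (-1) = x1 by rewrite /f0 upd_eq.
have [n n1 x|n f n1 fQ|f [fE fQ]] := @descending_family F Q (-1) f0.
- have [n0|nn] := eqVneq n (-1).
    move: x; rewrite n0 => x; rewrite f01 x10 -f00; congr (_ _).
  have [e|n0] := eqVneq n 0.
    move: x; rewrite e => x; rewrite [LHS](Y0 (0 + 1)) ?[RHS](Y0 (0 + 1)) //.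
  by rewrite [x]X0 ?linear0 //; lia.
- have [||x|a aE] := exY n _ (X n) _ (lcomp (f (n + 1)) (cdiff X n)).
  + lia.
  + exact: PX.
  + by rewrite /= -(fQ (n + 1)) ?cdiffK ?linear0 //; lia.
  by exists a => x; rewrite -aE.
by exists (ChainMap fQ) => x; rewrite /= fE // f00.
Qed.

End Comparison.

Section Functionals.

Variables (k : comPzRingType) (R : pzRingType) (phi : {rmorphism k -> R}).
Variables (cen : central phi) (E : lmodType k).
Variables (B0 B1 : lmodType R) (beta : {linear B0 -> B1}).

Implicit Types (X Y : complex R) (P : lmodType R -> Prop) (M : lmodType R).

Local Notation S0 := (stalk B0 0).
Local Notation S1 := (stalk B1 0).

Fact stalk_beta_cocycle x : cdiff S1 0 (lcomp (stalk_in B1 0) beta x) = 0.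
Proof. exact: submod_type_inj. Qed.

Definition stalk_beta : chain_map S0 S1 := stalk_map stalk_beta_cocycle.

(* [f] is an element of the kernel of D Hom(B0, X) -> D Hom(B1, X), where     *)
(* Hom is taken in the homotopy category.                                     *)
Record functional X (f : chain_map S0 X -> E) : Prop := Functional {
  functional_homotopic : forall g g', homotopic g g' -> f g = f g';
  functional_linear : forall a (g g' h : chain_map S0 X),
    (forall n x, h n x = phi a *: g n x + g' n x) -> f h = a *: f g + f g';
  functional_beta : forall g : chain_map S1 X, f (chain_comp g stalk_beta) = 0
}.

(** [xi] is a universal element in the sense of Yoneda: it identifies homotopy classes of maps
    [X -> Y] with functionals on [X]. *)
Definition represents P Y (xi : chain_map S0 Y -> E) := functional xi /\
  forall X, (forall n, P (X n)) -> in_nonpositive_degrees X ->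
    (forall u v : chain_map X Y,
       (forall g, xi (chain_comp u g) = xi (chain_comp v g)) -> homotopic u v) /\
    (forall f, functional f ->
       exists u : chain_map X Y, forall g, xi (chain_comp u g) = f g).

Definition degree0 M X (g : chain_map (stalk M 0) X) : {linear M -> X 0} :=
  lcomp (g 0) (stalk_in M 0).

Fact in_degree0_cocycle M X (hX : in_nonpositive_degrees X) (u : {linear M -> X 0}) x :
  cdiff X 0 (u x) = 0.
Proof. exact: hX. Qed.

Definition in_degree0 M X (hX : in_nonpositive_degrees X) (u : {linear M -> X 0}) :
  chain_map (stalk M 0) X := stalk_map (in_degree0_cocycle hX u).

Lemma in_degree0E M X (hX : in_nonpositive_degrees X) (u : {linear M -> X 0}) x :
  in_degree0 hX u 0 (stalk_in M 0 x) = u x.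
Proof. exact: (@stalk_mapE _ X M 0 u (in_degree0_cocycle hX u) x). Qed.

Lemma degree0K M X (hX : in_nonpositive_degrees X) (u : {linear M -> X 0}) :
  degree0 (in_degree0 hX u) = u.
Proof. by apply: linear_ext => x; apply: in_degree0E. Qed.

Lemma degree0_comp M X Y (u : chain_map X Y) (g : chain_map (stalk M 0) X) :
  degree0 (chain_comp u g) = lcomp (u 0) (degree0 g).
Proof. exact: linear_ext. Qed.

Lemma degree0_inj M X (f g : chain_map (stalk M 0) X) :
  degree0 f = degree0 g -> forall n x, f n x = g n x.
Proof.
move=> fg; apply: stalk_map_ext => x.
exact: (congr1 (fun h : {linear _ -> _} => h x) fg).
Qed.

Lemma in_degree0_boundary M X (hX : in_nonpositive_degrees X) (y : {linear M -> X (-1)}) :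
  homotopic (in_degree0 hX (lcomp (cdiff X (-1)) y)) (chain_zero (stalk M 0) X).
Proof.
pose F n := {linear stalk M 0 (n + 1) -> X n}.
exists (upd (fun n => \0 : F n) (lcomp y (stalk_val M 0 0) : F (-1))) => n x.
have [e|n1] := eqVneq n (-1).
  move: x; rewrite e => x; rewrite upd_eq subr0.
  rewrite [cdiff _ _ x](_ : _ = 0) ?linear0 ?addr0; last exact: submod_type_inj.
  by rewrite -[x in LHS](stalk_inK x); apply: stalk_mapE.
by rewrite [x](@stalk_zero _ M 0 (n + 1)) ?linear0 ?subr0 ?addr0 //; lia.
Qed.

(** Homotopy classes of maps from [B0] in degree 0 to [X] are maps to [X 0] modulo those through the
    differential. Exactness in [presents] is applied to [X 0] for the component in degree 0, and to
    [X (-1)] for the one in degree -1. *)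
Lemma presents_represents P Y (xi0 : {linear homk cen B0 (Y 0) -> E}) :
  in_nonpositive_degrees Y -> exact_neg P Y ->
  presents P beta (cdiff Y (-1) : {linear Y (-1) -> Y 0}) xi0 ->
  represents P (fun g => xi0 (degree0 g)).
Proof.
move=> Y0 exY [xid xib xiker xiim].
have xiD a (f g h : {linear B0 -> Y 0}) : (forall x, h x = phi a *: f x + g x) ->
    xi0 h = a *: xi0 f + xi0 g.
  move=> hE; rewrite -[RHS]linP; congr (xi0 _); apply: linear_ext => x.
  by rewrite hE homkP.
split; first split.
- move=> g g' [h hP].
  rewrite (xiD 1 (lcomp (cdiff Y (-1)) (lcomp (h (-1)) (stalk_in B0 0))) (degree0 g')).
    by rewrite xid scaler0 add0r.
  move=> x; rewrite rmorph1 scale1r; apply/(canRL (subrK _)).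
  rewrite [LHS](hP (-1) (stalk_in B0 0 x)) [cdiff S0 _ _](_ : _ = 0).
    by rewrite linear0 addr0.
  exact: submod_type_inj.
- by move=> a g g' h hE; apply: xiD => x; apply: hE.
- move=> g; rewrite -[RHS](xib (degree0 g)); congr (xi0 _); apply: linear_ext => x.
  by congr (g 0 _); apply: stalk_mapE.
move=> X PX hX; split=> [u v uv|f [f_hot f_lin f_beta]].
  have [|g|w wE] := xiker (X 0) (lin_sub (u 0) (v 0)); [exact: PX| |]; last first.
    by apply: (homotopic_of_degree0 PX hX exY (w := w)) => x; apply: wE.
  have := uv (in_degree0 hX g).
  rewrite !degree0_comp !degree0K.
  move=> e; rewrite (xiD (-1) (lcomp (v 0) g) (lcomp (u 0) g)).
    by rewrite e scaleN1r addNr.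
  by move=> x; rewrite rmorphN rmorph1 scaleN1r addrC.
have f0lin : linear (fun g : homk cen B0 (X 0) => f (in_degree0 hX (homk_lin g))).
  move=> a g h; apply: f_lin => n x.
  have [e|n0] := eqVneq 0 n; last by rewrite (stalk_zero n0 x) !linear0 scaler0 addr0.
  move: x; rewrite -e => x; rewrite -[x]stalk_inK.
  rewrite !in_degree0E.
  exact: homkP.
have f_ext (g g' : chain_map S0 X) : (forall n x, g n x = g' n x) -> f g = f g'.
  by move=> gg'; apply/f_hot/eq_homotopic.
have f_0 : f (chain_zero _ _) = 0.
  pose z : chain_map S0 X := chain_zero _ _; apply: (addrI (f z)); rewrite addr0.
  rewrite -[X in X + _]scale1r; apply/esym/f_lin => n x /=.
  by rewrite scaler0 addr0.
have [||x xE] := xiim (X 0) (mklin f0lin); first exact: PX.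
  move=> g /=; rewrite -[RHS](f_beta (in_degree0 hX g)); apply: f_ext.
  apply: degree0_inj; rewrite degree0K; apply: linear_ext => t.
  rewrite -[LHS](in_degree0E hX g); congr (in_degree0 hX g 0 _).
  exact/esym/stalk_mapE.
have [||w wE] := xiker (X (-1)) (lcomp x (cdiff X (-1))); first exact: PX.
  move=> g; rewrite (_ : lcomp _ g = lcomp x (lcomp (cdiff X (-1)) g)); last exact: linear_ext.
  rewrite -xE /= -f_0.
  by apply/f_hot/in_degree0_boundary.
have [t|u uE] := chain_map_of_degree0 PX hX Y0 exY (x0 := x) (x1 := w).
  by rewrite -wE.
exists u => g; rewrite degree0_comp (_ : lcomp _ _ = lcomp x (degree0 g)).
  rewrite -xE /=; apply/f_ext/degree0_inj; exact: degree0K.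
by apply: linear_ext => t; apply: uE.
Qed.

End Functionals.

(** * Stalk complexes and approximations *)

Section Subcategories.

Variable R : pzRingType.
Implicit Types (X Y : complex R) (M N : lmodType R).

Lemma module_iso_of M N (f : {linear M -> N}) (g : {linear N -> M}) :
  cancel f g -> cancel g f -> module_iso M N.
Proof. by move=> fg gf; exists f; exists g. Qed.

Lemma stalk_term (P : lmodType R -> Prop) M m n :
  (forall M N, module_iso M N -> P M -> P N) -> (forall M, zero_module M -> P M) ->
  P M -> P (stalk M m n).
Proof.
move=> P_iso P_zero PM; have [<-|mn] := eqVneq m n; last exact/P_zero/stalk_zero.
apply: P_iso PM; apply: (@module_iso_of _ _ (stalk_in M m) (stalk_val M m m)) => x //.
exact: stalk_inK.
Qed.

Lemma fg_iso M N : module_iso M N -> finitely_generated M -> finitely_generated N.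
Proof.
move=> [f [g fg gf]] /fgP fgM; apply/fgP; apply: (fg_surj (f := f)) fgM => y.
by exists (g y).
Qed.

Lemma fg_zero M : zero_module M -> finitely_generated M.
Proof. by move=> M0; exists 0%N, (fun=> 0) => x; exists (fun=> 0); rewrite [x]M0 big_ord0. Qed.

Variables (C : lmodType R -> Prop) (hC : additive_karoubi_subcategory C).

(** The kernel of [r] is a complement of the image of [i], which exhibits [M] as a product with
    factor [N]. *)
Lemma subcat_retract M N (i : {linear N -> M}) (r : {linear M -> N}) :
  cancel i r -> C M -> C N.
Proof.
move=> ir CM.
have K0 : r 0 = 0 by apply: linear0.
have KP a x y : r x = 0 -> r y = 0 -> r (a *: x + y) = 0.
  by move=> x0 y0; rewrite linP x0 y0 scaler0 addr0.
pose K := @Submod R M _ K0 KP.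
have Kr x : K (x - i (r x)) by rewrite /= linearB ir subrr.
have flin : linear (fun x => (r x, in_submod (Kr x) : submod_type K)).
  move=> a x y; congr pair; first exact: linP.
  apply: submod_type_inj; rewrite /= (linP r) (linP i) opprD addrACA scalerBr.
  by [].
have glin : linear (fun s : (N * submod_type K)%type => i s.1 + submod_val K s.2).
  by move=> a s t; rewrite (linP i) (linP (submod_val K)) scalerDr addrACA.
apply: (subcat_summand hC (N := submod_type K)).
apply: (subcat_iso hC) CM; apply: (@module_iso_of _ _ (mklin flin) (mklin glin)).
  by move=> x /=; rewrite addrC subrK.
move=> [y z] /=; have rz : r (sval z) = 0 by apply: (submod_typeP z).
congr pair; first by rewrite linearD ir rz addr0.
by apply: submod_type_inj; rewrite /= linearD ir rz addr0 addrAC subrr add0r.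
Qed.

Lemma Kminus_stalk M m : C M -> Kminus C (stalk M m).
Proof.
move=> CM; split=> [n|]; first exact: stalk_term (subcat_iso hC) (subcat_zero hC) CM.
by exists m => n mn; apply: stalk_zero; rewrite lt_eqF.
Qed.

(** The degree 0 term of the approximation of [W] as a stalk complex. Homotopic maps between stalk
    complexes in degree 0 are equal, so factoring up to homotopy is factoring. *)
Lemma preenvelope : op_approximating C -> forall W, finitely_generated W ->
  exists (B : lmodType R) (p : {linear W -> B}), C B /\
     forall M, C M -> forall g : {linear W -> M},
       exists g' : {linear B -> M}, forall x, g x = g' (p x).
Proof.
move=> opC W fgW; have [|XC [e [[CX _] _ eP]]] := opC (stalk W 0).
  split=> [n|]; first exact: stalk_term fg_iso fg_zero fgW.
  by exists 0 => n n0; apply: stalk_zero; rewrite gt_eqF.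
exists (XC 0), (lcomp (e 0) (stalk_in W 0)); split=> // M CM g.
have dg x : cdiff (stalk M 0) 0 (lcomp (stalk_in M 0) g x) = 0.
  exact: submod_type_inj.
have [|/(_ (stalk_map dg)) [g' [h hP]] _] := eP (stalk M 0).
  split=> [n|]; first exact: stalk_term (subcat_iso hC) (subcat_zero hC) CM.
  by exists 0 => n n0; apply: stalk_zero; rewrite gt_eqF.
exists (lcomp (stalk_val M 0 0) (g' 0)) => x.
have := hP (-1) (stalk_in W 0 x).
rewrite [cdiff _ _ (stalk_in _ _ _)](_ : _ = 0); last exact: submod_type_inj.
rewrite [cdiff _ _ _](_ : _ = 0); last exact: submod_type_inj.
rewrite linear0 addr0 => /subr0_eq e1.
rewrite -[LHS](stalk_valK 0 (g x)); congr (stalk_val M 0 0 _).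
rewrite -[RHS]/((chain_comp g' e) 0 (stalk_in W 0 x)).
apply: (etrans _ (esym e1)); exact/esym/(stalk_mapE dg).
Qed.

Lemma null_stalk X M n (u : {linear M -> X (n + 1)})
    (du : forall x, cdiff X (n + 1) (u x) = 0) :
  homotopic (stalk_map du) (chain_zero _ _) ->
  exists w : {linear M -> X n}, forall x, u x = cdiff X n (w x).
Proof.
move=> [h hP]; exists (lcomp (h n) (stalk_in M (n + 1))) => x.
have := hP n (stalk_in M (n + 1) x); rewrite stalk_mapE subr0 => ->.
rewrite [cdiff _ _ (stalk_in _ _ _)](_ : _ = 0) ?linear0 ?addr0 //.
exact: submod_type_inj.
Qed.

(** A cocycle on [M] in degree [n + 1] is a map from a stalk complex, which is the shift of the
    stalk complex in degree [n + 2 <= 0]. *)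
Lemma exact_neg_of_T_ge0 (Y : Tcat C) : T_ge0 Y -> exact_neg C (sval Y).
Proof.
move=> Yge n n1 M CM u du.
have TS : T_le0 (exist (Kminus C) (stalk M (n + 1 + 1)) (Kminus_stalk (n + 1 + 1) CM)).
  exists (exist (Kminus C) (stalk M (n + 1 + 1)) (Kminus_stalk (n + 1 + 1) CM)).
    by move=> m m0; apply: stalk_zero; rewrite lt_eqF //=; lia.
  exists (chain_id _), (chain_id _); split; exact: eq_homotopic.
have kP m (x : shift (stalk M (n + 1 + 1)) m) :
    stalk_submod M (n + 1) m (stalk_val M (n + 1 + 1) (m + 1) x).
  by case: (submod_typeP x) => [/addIr|x0]; [left | right].
have klin m : linear (fun x => in_submod (kP m x) : stalk M (n + 1) m).
  by move=> a x y; apply: submod_type_inj.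
have kd m (x : shift (stalk M (n + 1 + 1)) m) :
    mklin (klin (m + 1)) (cdiff _ m x) = cdiff (stalk M (n + 1)) m (mklin (klin m) x).
  by apply: submod_type_inj; rewrite /= oppr0.
pose kap := ChainMap kd.
have [h hP] := Yge _ TS (chain_comp (stalk_map du) kap).
exists (lcomp (h n) (stalk_in M (n + 1 + 1))) => x.
have := hP n (stalk_in M (n + 1 + 1) x).
rewrite [cdiff (shift _) _ _](_ : _ = 0); last first.
  by apply: submod_type_inj; rewrite /= oppr0.
rewrite subr0 linear0 addr0 => <-; rewrite -(stalk_mapE du) /=; congr (stalk_fam _ _ _).
Qed.

End Subcategories.

Section Truncation.

Variable R : pzRingType.
Variables (C : lmodType R -> Prop) (hC : additive_karoubi_subcategory C).
Variables (X : complex R) (CX : Kminus C X).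
Hypothesis exX : forall n : int, 0 <= n -> exact_at C X n.

(* A contraction of [X] in positive degrees splits off the projection of [X] *)
(* onto its truncation.                                                      *)
Lemma positive_contraction : exists h : forall n, {linear X (n + 1) -> X n},
  forall n, if 0 <= n then
    forall x : X (n + 1), x = cdiff X n (h n x) + h (n + 1) (cdiff X (n + 1) x)
  else forall x, h n x = 0.
Proof.
have [PX [N XN]] := CX.
pose F n := {linear X (n + 1) -> X n}.
pose Q n (a : F n) (b : F (n + 1)) := if 0 <= n then
    forall x : X (n + 1), x = cdiff X n (a x) + b (cdiff X (n + 1) x)
  else forall x, a x = 0.
have [n Nn|n f nN fQ|h [_ hQ]] := @descending_family F Q N (fun n => \0); last first.
- by exists h.
- have [n0|n0] := boolP (0 <= n); last by exists \0; rewrite /Q ifN.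
  have [x|w wE] := exX n0 (PX (n + 1))
      (u := lin_sub idfun (lcomp (f (n + 1)) (cdiff X (n + 1)))).
    have := fQ (n + 1); rewrite /Q ifT; last by lia.
    move=> /(_ _ (cdiff X (n + 1) x)); rewrite cdiffK linear0 addr0 => fE.
    by rewrite /= linearB -fE ?subrr //; lia.
  by exists w; rewrite /Q ifT // => x; rewrite -wE /= subrK.
by rewrite /Q; case: ifP => // _ x; rewrite [x]XN ?linear0 ?addr0 //; lia.
Qed.

(** Degree 0 of the truncation is the kernel of the differential, which belongs to [C] because
    [x - h (d x)] retracts [X 0] onto it. *)
Lemma truncation : exists (X' : complex R) (i : chain_map X' X) (r : chain_map X X'),
  [/\ Kminus C X', in_nonpositive_degrees X',
      homotopic (chain_comp i r) (chain_id X) & homotopic (chain_comp r i) (chain_id X')].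
Proof.
have [h hP] := positive_contraction.
have [PX X_bound] := CX.
have P0 n : (0 <= n -> cdiff X n 0 = 0) /\ (0 < n -> 0 = 0 :> X n).
  by split=> // _; apply: linear0.
have PP n (a : R) (x y : X n) : (0 <= n -> cdiff X n x = 0) /\ (0 < n -> x = 0) ->
    (0 <= n -> cdiff X n y = 0) /\ (0 < n -> y = 0) ->
    (0 <= n -> cdiff X n (a *: x + y) = 0) /\ (0 < n -> a *: x + y = 0).
  move=> [dx x0] [dy y0]; split=> n0.
    by rewrite linP dx // dy // scaler0 addr0.
  by rewrite x0 // y0 // scaler0 addr0.
pose P n := @Submod R (X n) _ (P0 n) (@PP n).
have PD n x : P n x -> P (n + 1) (cdiff X n x).
  move=> [dx x0]; split=> [_|n0]; first exact: cdiffK.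
  by apply: dx; lia.
pose X' := subcomplex PD (fun n x _ => cdiffK x).
pose q n (x : X n) : X n :=
  if n < 0 then x else if n == 0 then x - h n (cdiff X n x) else 0.
have qlin n : linear (@q n).
  move=> a x y; rewrite /q; case: ifP => // _; case: ifP => _; last by rewrite scaler0 addr0.
  exact: (linP (lin_sub idfun (lcomp (h n) (cdiff X n)))).
have qP n x : P n (@q n x).
  rewrite /q; case: ifPn => n0; first by split=> n1; lia.
  case: ifP => n1; last exact: submod0.
  split=> n2; last by lia.
  have := hP n; rewrite ifT; last by lia.
  move=> /(_ (cdiff X n x)); rewrite cdiffK linear0 addr0 => dxE.
  by rewrite linearB -dxE subrr.
have q_id n x : P n x -> q n x = x.
  rewrite /q => -[dx x0]; case: ifPn => // n0; rewrite dx; last by lia.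
  by rewrite linear0 subr0; case: ifP => // n1; rewrite x0 //; lia.
have rlin n : linear (fun x => in_submod (qP n x) : submod_type (P n)).
  by move=> a x y; apply: submod_type_inj; apply: qlin.
have i_diff n (x : X' n) : submod_val (P (n + 1)) (cdiff X' n x) = cdiff X n (submod_val (P n) x).
  by [].
have r_diff n (x : X n) : mklin (rlin (n + 1)) (cdiff X n x) = cdiff X' n (mklin (rlin n) x).
  apply: submod_type_inj; rewrite /= /q.
  have [n0|n0] := ltP n 0.
    case: ifP => // n1; rewrite ifT; last by lia.
    by rewrite cdiffK linear0 subr0.
  have -> : (n + 1 < 0) = false by lia.
  have -> /= : (n + 1 == 0) = false by lia.
  have [n1|n1] := eqVneq n 0; last by rewrite linear0.
  have := hP n; rewrite n0 => /(_ (cdiff X n x)); rewrite cdiffK linear0 addr0 => dxE.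
  by rewrite linearB -dxE subrr.
exists X', (@ChainMap R X' X (fun n => submod_val (P n)) i_diff),
  (@ChainMap R X X' (fun n => mklin (rlin n)) r_diff); split.
- split=> [n|]; last first.
    have [N XN] := X_bound; exists N => n Nn x; apply: submod_type_inj; exact: XN.
  apply: (subcat_retract hC (i := submod_val (P n)) (r := mklin (rlin n))) => // x.
  by apply: submod_type_inj; apply/q_id/submod_typeP.
- by move=> n n0 x; apply: submod_type_inj; case: (submod_typeP x) => _; apply.
- exists (fun n => \- h n) => n x; rewrite /= /q.
  have [n1|n1] := ltP (n + 1) 0.
    have := hP n; rewrite ifF; last by lia.
    have := hP (n + 1); rewrite ifF; last by lia.
    by move=> -> ->; rewrite subrr subr0 oppr0 linear0.
  have [n2|n2] := eqVneq (n + 1) 0.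
    have := hP n; rewrite ifF; last by lia.
    by move=> ->; rewrite oppr0 linear0 add0r addrAC subrr add0r.
  have := hP n; rewrite ifT; last by lia.
  by move=> hE; rewrite sub0r linearN -opprD -hE.
by apply: eq_homotopic => n x; apply: submod_type_inj; apply/q_id/submod_typeP.
Qed.

End Truncation.

Section Shift.

Variable R : pzRingType.
Implicit Types X Y : complex R.

Fact shift_map_diff X Y (f : chain_map X Y) n (x : shift X n) :
  f (n + 1 + 1) (cdiff (shift X) n x) = cdiff (shift Y) n (f (n + 1) x).
Proof. by rewrite /= linearN cmap_diff. Qed.

Definition shift_map X Y (f : chain_map X Y) : chain_map (shift X) (shift Y) :=
  @ChainMap R (shift X) (shift Y) (fun n => f (n + 1)) (shift_map_diff f).

Lemma shift_map_homotopic X Y (f g : chain_map X Y) :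
  homotopic f g -> homotopic (shift_map f) (shift_map g).
Proof.
move=> [h hP]; exists (fun n => \- h (n + 1)) => n x.
by rewrite [LHS]hP /= linearN !linearN !opprK.
Qed.

End Shift.

(** * Objects of the two hearts *)

Section Hearts.

Variable R : pzRingType.
Implicit Types X Y : complex R.

Local Notation fgR := (@finitely_generated R).

Lemma H_A_nonpositive (X : Tcat fgR) : in_H_A X -> in_nonpositive_degrees (sval X).
Proof. by move=> [X0 _] n n0; apply: X0; lia. Qed.

(** No projectivity of [M] is needed: differentials out of degrees below -1 are injective, so lifts
    are unique, hence linear. *)
Lemma H_A_exact_neg (X : Tcat fgR) : in_H_A X -> exact_neg (fun=> True) (sval X).
Proof.
move=> [X0 exX] n n1 M _ u du.
have d_inj (m : int) : m < -1 -> forall x : sval X m, cdiff (sval X) m x = 0 -> x = 0.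
  rewrite -[m](subrK 1) => m1 x dx.
  have [|y ->] := exX (m - 1) _ x dx; first by lia.
  have [m2|m2] := eqVneq m (-2); last by rewrite [y]X0 ?linear0 //; lia.
  by rewrite [y]X0 ?linear0 //; lia.
have [||w wE] := @factor_inj _ M (sval X n) (sval X (n + 1)) (cdiff (sval X) n) u.
- by apply: linear_inj => x; apply: d_inj; lia.
- by move=> x; have [y yE] := exX n n1 (u x) (du x); exists y.
by exists w => x; rewrite wE.
Qed.

Lemma exact_neg_sub (P Q : lmodType R -> Prop) Y :
  (forall M, P M -> Q M) -> exact_neg Q Y -> exact_neg P Y.
Proof. by move=> PQ exY n n1 M /PQ QM; apply: exY. Qed.

Variables (C : lmodType R -> Prop) (hC : additive_karoubi_subcategory C).
Variable app : forall X : Tcat fgR, approximation C (sval X).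

(** Maps from objects of [K^-(C)] to the approximation are maps to [X]. From modules of [C] in
    positive degrees they vanish, so the approximation can be truncated; from shifts of nonpositive
    complexes they are null by comparison. *)
Lemma pi_in_H (X : Tcat fgR) : in_H_A X -> in_H_C (pi_functor app X).
Proof.
move=> HX; have X0 := H_A_nonpositive HX.
have [CXC _ eP] := apxP (app X); set XC := apx _ in CXC eP *; set e := apx_map _ in eP.
split.
  have [n n0 M CM u du|X' [i [r [CX' X'0 ir ri]]]] := truncation hC CXC.
    apply: (null_stalk (du := du)).
    have [_] := eP _ (Kminus_stalk hC (n + 1) CM); apply; apply: eq_homotopic.
    apply: stalk_map_ext => x; rewrite [LHS](X0 (n + 1)) ?[RHS](X0 (n + 1)) //; lia.
  by exists (exist _ X' CX') => //; exists r, i.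
move=> W [W' W'0 [a [b [ba _]]]] f.
have [CW [N WN]] := svalP W.
have KSW : Kminus C (shift (sval W)).
  by split=> [n|]; [apply: CW | exists N => n Nn; apply: WN; lia].
have [_] := eP _ KSW; apply.
have fb0 : homotopic (chain_comp (chain_comp e f) (shift_map b)) (chain_zero _ _).
  apply: (@homotopic_of_degree0 _ C _ _ _ _ \0).
  - by move=> n; case: (svalP W') => + _; apply.
  - by move=> n n0; apply: W'0; lia.
  - by apply: exact_neg_sub (H_A_exact_neg HX).
  move=> x; rewrite subr0 [RHS]linear0 [x](W'0 1) //.
  exact: (linear0 (chain_comp (chain_comp e f) (shift_map b) 0)).
apply: (@homotopic_trans _ _ _ _
  (chain_comp (chain_comp (chain_comp e f) (shift_map b)) (shift_map a))).
  apply: (@homotopic_trans _ _ _ _ (chain_comp (chain_comp e f) (shift_map (chain_comp b a)))).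
    apply: (@homotopic_trans _ _ _ _ (chain_comp (chain_comp e f) (shift_map (chain_id _)))).
      exact: eq_homotopic.
    apply: homotopic_comp; first exact: homotopic_refl.
    exact/shift_map_homotopic/homotopic_sym.
  exact: eq_homotopic.
apply: homotopic_trans (homotopic_comp fb0 (homotopic_refl _)) _.
by apply: eq_homotopic => n x /=; rewrite linear0.
Qed.

End Hearts.

Section PresentedComplex.

Variables (k : comPzRingType) (R : pzRingType) (phi : {rmorphism k -> R}).
Hypotheses (cen : central phi) (nk : noeth k^o) (fg_R : fg (res phi R^o)).

Section Construction.

Variables (Z1 Z0 : lmodType R) (d : {linear Z1 -> Z0}).

Local Notation A := (Z1 * Z0)%type.

Let P (n : int) (x : A) : Prop :=
  if n == 0 then x.1 = 0 else if n == -1 then x.2 = 0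
  else if n == -2 then x.2 = 0 /\ d x.1 = 0 else x = 0.

Fact presented_submod0 n : P n 0.
Proof.
rewrite /P; case: (n == 0) => //; case: (n == -1) => //; case: (n == -2) => //.
by split=> //; apply: linear0.
Qed.

Fact presented_submodP n a x y : P n x -> P n y -> P n (a *: x + y).
Proof.
case: x y => [x1 x2] [y1 y2]; rewrite /P /=; case: (n == 0) => [-> ->|].
  by rewrite scaler0 addr0.
case: (n == -1) => [-> ->|]; first by rewrite scaler0 addr0.
case: (n == -2) => [[-> dx] [-> dy]|-> ->]; last by rewrite scaler0 addr0.
by rewrite scaler0 addr0 linP dx dy scaler0 addr0.
Qed.

Let PS n := @Submod R A (P n) (@presented_submod0 n) (@presented_submodP n).

Let D (n : int) : {linear A -> A} :=
  if n == -1 then pair_lin (\0 : {linear A -> Z1}) (lcomp d (fst_lin Z1 Z0))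
  else if n == -2 then (idfun : {linear A -> A}) else (\0 : {linear A -> A}).

Fact presented_D n x : PS n x -> PS (n + 1) (D n x).
Proof.
rewrite /= /P /D; have [->|n1] := eqVneq n (-1); first by [].
have [->|n2] := eqVneq n (-2); first by case.
move=> _; exact: (presented_submod0 (n + 1)).
Qed.

Fact presented_DD n x : PS n x -> D (n + 1) (D n x) = 0.
Proof.
rewrite /= /P /D; have [->|n1] := eqVneq n (-1); first by [].
have [->|n2] := eqVneq n (-2); last by rewrite linear0.
by move=> [x2 dx] /=; rewrite dx.
Qed.

(** The complex ker d -> Z1 -> Z0 in degrees -2, -1, 0, cut out of the constant family of products
    of [Z1] and [Z0]; the differential from degree -2 is the inclusion. *)
Definition presented : complex R := @subcomplex R (fun=> A) D PS presented_D presented_DD.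

Lemma presented_Kminus : fg Z1 -> fg Z0 -> Kminus (@finitely_generated R) presented.
Proof.
move=> fg1 fg0; split=> [n|]; first by apply/fgP/(fg_submod nk fg_R)/fg_prod.
exists 0 => n n0 x; apply: submod_type_inj.
have := submod_typeP x; rewrite /= /P !ifF //; lia.
Qed.

Lemma presented_H_A (h : Kminus (@finitely_generated R) presented) :
  in_H_A (exist _ presented h).
Proof.
split=> /= n.
  move=> n0 x; apply: submod_type_inj.
  have := submod_typeP x; rewrite /= /P !ifF //; lia.
move=> n1 x dx.
have [e|n2] := eqVneq n (-2).
  move: x dx; rewrite e => x dx.
  have x2 : (submod_val (PS (-2 + 1)) x).2 = 0 by apply: (submod_typeP x).
  have dx1 : d (submod_val (PS (-2 + 1)) x).1 = 0.
    exact: (congr1 (fun y => (submod_val (PS (-2 + 1 + 1)) y).2) dx).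
  by exists (in_submod (conj x2 dx1 : PS (-2) _)); apply: submod_type_inj.
have x0 : x = 0.
  have [e|n3] := eqVneq n (-3).
    move: x dx; rewrite e => x dx; apply: submod_type_inj.
    exact: (congr1 (submod_val (PS (-3 + 1 + 1))) dx).
  apply: submod_type_inj; have := submod_typeP x; rewrite /= /P !ifF //; lia.
by exists 0; rewrite x0; symmetry; exact: (linear0 (cdiff presented n)).
Qed.

Fact presented_in0 (z : Z0) : PS 0 (0, z). Proof. by []. Qed.
Fact presented_in1 (z : Z1) : PS (-1) (z, 0). Proof. by []. Qed.

Fact presented_in0_linear : linear (fun z => in_submod (presented_in0 z) : presented 0).
Proof. by move=> a x y; apply: submod_type_inj; congr pair; rewrite /= scaler0 addr0. Qed.
Fact presented_in1_linear : linear (fun z => in_submod (presented_in1 z) : presented (-1)).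
Proof. by move=> a x y; apply: submod_type_inj; congr pair; rewrite /= scaler0 addr0. Qed.

Lemma presented_isos : exists (i1 : {linear Z1 -> presented (-1)})
    (j1 : {linear presented (-1) -> Z1}) (i0 : {linear Z0 -> presented 0}) (j0 : {linear presented 0 -> Z0}),
  [/\ cancel i1 j1, cancel j1 i1, cancel i0 j0, cancel j0 i0 &
     forall z, cdiff presented (-1) (i1 z) = i0 (d z)].
Proof.
exists (mklin presented_in1_linear), (lcomp (fst_lin Z1 Z0) (submod_val (PS (-1)))).
exists (mklin presented_in0_linear), (lcomp (snd_lin Z1 Z0) (submod_val (PS 0))).
split=> // [x|x|z].
- apply: submod_type_inj; have x2 : (sval x).2 = 0 by apply: (submod_typeP x).
  by rewrite /= [RHS]surjective_pairing x2.
- apply: submod_type_inj; have x1 : (sval x).1 = 0 by apply: (submod_typeP x).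
  by rewrite /= [RHS]surjective_pairing x1.
by apply: submod_type_inj.
Qed.

End Construction.

Variable E : lmodType k.

(** Serves to pass from [Z1] and [Z0] to the terms of [presented], which are only isomorphic to
    them. *)
Lemma presents_transport (P : lmodType R -> Prop) (B0 B1 Y1 Y0 Y1' Y0' : lmodType R)
    (beta : {linear B0 -> B1}) (d : {linear Y1 -> Y0}) (d' : {linear Y1' -> Y0'})
    (xi : {linear homk cen B0 Y0 -> E}) (i1 : {linear Y1 -> Y1'}) (j1 : {linear Y1' -> Y1})
    (i0 : {linear Y0 -> Y0'}) (j0 : {linear Y0' -> Y0}) :
  cancel j1 i1 -> cancel i0 j0 -> cancel j0 i0 -> (forall y, d' (i1 y) = i0 (d y)) ->
  presents P beta d xi -> presents P beta d' (xi \o postcomp cen B0 j0).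
Proof.
move=> ji1 ij0 ji0 di [xid xib xiker xiim].
split=> [y|z|X x PX x0|X f PX f0].
- rewrite -[RHS](xid (lcomp j1 y)); congr (xi _); apply: linear_ext => t /=.
  by rewrite -[in LHS](ji1 (y t)) di ij0.
- by rewrite -[RHS](xib (lcomp j0 z)); congr (xi _); apply: linear_ext.
- have [|w wE] := xiker X (lcomp j0 x) PX.
    by move=> g; rewrite -[RHS](x0 g); congr (xi _); apply: linear_ext.
  by exists (lcomp i1 w) => t; rewrite /= di -wE /= ji0.
have [x xE] := xiim X f PX f0; exists (lcomp i0 x) => g.
by rewrite xE; congr (xi _); apply: linear_ext => t /=; rewrite ij0.
Qed.

End PresentedComplex.

(** * The adjoint *)

Local Notation hom := Defs.hom.

Section UniversalArrows.

Variables (A B : category) (F : functor A B).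

Definition universal_arrow (Y : B) (Z : A) (eps : hom (F Z) Y) : Prop :=
  forall X : A,
    (forall g : hom (F X) Y, exists f : hom X Z, heq (hcomp eps (fmap F f)) g) /\
    (forall f f' : hom X Z,
       heq (hcomp eps (fmap F f)) (hcomp eps (fmap F f')) -> heq f f').

(** Chosen universal arrows form the counit; functoriality and the adjunction identities follow from
    uniqueness of factorisations. *)
Lemma quotient_functor_of_universal_arrows :
  (forall Y : B, exists (Z : A) (eps : hom (F Z) Y), is_iso eps /\ universal_arrow eps) ->
  is_quotient_functor F.
Proof.
move=> univ.
pose G Y := sval (cid (univ Y)).
pose eps Y : hom (F (G Y)) Y := sval (cid (svalP (cid (univ Y)))).
have epsP Y : is_iso (eps Y) /\ universal_arrow (eps Y).
  exact: (svalP (cid (svalP (cid (univ Y))))).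
pose tr X Y (g : hom (F X) Y) : hom X (G Y) := sval (cid (((epsP Y).2 X).1 g)).
have trP X Y (g : hom (F X) Y) : heq (hcomp (eps Y) (fmap F (tr X Y g))) g.
  exact: (svalP (cid (((epsP Y).2 X).1 g))).
have tr_inj X Y (f f' : hom X (G Y)) :
    heq (hcomp (eps Y) (fmap F f)) (hcomp (eps Y) (fmap F f')) -> heq f f'.
  exact: ((epsP Y).2 X).2.
have compl (X Y Z : B) (g g' : hom Y Z) (f : hom X Y) : heq g g' -> heq (hcomp g f) (hcomp g' f).
  by move=> gg'; apply: hcomp_heq => //; apply: heq_refl.
have compr (X Y Z : B) (g : hom Y Z) (f f' : hom X Y) : heq f f' -> heq (hcomp g f) (hcomp g f').
  by move=> ff'; apply: hcomp_heq => //; apply: heq_refl.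
have comp2 X Y Z (f : hom Y (G Z)) (g : hom X Y) :
    heq (hcomp (eps Z) (fmap F (hcomp f g)))
        (hcomp (hcomp (eps Z) (fmap F f)) (fmap F g)).
  by apply: heq_trans (compr _ _ _ _ _ _ (fmap_comp F f g)) (hcompA _ _ _).
pose Gmap Y Y' (g : hom Y Y') : hom (G Y) (G Y') := tr (G Y) Y' (hcomp g (eps Y)).
have Gheq Y Y' (g g' : hom Y Y') : heq g g' -> heq (Gmap Y Y' g) (Gmap Y Y' g').
  move=> gg'; apply: tr_inj; apply: heq_trans (trP _ _ _) _.
  by apply: heq_trans (compl _ _ _ _ _ _ gg') (heq_sym (trP _ _ _)).
have Gid Y : heq (Gmap Y Y (hid Y)) (hid (G Y)).
  apply: tr_inj; apply: heq_trans (trP _ _ _) _; apply: heq_trans (hcomp_idl _) _.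
  apply: heq_sym; apply: heq_trans (compr _ _ _ _ _ _ (fmap_id F _)) (hcomp_idr _).
have Gcomp Y Y' Y'' (g : hom Y' Y'') (f : hom Y Y') :
    heq (Gmap Y Y'' (hcomp g f)) (hcomp (Gmap Y' Y'' g) (Gmap Y Y' f)).
  apply: tr_inj; apply: heq_trans (trP _ _ _) _; apply: heq_sym.
  apply: heq_trans (comp2 _ _ _ _ _) _; apply: heq_trans (compl _ _ _ _ _ _ (trP _ _ _)) _.
  apply: heq_trans (heq_sym (hcompA _ _ _)) _.
  apply: heq_trans (compr _ _ _ _ _ _ (trP _ _ _)) _; exact: hcompA.
pose GF := Functor Gheq Gid Gcomp.
have unit_nat X X' (f : hom X X') : heq (hcomp (tr X' (F X') (hid (F X'))) f)
    (hcomp (fmap GF (fmap F f)) (tr X (F X) (hid (F X)))).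
  apply: tr_inj; apply: heq_trans (comp2 _ _ _ _ _) _.
  apply: heq_trans (compl _ _ _ _ _ _ (trP _ _ _)) _; apply: heq_trans (hcomp_idl _) _.
  apply: heq_sym; apply: heq_trans (comp2 _ _ _ _ _) _.
  apply: heq_trans (compl _ _ _ _ _ _ (trP _ _ _)) _.
  apply: heq_trans (heq_sym (hcompA _ _ _)) _.
  by apply: heq_trans (compr _ _ _ _ _ _ (trP _ _ _)) _; apply: hcomp_idr.
have counit_nat Y Y' (g : hom Y Y') :
    heq (hcomp g (eps Y)) (hcomp (eps Y') (fmap F (fmap GF g))).
  exact/heq_sym/trP.
have tri_l X : heq (hcomp (eps (F X)) (fmap F (tr X (F X) (hid (F X))))) (hid (F X)).
  exact: trP.
have tri_r Y : heq (hcomp (fmap GF (eps Y)) (tr (G Y) (F (G Y)) (hid (F (G Y)))))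
    (hid (G Y)).
  apply: tr_inj; apply: heq_trans (comp2 _ _ _ _ _) _.
  apply: heq_trans (compl _ _ _ _ _ _ (trP _ _ _)) _.
  apply: heq_trans (heq_sym (hcompA _ _ _)) _.
  apply: heq_trans (compr _ _ _ _ _ _ (trP _ _ _)) _; apply: compr.
  exact/heq_sym/fmap_id.
exists GF, (@Adjunction _ _ F GF (fun X => tr X (F X) (hid (F X))) eps
  unit_nat counit_nat tri_l tri_r) => Y.
exact: (epsP Y).1.
Qed.

End UniversalArrows.

Section Quotient.

Variables (k : comPzRingType) (R : pzRingType) (phi : {rmorphism k -> R}).
Variables (cen : central phi) (E : lmodType k).
Variables (B0 B1 : lmodType R) (beta : {linear B0 -> B1}).

Implicit Types (X Y W : complex R) (P : lmodType R -> Prop).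

Local Notation S0 := (stalk B0 0).
Local Notation S1 := (stalk B1 0).
Local Notation functional := (functional phi beta).
Local Notation represents := (represents phi beta).

Lemma functional_ext X (f : chain_map S0 X -> E) (g g' : chain_map S0 X) : functional f ->
  (forall n x, g n x = g' n x) -> f g = f g'.
Proof. by move=> ff gg'; apply/(functional_homotopic ff)/eq_homotopic. Qed.

Lemma functional_precomp W X (f : chain_map S0 X -> E) (u : chain_map W X) :
  functional f -> functional (fun g : chain_map S0 W => f (chain_comp u g)).
Proof.
move=> ff; split=> [g g' gg'|a g g' h hE|g].
- apply: (functional_homotopic ff); apply: homotopic_comp gg'; exact: homotopic_refl.
- by apply: (functional_linear ff) => n x /=; rewrite hE linP.
by rewrite -[RHS](functional_beta ff (chain_comp u g)); apply: functional_ext.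
Qed.

Fact chain_comb_diff X Y a (f g : chain_map X Y) n x :
  mklin (homk_comb_linear cen a 1 (f (n + 1)) (g (n + 1))) (cdiff X n x) =
  cdiff Y n (mklin (homk_comb_linear cen a 1 (f n) (g n)) x).
Proof. by rewrite /= !cmap_diff linearD !linZ. Qed.

Definition chain_comb X Y a (f g : chain_map X Y) : chain_map X Y :=
  ChainMap (chain_comb_diff a f g).

Lemma chain_comb_homotopic X Y a (f f' g g' : chain_map X Y) :
  homotopic f f' -> homotopic g g' -> homotopic (chain_comb a f g) (chain_comb a f' g').
Proof.
move=> [h hP] [h' h'P].
exists (fun n => mklin (homk_comb_linear cen a 1 (h n) (h' n))) => n x /=.
rewrite opprD addrACA -!scalerBr hP h'P linearD !linZ !scalerDr.
by rewrite addrACA.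
Qed.

(** Maps from the stalks of [B0] and [B1] lift along [e]. The chosen lifts are additive only up to
    homotopy, which functionals do not see. *)
Lemma functional_descend C X XC (e : chain_map XC X) (f : chain_map S0 XC -> E) :
  is_approximation C e -> Kminus C S0 -> Kminus C S1 -> functional f ->
  exists2 f' : chain_map S0 X -> E, functional f' &
    forall g, f' (chain_comp e g) = f g.
Proof.
move=> [_ _ eP] KS0 KS1 ff.
have [l lP] := choice (eP _ KS0).1; have l_inj := (eP _ KS0).2.
have lE g g' : homotopic (chain_comp e g') g -> f (l g) = f g'.
  move=> eg; apply/(functional_homotopic ff)/l_inj.
  exact: homotopic_trans (lP g) (homotopic_sym eg).
exists (fun g => f (l g)); last by move=> g; apply: lE; apply: homotopic_refl.
split=> [g g' gg'|a g g' h hE|g].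
- by apply: lE; apply: homotopic_trans (lP g') (homotopic_sym gg').
- rewrite (lE h (chain_comb a (l g) (l g'))).
    by apply: (functional_linear ff) => n x /=; rewrite rmorph1 scale1r.
  apply: (@homotopic_trans _ _ _ _ (chain_comb a g g')); last first.
    by apply: eq_homotopic => n x; rewrite hE /= rmorph1 scale1r.
  apply: homotopic_trans (chain_comb_homotopic a (lP g) (lP g')).
  by apply: eq_homotopic => n x /=; rewrite linearD !linZ.
have [g' g'P] := (eP _ KS1).1 g.
rewrite (lE _ (chain_comp g' (stalk_beta beta))); first exact: (functional_beta ff).
apply: (@homotopic_trans _ _ _ _ (chain_comp (chain_comp e g') (stalk_beta beta))).
  exact: eq_homotopic.
by apply: homotopic_comp g'P _; apply: homotopic_refl.
Qed.

(** Approximations are nonpositive only up to homotopy; a one-sided inverse suffices to carry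
    [represents] over to them. *)
Definition equivalent_to_nonpositive P W := exists (X : complex R) (r : chain_map W X)
    (i : chain_map X W),
  [/\ forall n, P (X n), in_nonpositive_degrees X & homotopic (chain_comp i r) (chain_id W)].

Lemma represents_equivalent P Y (xi : chain_map S0 Y -> E) W :
  represents P xi -> equivalent_to_nonpositive P W ->
  (forall u v : chain_map W Y,
     (forall g, xi (chain_comp u g) = xi (chain_comp v g)) -> homotopic u v) /\
  (forall f, functional f ->
     exists u : chain_map W Y, forall g, xi (chain_comp u g) = f g).
Proof.
move=> [fxi repr] [X [r [i [PX X0 ir]]]]; have [inj surj] := repr X PX X0.
have uir (u : chain_map W Y) : homotopic u (chain_comp (chain_comp u i) r).
  apply: (@homotopic_trans _ _ _ _ (chain_comp u (chain_comp i r))).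
    apply: (@homotopic_trans _ _ _ _ (chain_comp u (chain_id W))).
      exact: eq_homotopic.
    by apply: homotopic_comp (homotopic_sym ir); apply: homotopic_refl.
  exact: eq_homotopic.
split=> [u v uv|f ff].
  apply: homotopic_trans (uir u) _; apply: homotopic_trans _ (homotopic_sym (uir v)).
  apply: homotopic_comp; last exact: homotopic_refl.
  apply: inj => g; rewrite (functional_ext (g' := chain_comp u (chain_comp i g)) fxi) //.
  by rewrite uv; apply: functional_ext.
have [u uE] := surj _ (functional_precomp i ff).
exists (chain_comp u r) => g.
rewrite (functional_ext (g' := chain_comp u (chain_comp r g)) fxi) // uE.
apply: (functional_homotopic ff).
apply: (@homotopic_trans _ _ _ _ (chain_comp (chain_comp i r) g)); first exact: eq_homotopic.
apply: (@homotopic_trans _ _ _ _ (chain_comp (chain_id W) g)); last exact: eq_homotopic.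
by apply: homotopic_comp ir _; apply: homotopic_refl.
Qed.

End Quotient.

Section Isomorphisms.

Variable A : category.
Implicit Types X Y Z W : A.

Lemma left_inverse_comp X Y Z (f : Defs.hom X Y) (f' : Defs.hom Y X)
    (g : Defs.hom Y Z) (g' : Defs.hom Z Y) :
  heq (hcomp f' f) (hid X) -> heq (hcomp g' g) (hid Y) ->
  heq (hcomp (hcomp f' g') (hcomp g f)) (hid X).
Proof.
move=> ff gg; apply: heq_trans (heq_sym (hcompA _ _ _)) _.
apply: heq_trans _ ff; apply: hcomp_heq; first exact: heq_refl.
apply: heq_trans (hcompA _ _ _) _; apply: heq_trans _ (hcomp_idl f).
by apply: hcomp_heq gg (heq_refl _).
Qed.

Lemma left_inverse_cancel X Y Z (f : Defs.hom Y Z) (f' : Defs.hom Z Y) (u : Defs.hom X Y) :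
  heq (hcomp f' f) (hid Y) -> heq (hcomp f' (hcomp f u)) u.
Proof.
move=> ff; apply: heq_trans (hcompA _ _ _) _; apply: heq_trans _ (hcomp_idl u).
by apply: hcomp_heq ff (heq_refl _).
Qed.

End Isomorphisms.

(** * The universal arrow at an object of the heart *)

Section Adjoint.

Variables (k : comPzRingType) (R : pzRingType) (phi : {rmorphism k -> R}).
Variables (cen : central phi) (E : lmodType k).
Variables (B0 B1 : lmodType R) (beta : {linear B0 -> B1}).
Variables (C : lmodType R -> Prop) (hC : additive_karoubi_subcategory C).

Local Notation fgR := (@finitely_generated R).

Variable app : forall X : Tcat fgR, approximation C (sval X).

Local Notation S0 := (stalk B0 0).
Local Notation represents := (represents phi beta).
Local Notation pi := (pi_map app).

Hypotheses (CB0 : C B0) (CB1 : C B1).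

Lemma pi_equivalent (P : lmodType R -> Prop) (X : Tcat fgR) : (forall M, C M -> P M) ->
  in_H_A X -> equivalent_to_nonpositive P (apx (app X)).
Proof.
move=> CP HX; have [[Y Y0 [r [i [ir _]]]] _] := pi_in_H hC app HX.
exists (sval Y), r, i; split=> // n; apply: CP.
by case: (svalP Y) => + _; apply.
Qed.

Variables (Y : Tcat C) (Z : Tcat fgR).
Hypotheses (Y0 : in_nonpositive_degrees (sval Y)) (HZ : in_H_A Z).
Variables (xi : chain_map S0 (sval Y) -> E) (zeta : chain_map S0 (sval Z) -> E).
Hypotheses (repY : represents C xi) (repZ : represents fgR zeta).

Let e (X : Tcat fgR) : chain_map (apx (app X)) (sval X) := apx_map (app X).
Let KS0 := Kminus_stalk hC 0 CB0.
Let KS1 := Kminus_stalk hC 0 CB1.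
Let C_fg := subcat_fg hC.
Let fxi := repY.1.
Let fzeta := repZ.1.
Let eP X := apxP (app X).

Let compl (U V W : complex R) (g g' : chain_map V W) (f : chain_map U V) :
  homotopic g g' -> homotopic (chain_comp g f) (chain_comp g' f).
Proof. by move=> gg'; apply: homotopic_comp gg' (homotopic_refl _). Qed.

Let compr (U V W : complex R) (g : chain_map V W) (f f' : chain_map U V) :
  homotopic f f' -> homotopic (chain_comp g f) (chain_comp g f').
Proof. exact: homotopic_comp (homotopic_refl _). Qed.

Let compA (U V W T : complex R) (h : chain_map W T) (g : chain_map V W) (f : chain_map U V) :
  homotopic (chain_comp h (chain_comp g f)) (chain_comp (chain_comp h g) f).
Proof. exact: eq_homotopic. Qed.

Let xiA (V W : complex R) (h : chain_map W (sval Y)) (g : chain_map V W) (f : chain_map S0 V) :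
  xi (chain_comp (chain_comp h g) f) = xi (chain_comp h (chain_comp g f)).
Proof. exact/(functional_homotopic fxi)/homotopic_sym/compA. Qed.

Let zetaA (V W : complex R) (h : chain_map W (sval Z)) (g : chain_map V W) (f : chain_map S0 V) :
  zeta (chain_comp (chain_comp h g) f) = zeta (chain_comp h (chain_comp g f)).
Proof. exact/(functional_homotopic fzeta)/homotopic_sym/compA. Qed.

Let zeta_hot (V : complex R) (h h' : chain_map V (sval Z)) (f : chain_map S0 V) :
  homotopic h h' -> zeta (chain_comp h f) = zeta (chain_comp h' f).
Proof. by move=> hh'; apply/(functional_homotopic fzeta)/compl. Qed.

(** [zeta], restricted along the approximation of [Z], is a functional, and [Y] represents it. *)
Lemma exists_counit : exists eps : chain_map (apx (app Z)) (sval Y),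
  forall g, xi (chain_comp eps g) = zeta (chain_comp (e Z) g).
Proof.
have [_] := represents_equivalent repY (pi_equivalent (fun=> id) HZ); apply.
exact: functional_precomp.
Qed.

Variable eps : chain_map (apx (app Z)) (sval Y).
Hypothesis epsP : forall g, xi (chain_comp eps g) = zeta (chain_comp (e Z) g).

(** As the terms of [Y] are finitely generated, [repZ] turns the functional [xi] into a map
    [Y -> Z], which lifts to the approximation of [Z]. *)
Lemma counit_iso : exists j : chain_map (sval Y) (apx (app Z)),
  homotopic (chain_comp j eps) (chain_id _) /\ homotopic (chain_comp eps j) (chain_id _).
Proof.
have CY n : C (sval Y n) by case: (svalP Y) => + _; apply.
have [_] := repZ.2 _ (fun n => C_fg (CY n)) Y0.
case/(_ _ fxi) => j' j'E.
have [_ _ /(_ _ (svalP Y)) [/(_ j') [j jE] _]] := eP Z.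
exists j; split.
  have [_ _ /(_ _ (svalP (pi_obj app Z))) [_]] := eP Z; apply.
  have [inj _] := represents_equivalent repZ (pi_equivalent C_fg HZ); apply: inj => g.
  rewrite zetaA (_ : zeta (chain_comp _ (chain_comp (chain_comp j eps) g)) =
    zeta (chain_comp j' (chain_comp eps g))).
    by rewrite j'E epsP; apply: (functional_ext fzeta).
  rewrite -(zeta_hot _ jE) zetaA; apply: (functional_homotopic fzeta).
  exact/compr/homotopic_sym/compA.
have [inj _] := repY.2 _ CY Y0; apply: inj => g.
rewrite xiA epsP -zetaA (zeta_hot _ jE) j'E.
exact: (functional_ext fxi).
Qed.

(** Both kinds of maps are functionals: those to [Z] by [repZ], those from the approximation of [X]
    to [Y] by [repY]; [functional_descend] identifies the functionals. *)
Lemma counit_universal (X : Tcat fgR) : in_H_A X ->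
  (forall psi : chain_map (apx (app X)) (sval Y), exists f : chain_map (sval X) (sval Z),
     homotopic (chain_comp eps (@pi X Z f)) psi) /\
  (forall f f' : chain_map (sval X) (sval Z),
     homotopic (chain_comp eps (@pi X Z f)) (chain_comp eps (@pi X Z f')) ->
     homotopic f f').
Proof.
move=> HX.
have fgX n : finitely_generated (sval X n) by case: (svalP X) => + _; apply.
have [injZ surjZ] := repZ.2 _ fgX (H_A_nonpositive HX).
have piE f g : xi (chain_comp (chain_comp eps (@pi X Z f)) g) =
    zeta (chain_comp f (chain_comp (e X) g)).
  by rewrite xiA epsP -!zetaA; apply/zeta_hot/pi_mapP.
split=> [psi|f f' ff'].
  have [l fl lE] := functional_descend cen (eP X) KS0 KS1 (functional_precomp psi fxi).
  have [f fE] := surjZ l fl; exists f.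
  have [inj _] := represents_equivalent repY (pi_equivalent (fun=> id) HX).
  by apply: inj => g; rewrite piE fE lE.
apply: injZ => g.
have [_ _ /(_ _ KS0) [/(_ g) [g' g'E] _]] := eP X.
have zg h : zeta (chain_comp h g) = zeta (chain_comp h (chain_comp (e X) g')).
  by apply/(functional_homotopic fzeta)/compr/homotopic_sym.
by rewrite !zg -!piE; apply/(functional_homotopic fxi)/compl.
Qed.

End Adjoint.

Theorem theorem4p5 (R : pzRingType) (hR : artin_algebra R)
    (C : lmodType R -> Prop) (hC : additive_karoubi_subcategory C)
    (hfin : functorially_finite C)
    (app : forall X : Tcat (@finitely_generated R), approximation C (sval X)) :
  exists hpi : forall X : Tcat (@finitely_generated R),
                 in_H_A X -> in_H_C (pi_functor app X),
    is_quotient_functor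
      (restrict_functor hpi : functor (H_A R) (H_C C)).
Proof.
have [k [phi [artin_k cen [n [r rP]]]]] := hR.
have fgR : fg (res phi R^o).
  by exists 'I_n, r; split=> // x _; have [c ->] := rP x; exists c.
have [nk [E dE]] := exists_dualizing artin_k.
exists (pi_in_H hC app); apply: quotient_functor_of_universal_arrows.
(* [Y] is only isomorphic to a nonpositive complex. The construction is made for [Y'], and [a] and
   [b] carry it back. *)
move=> [Y [[Y' Y'0 [a [b [ba ab]]]] Yge]].
have C_fg M : C M -> fg M by move=> /(subcat_fg hC)/fgP.
have CY' m : C (sval Y' m) by case: (svalP Y') => + _; apply.
have Y'ge : T_ge0 Y'.
  move=> W WT f; apply: (@homotopic_trans _ _ _ _ (chain_comp (chain_comp a b) f)).
    apply: (@homotopic_trans _ _ _ _ (chain_comp (chain_id _) f)); first exact: eq_homotopic.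
    by apply: homotopic_comp (homotopic_refl _); apply: homotopic_sym.
  apply: (@homotopic_trans _ _ _ _ (chain_comp a (chain_comp b f))); first exact: eq_homotopic.
  apply: homotopic_trans (homotopic_comp (homotopic_refl a) (Yge W WT (chain_comp b f))) _.
  by apply: eq_homotopic => m x; rewrite /= linear0.
have [|B0 [B1 [beta [xi0 [CB0 CB1 presY]]]]] := exists_copresentation cen nk fgR dE
    (cdiff (sval Y') (-1) : {linear sval Y' (-1) -> sval Y' 0})
    C_fg _ (C_fg _ (CY' (-1))) (C_fg _ (CY' 0)).
  by move=> W /fgP; apply: (preenvelope hC hfin.2).
have [Z1 [Z0 [d [ze [fg1 fg0 presZ]]]]] :=
  exists_presentation cen nk fgR dE beta (C_fg _ CB0) (C_fg _ CB1).
pose Z : Tcat (@finitely_generated R) := exist _ _ (presented_Kminus nk fgR d fg1 fg0).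
have HZ : in_H_A Z := presented_H_A (presented_Kminus nk fgR d fg1 fg0).
have [i1 [j1 [i0 [j0 [_ ji1 ij0 ji0 di]]]]] := presented_isos d.
have repY := presents_represents Y'0 (exact_neg_of_T_ge0 hC Y'ge) presY.
have repZ := presents_represents (H_A_nonpositive HZ) (H_A_exact_neg HZ)
  (presents_transport (d' := cdiff (sval Z) (-1)) ji1 ij0 ji0 di presZ).
have {}repZ : represents phi beta (@finitely_generated R)
    (fun g => (ze \o postcomp cen B0 j0) (degree0 g)).
  by split=> [|X _ X0]; [exact: repZ.1 | exact: repZ.2].
have [eps epsP] := exists_counit hC app HZ repY repZ.
have [j [jeps epsj]] := counit_iso hC (app := app) Y'0 HZ repY repZ epsP.
(* [eps] ends at [Y'], and [b] continues it to [Y]. *)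
exists (exist _ Z HZ), (chain_comp b eps); split.
  exists (chain_comp j a); split.
    exact: (@left_inverse_comp (homotopy_category R) _ _ _ eps j b a).
  exact: (@left_inverse_comp (homotopy_category R) _ _ _ a b j eps).
move=> [X HX]; have [surj inj] := counit_universal (Z := Z) cen hC CB0 CB1 repY repZ epsP HX.
have compA (U V W T : complex R) (h : chain_map W T) (g : chain_map V W) (f : chain_map U V) :
    homotopic (chain_comp (chain_comp h g) f) (chain_comp h (chain_comp g f)).
  exact: eq_homotopic.
split=> [g|f f' ff'].
  have [f fE] := surj (chain_comp a g); exists f.
  apply: homotopic_trans (compA _ _ _ _ _ _ _) _.
  apply: homotopic_trans (homotopic_comp (homotopic_refl b) fE) _.
  exact: (@left_inverse_cancel (homotopy_category R) _ _ _ a b g).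
apply: inj.
have cancel_b := fun u => @left_inverse_cancel (homotopy_category R) _ _ _ b a u ab.
apply: homotopic_trans (homotopic_sym (cancel_b _ _)) _.
apply: homotopic_trans _ (cancel_b _ _); apply: homotopic_comp (homotopic_refl a) _.
apply: homotopic_trans (homotopic_sym (compA _ _ _ _ _ _ _)) _.
exact: homotopic_trans ff' (compA _ _ _ _ _ _ _).
Qed.
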